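(* For any $d\ge1$ and any positive function $\theta$ in $H^2(\mathbf{T}^d)$, $$\int_{\mathbf{T}^d}\big|\nabla\theta^{1/2}\big|^4\,dx\le\frac{9}{16}\int_{\mathbf{T}^d}(\Delta\theta)^2\,dx .$$
   Context: $\mathbf{T}^d$ is a $d$-dimensional (flat) torus and $H^2(\mathbf{T}^d)$ is the usual real-valued Sobolev space. *)

(* Defs.v *)
From HB Require Import structures.
From mathcomp Require Import all_boot all_order all_algebra.
From mathcomp Require Import all_classical all_reals all_analysis.

Set Implicit Arguments.
Unset Strict Implicit.
Unset Printing Implicit Defensive.

Import Order.TTheory GRing.Theory Num.Theory.
Import numFieldNormedType.Exports.

Local Open Scope classical_set_scope.
Local Open Scope ring_scope.

Definition tuple_cons (R : realType) (n : nat) 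
    (p : measurableTypeR R * n.-tuple R) : n.+1.-tuple R := [tuple of p.1 :: p.2].

Lemma measurable_tuple_cons (R : realType) (n : nat) :
  measurable_fun [set: measurableTypeR R * n.-tuple R] (@tuple_cons R n).
Proof. by apply: measurable_cons. Qed.

HB.instance Definition _ (R : realType) (n : nat) :=
  isMeasurableFun.Build _ _ _ _ (@tuple_cons R n) (@measurable_tuple_cons R n).

(* Lebesgue measure on the unit cube [0, 1]^n, carried by R^n, as the iterated
   product of Lebesgue measure on [0, 1]. *)
Fixpoint cube (R : realType) (n : nat) : probability (n.-tuple R) R :=
  if n is m.+1 then
    distribution (uniform_prob (@ltr01 R) \x cube R m)%E (@tuple_cons R m)
  else \d_([tuple] : 0.-tuple R).

(* The flat torus is R^d / L where L is the lattice spanned by the rows of an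
   invertible matrix A.  Functions on it are L-periodic functions on R^d, and
   it is parametrized, up to a null set one-to-one, by the unit cube through
   y |-> y *m A, which multiplies volumes by `|\det A|. *)
Definition torus_pt (R : realType) (d : nat) (A : 'M[R]_d) (y : d.-tuple R) :
  'rV[R]_d := (\row_i tnth y i) *m A.

Definition torus_measure (R : realType) (d : nat) (A : 'M[R]_d) :
    {measure set (d.-tuple R) -> \bar R} :=
  mscale (`|\det A|%:nng) (cube R d).

Definition periodic (R : realType) (d : nat) (A : 'M[R]_d)
    (u : 'rV[R]_d -> R) : Prop :=
  forall i x, u (x + row i A) = u x.

Definition torus_Lp (R : realType) (d : nat) (A : 'M[R]_d) (p : \bar R)
    (u : 'rV[R]_d -> R) : Prop :=
  periodic A u /\ u \o torus_pt A \in Lfun (torus_measure A) p.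

Definition partial (R : realType) (d : nat) (s : seq 'I_d)
    (f : 'rV[R]_d -> R) : 'rV[R]_d -> R :=
  foldr (fun i g => 'D_(delta_mx 0 i) g) f s.

Definition smooth (R : realType) (d : nat) (f : 'rV[R]_d -> R) : Prop :=
  forall s x, differentiable (partial s f) x.

Definition weak_partial (R : realType) (d : nat) (A : 'M[R]_d) (s : seq 'I_d)
    (u v : 'rV[R]_d -> R) : Prop :=
  [/\ torus_Lp A 1%:E u, torus_Lp A 1%:E v &
    forall phi, smooth phi -> periodic A phi ->
      \int[torus_measure A]_y
        (u (torus_pt A y) * partial s phi (torus_pt A y)) =
      (-1) ^+ size s *
      \int[torus_measure A]_y (v (torus_pt A y) * phi (torus_pt A y))].

Definition sobolev_H (R : realType) (d : nat) (A : 'M[R]_d) (k : nat)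
    (u : 'rV[R]_d -> R) : Prop :=
  torus_Lp A 2%:E u /\
  forall s : seq 'I_d, (size s <= k)%N ->
    exists v, torus_Lp A 2%:E v /\ weak_partial A s u v.

Definition weak_gradient (R : realType) (d : nat) (A : 'M[R]_d)
    (u : 'rV[R]_d -> R) (G : 'rV[R]_d -> 'rV[R]_d) : Prop :=
  forall i, weak_partial A [:: i] u (fun x => G x 0 i).

Definition weak_laplacian (R : realType) (d : nat) (A : 'M[R]_d)
    (u L : 'rV[R]_d -> R) : Prop :=
  exists H : 'I_d -> 'rV[R]_d -> R,
    (forall i, weak_partial A [:: i; i] u (H i)) /\
    forall x, L x = \sum_i H i x.

(* The norm `|v| on 'rV[R]_d is the sup norm. *)
Definition euclidean_norm (R : realType) (d : nat) (v : 'rV[R]_d) : R :=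
  Num.sqrt (\sum_i v 0 i ^+ 2).

(* Main.v *)
From HB Require Import structures.
Require Import Defs.
From mathcomp Require Import all_boot all_order all_algebra.
From mathcomp Require Import all_classical all_reals all_analysis.
From mathcomp Require Import measurable_realfun ring lra.
Import Order.TTheory GRing.Theory Num.Theory.
Import numFieldNormedType.Exports.
Local Open Scope classical_set_scope.
Local Open Scope ring_scope.

(** If [u] is smooth and [u >= e > 0], then integrating the divergence of
    [|grad u|^2 grad u / u] to zero and using AM-GM gives
    [int (|grad u|^2 / u)^2 <= 3 int (lap u)^2 + 6 int |hess u|^2], and the last
    integral equals [int (lap u)^2] on the torus.

    A function of H^2 is convolved with the kernels
    [prod_i c_n (1 + cos (2 pi y_i))^n] in the lattice coordinates [y_i].  By the
    addition formulas these separate variables, so a convolution is a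
    trigonometric polynomial; by the definition of weak derivatives, with the
    kernel as a test function, its derivatives are the convolutions of the weak
    derivatives.  The convolutions converge in L^1 and contract L^2.  Fatou's
    lemma passes to the limit in the inequality, [grad theta / (2 sqrt theta)]
    is identified as the weak gradient of [sqrt theta] through
    [sqrt (theta + e)], and weak gradients are unique because two of them have
    the same convolutions. *)

Set Implicit Arguments.
Unset Strict Implicit.
Unset Printing Implicit Defensive.

(** * Oscillation against doubly stochastic kernels *)

(** Two defects shape the argument. The function has no positive lower bound, while the divergence
    identity divides by [u]; and the Hessian identity differentiates three times, beyond H^2. Both
    are cured by [u = 1/(n+1) + convolution], where the added constant changes no derivative.

    Trigonometric polynomials are convenient because smoothness, symmetry of second derivatives and
    separation of translated variables are inductions on their construction. A convolution is then a
    finite sum, so nothing is differentiated under an integral sign. The L^1 convergence is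
    controlled by a double integral without cancellation, the oscillation, because it splits over
    the factors of a product and so reduces to the circle.

    The constant is [(3 + 6) / 16]: the 16 is the square of the 4 in [|grad (sqrt theta)|^2 = |grad
    theta|^2 / (4 theta)]. The estimate on [|grad theta|^2 / theta] must precede the existence of
    the gradient of the root: it is what makes [grad theta / (2 sqrt theta)] integrable and lets [e]
    tend to 0. *)

Section oscillation.
Context {d : measure_display} {T : measurableType d} {R : realType}.
Variable mu : probability T R.
Local Open Scope ereal_scope.

(** Both marginals are normalised: integrating out the second variable makes [k] an averaging
    operator that fixes constants, and integrating out the first gives the bounds in L^1 and L^2. *)
Definition doubly_stochastic (k : T * T -> R) : Prop :=
  [/\ measurable_fun setT k, forall p, (0 <= k p)%R,
      forall x, \int[mu]_y (k (x, y))%:E = 1 &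
      forall y, \int[mu]_x (k (x, y))%:E = 1].

(** It dominates the L^1 distance from [f] to its average against [k]. Having the absolute value
    inside makes it subadditive in [f] and compatible with product kernels. *)
Definition oscillation (k : T * T -> R) (f : T -> R) : \bar R :=
  \int[mu \x mu]_p (k p * `|f p.1 - f p.2|)%:E.

Definition approximate_identity (k : nat -> T * T -> R) : Prop :=
  (forall n, doubly_stochastic (k n)) /\
  forall f, mu.-integrable setT (EFin \o f) ->
    oscillation (k n) f @[n --> \oo] --> 0.

Lemma oscillation_ge0 k f : (forall p, 0 <= k p)%R -> 0 <= oscillation k f.
Proof. by move=> k0; apply: integral_ge0 => p _; rewrite lee_fin mulr_ge0. Qed.

Lemma measurable_oscillation (k : T * T -> R) (f : T -> R) :
  measurable_fun setT k -> measurable_fun setT f ->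
  measurable_fun setT (EFin \o fun p : T * T => (k p * `|f p.1 - f p.2|)%R).
Proof.
move=> mk mf; apply/measurable_EFinP/measurable_funM => //.
by apply: measurableT_comp => //; apply: measurable_funB; exact: measurableT_comp.
Qed.

Variables (k : T * T -> R) (hk : doubly_stochastic k).

Let mk : measurable_fun setT k. Proof. by case: hk. Qed.
Let k0 p : (0 <= k p)%R. Proof. by case: hk. Qed.

Lemma stochastic_integral1 f : measurable_fun setT f -> (forall x, 0 <= f x) ->
  \int[mu \x mu]_p ((k p)%:E * f p.1) = \int[mu]_x f x.
Proof.
move=> mf f0; case: hk => _ _ k1 _; rewrite fubini_tonelli1//=; last 2 first.
- by apply: emeasurable_funM; [exact/measurable_EFinP|exact: measurableT_comp].
- by move=> p; rewrite mule_ge0// lee_fin.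
apply: eq_integral => x _; rewrite /fubini_F/=.
rewrite ge0_integralZr//; first by rewrite k1 mul1e.
- by apply/measurable_EFinP; exact: measurableT_comp.
- by move=> y _; rewrite lee_fin.
Qed.

Lemma stochastic_integral2 f : measurable_fun setT f -> (forall x, 0 <= f x) ->
  \int[mu \x mu]_p ((k p)%:E * f p.2) = \int[mu]_x f x.
Proof.
move=> mf f0; case: hk => _ _ _ k2; rewrite fubini_tonelli2//=; last 2 first.
- by apply: emeasurable_funM; [exact/measurable_EFinP|exact: measurableT_comp].
- by move=> p; rewrite mule_ge0// lee_fin.
apply: eq_integral => y _; rewrite /fubini_G/=.
rewrite ge0_integralZr//; first by rewrite k2 mul1e.
- by apply/measurable_EFinP; exact: measurableT_comp.
- by move=> x _; rewrite lee_fin.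
Qed.

(** Each of [|f x|] and [|f y|] sees only one marginal of [k], which is 1. The bound is uniform in
    the kernel, so it serves both as a dominating function and in density arguments. *)
Lemma le_oscillation_norm f : measurable_fun setT f ->
  oscillation k f <= 2%:E * \int[mu]_x `|f x|%:E.
Proof.
move=> mf; have mnf : measurable_fun setT (EFin \o (fun x => `|f x|%R)).
  by apply/measurable_EFinP/measurableT_comp.
rewrite (_ : 2%:E = 1 + 1) ; last by rewrite -EFinD.
rewrite ge0_muleDl// mul1e -[X in _ <= X + _]stochastic_integral1//.
rewrite -[X in _ <= _ + X]stochastic_integral2//.
have mk1 : measurable_fun setT (fun p : T * T => (k p)%:E * `|f p.1|%:E).
  by apply: emeasurable_funM; [exact/measurable_EFinP|exact: (measurableT_comp mnf)].
have mk2 : measurable_fun setT (fun p : T * T => (k p)%:E * `|f p.2|%:E).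
  by apply: emeasurable_funM; [exact/measurable_EFinP|exact: (measurableT_comp mnf)].
rewrite -ge0_integralD//; last 2 first.
- by move=> p _; rewrite mule_ge0// lee_fin.
- by move=> p _; rewrite mule_ge0// lee_fin.
apply: ge0_le_integral => //.
- by move=> x _; rewrite lee_fin mulr_ge0.
- exact: measurable_oscillation.
- exact: emeasurable_funD.
by move=> y _; rewrite -!EFinM -EFinD lee_fin -mulrDr ler_wpM2l// ler_normB.
Qed.

Lemma le_oscillationD f g : measurable_fun setT f -> measurable_fun setT g ->
  oscillation k f <= oscillation k g + oscillation k (f \- g)%R.
Proof.
move=> mf mg; rewrite /oscillation -ge0_integralD//; last 4 first.
- by move=> p _; rewrite lee_fin mulr_ge0.
- exact: measurable_oscillation.
- by move=> p _; rewrite lee_fin mulr_ge0.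
- by apply: measurable_oscillation => //; exact: measurable_funB.
apply: ge0_le_integral => //.
- by move=> p _; rewrite lee_fin mulr_ge0.
- exact: measurable_oscillation.
- apply: emeasurable_funD; apply: measurable_oscillation => //.
  exact: measurable_funB.
move=> p _; rewrite -EFinD lee_fin -mulrDr ler_wpM2l//=.
rewrite (_ : f p.1 - f p.2 = (g p.1 - g p.2) + (f p.1 - g p.1 - (f p.2 - g p.2)))%R.
  exact: ler_normD.
by ring.
Qed.

End oscillation.

(** * Approximate identities under a change of variables *)

Section oscillation_pushforward.
Context {d d' : measure_display} {T : measurableType d} {T' : measurableType d'}
  {R : realType} (mu : probability T R) (phi : {RV mu >-> T'}).
Local Open Scope ereal_scope.

(** A double integral against an image measure is the double integral of the composed function. This
    matches the recursive definition of [cube] as the image of a product measure. *)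
Lemma approximate_identity_distribution (K : nat -> T' * T' -> R) :
  (forall n, measurable_fun setT (K n)) -> (forall n p, 0 <= K n p)%R ->
  (forall n x, \int[distribution mu phi]_y (K n (x, y))%:E = 1) ->
  (forall n y, \int[distribution mu phi]_x (K n (x, y))%:E = 1) ->
  approximate_identity mu (fun n p => K n (phi p.1, phi p.2)) ->
  approximate_identity (distribution mu phi) K.
Proof.
move=> mK K0 K1 K2 [_ ai]; split=> // f intf.
have mf : measurable_fun setT f by move/integrableP: intf => [/measurable_EFinP].
have : mu.-integrable setT (EFin \o (f \o phi)).
  move/integrableP: intf => [_ fi]; apply/integrableP; split.
    by apply/measurable_EFinP/measurableT_comp.
  move: fi; rewrite ge0_integral_distribution//.
  by apply/measurableT_comp => //; exact/measurable_EFinP.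
move/ai; apply: cvg_trans; apply: near_eq_cvg; apply: nearW => n.
have Kf0 p : 0 <= (K n p * `|f p.1 - f p.2|)%:E by rewrite lee_fin mulr_ge0.
have mKf := measurable_oscillation (mK n) mf.
have mpp : measurable_fun setT (fun p : T * T => (phi p.1, phi p.2)).
  by apply: measurable_fun_pair; exact: measurableT_comp.
rewrite /oscillation !fubini_tonelli1//=; last first.
  exact: (measurableT_comp mKf mpp).
rewrite ge0_integral_distribution//=; last 2 first.
- exact: measurable_fun_fubini_tonelli_F.
- by move=> x; exact: integral_ge0.
apply: eq_integral => x _; rewrite /fubini_F ge0_integral_distribution//.
by apply: (measurableT_comp mKf); exact: measurable_pair1.
Qed.

End oscillation_pushforward.

(** * Approximate identities on product spaces *)

Section oscillation_product.
Context {d1 d2 : measure_display} {T1 : measurableType d1}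
  {T2 : measurableType d2} {R : realType}
  (mu1 : probability T1 R) (mu2 : probability T2 R).
Local Open Scope ereal_scope.

Definition tensor_kernel (k1 : T1 * T1 -> R) (k2 : T2 * T2 -> R)
    (p : (T1 * T2) * (T1 * T2)) : R :=
  (k1 (p.1.1, p.2.1) * k2 (p.1.2, p.2.2))%R.

Lemma measurable_tensor_kernel k1 k2 :
  measurable_fun setT k1 -> measurable_fun setT k2 ->
  measurable_fun setT (tensor_kernel k1 k2).
Proof.
move=> mk1 mk2; apply: measurable_funM.
- apply: (measurableT_comp mk1); apply: measurable_fun_pair.
    by apply: measurableT_comp => //; exact: measurable_fst.
  by apply: measurableT_comp => //; exact: measurable_snd.
- apply: (measurableT_comp mk2); apply: measurable_fun_pair.
    by apply: measurableT_comp => //; exact: measurable_fst.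
  by apply: measurableT_comp => //; exact: measurable_snd.
Qed.

Lemma doubly_stochastic_tensor k1 k2 :
  doubly_stochastic mu1 k1 -> doubly_stochastic mu2 k2 ->
  doubly_stochastic (mu1 \x mu2) (tensor_kernel k1 k2).
Proof.
move=> [mk1 k10 k11 k12] [mk2 k20 k21 k22].
have mk := measurable_tensor_kernel mk1 mk2.
have k0 p : (0 <= tensor_kernel k1 k2 p)%R by rewrite mulr_ge0.
split=> // [[x x']|[y y']].
- rewrite fubini_tonelli1//=; last 2 first.
  + by apply/measurable_EFinP; exact: measurable_fun_pair2.
  + by move=> p; rewrite lee_fin.
  rewrite -(k11 x); apply: eq_integral => y _; rewrite /fubini_F/tensor_kernel/=.
  under eq_integral do rewrite EFinM.
  rewrite ge0_integralZl//; first by rewrite k21 mule1.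
  + by apply/measurable_EFinP; exact: measurable_fun_pair2.
  + by move=> z _; rewrite lee_fin.
  + by rewrite lee_fin.
- rewrite fubini_tonelli1//=; last 2 first.
  + by apply/measurable_EFinP; exact: (measurable_fun_pair1 _ mk).
  + by move=> p; rewrite lee_fin.
  rewrite -(k12 y); apply: eq_integral => x _; rewrite /fubini_F/tensor_kernel/=.
  under eq_integral do rewrite EFinM.
  rewrite ge0_integralZl//; first by rewrite k22 mule1.
  + by apply/measurable_EFinP; exact: measurable_fun_pair1.
  + by move=> z _; rewrite lee_fin.
  + by rewrite lee_fin.
Qed.

(* [nu] is abstract here (it is [mu1 \x mu2]) so that unification never unfolds
   the product measure. *)
Lemma le_oscillation_tensor_abstract (nu : probability (T1 * T2)%type R)
    k1 k2 (f : T1 * T2 -> R) :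
  (forall g : T1 * T2 -> \bar R, measurable_fun setT g -> (forall p, 0 <= g p) ->
    \int[nu]_p g p = \int[mu1]_x \int[mu2]_y g (x, y)) ->
  (forall g : T1 * T2 -> \bar R, measurable_fun setT g -> (forall p, 0 <= g p) ->
    \int[nu]_p g p = \int[mu2]_y \int[mu1]_x g (x, y)) ->
  doubly_stochastic mu1 k1 -> doubly_stochastic mu2 k2 ->
  measurable_fun setT f ->
  oscillation nu (tensor_kernel k1 k2) f <=
  \int[mu2]_x' oscillation mu1 k1 (fun x => f (x, x')) +
  \int[mu1]_y oscillation mu2 k2 (fun x' => f (y, x')).
Proof.
move=> fub1 fub2 [mk1 k10 k11 k12] [mk2 k20 k21 k22] mf.
have mk := measurable_tensor_kernel mk1 mk2.
(* With [p = ((x, x'), (y, y'))], the difference is routed through the corner [(y, x')]. In [t1] the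
   variable [y'] occurs only in [k2], and in [t2] the variable [x] occurs only in [k1]; these
   factors integrate to 1 and leave one-factor oscillations of slices. *)
pose t1 (p : (T1 * T2) * (T1 * T2)) : R :=
  (tensor_kernel k1 k2 p * `|f p.1 - f (p.2.1, p.1.2)|)%R.
pose t2 (p : (T1 * T2) * (T1 * T2)) : R :=
  (tensor_kernel k1 k2 p * `|f (p.2.1, p.1.2) - f p.2|)%R.
have m21 : measurable_fun setT (fun p : (T1 * T2) * (T1 * T2) => (p.2.1, p.1.2)).
  apply: measurable_fun_pair.
    by apply: measurableT_comp => //; exact: measurable_snd.
  by apply: measurableT_comp => //; exact: measurable_fst.
have mt1 : measurable_fun setT (EFin \o t1).
  apply/measurable_EFinP/measurable_funM => //; apply: measurableT_comp => //.
  by apply: measurable_funB; exact: measurableT_comp.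
have mt2 : measurable_fun setT (EFin \o t2).
  apply/measurable_EFinP/measurable_funM => //; apply: measurableT_comp => //.
  by apply: measurable_funB; exact: measurableT_comp.
have t10 p : 0 <= (t1 p)%:E by rewrite lee_fin !mulr_ge0.
have t20 p : 0 <= (t2 p)%:E by rewrite lee_fin !mulr_ge0.
have sect2 (x' : T2) : measurable_fun setT (fun x => f (x, x')).
  exact: measurable_fun_pair1.
have sect1 (y : T1) : measurable_fun setT (fun x' => f (y, x')).
  exact: measurable_fun_pair2.
apply: (@le_trans _ _ (\int[nu \x nu]_p ((t1 p)%:E + (t2 p)%:E))).
  apply: ge0_le_integral => //.
  - by move=> p _; rewrite lee_fin !mulr_ge0.
  - exact: measurable_oscillation.
  - exact: emeasurable_funD.
  move=> p _; rewrite -EFinD lee_fin -mulrDr ler_wpM2l ?mulr_ge0//.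
  by rewrite (le_trans _ (ler_normD _ _))// addrA subrK.
have -> : \int[nu \x nu]_p ((t1 p)%:E + (t2 p)%:E) =
    \int[nu \x nu]_p (t1 p)%:E + \int[nu \x nu]_p (t2 p)%:E.
  by rewrite ge0_integralD.
apply: leeD.
- pose h1 (p : (T1 * T2) * T1) : R := (k1 (p.1.1, p.2) * `|f p.1 - f (p.2, p.1.2)|)%R.
  have mg : measurable_fun setT (EFin \o h1).
    apply/measurable_EFinP/measurable_funM.
      by apply: measurableT_comp => //; apply: measurable_fun_pair => //;
        apply: measurableT_comp.
    apply: measurableT_comp => //; apply: measurable_funB.
      exact: measurableT_comp.
    apply: measurableT_comp => //; apply: measurable_fun_pair => //.
    exact: measurableT_comp.
  have h10 p : 0 <= (EFin \o h1) p by rewrite lee_fin mulr_ge0.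
  pose H1 p := \int[mu1]_y (h1 (p, y))%:E.
  have mH1 : measurable_fun setT H1.
    exact: (measurable_fun_fubini_tonelli_F (m2 := mu1) (EFin \o h1)).
  have H10 p : 0 <= H1 p by apply: integral_ge0 => y _; exact: h10.
  have -> : \int[nu \x nu]_p (t1 p)%:E = \int[nu]_p H1 p.
    rewrite fubini_tonelli1//; apply: eq_integral => -[x x'] _.
    rewrite /fubini_F/= fub1//=; last first.
      by apply/measurable_EFinP; apply: measurable_fun_pair2; exact/measurable_EFinP.
    apply: eq_integral => y _; rewrite /t1/= /tensor_kernel/=.
    under eq_integral do rewrite mulrAC EFinM.
    rewrite ge0_integralZl//; first by rewrite k21 mule1.
    + by apply/measurable_EFinP; exact: measurable_fun_pair2.
    + by move=> z _; rewrite lee_fin.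
    + by rewrite lee_fin mulr_ge0.
  rewrite fub2//; rewrite le_eqVlt; apply/orP; left; apply/eqP.
  apply: eq_integral => x' _; rewrite /oscillation fubini_tonelli1//.
    exact: (measurable_oscillation mk1 (sect2 x')).
  by move=> p; rewrite lee_fin mulr_ge0.
- pose h2 (p : T2 * (T1 * T2)) : R := (k2 (p.1, p.2.2) * `|f (p.2.1, p.1) - f p.2|)%R.
  have mg : measurable_fun setT (EFin \o h2).
    apply/measurable_EFinP/measurable_funM.
      by apply: measurableT_comp => //; apply: measurable_fun_pair => //;
        apply: measurableT_comp.
    apply: measurableT_comp => //; apply: measurable_funB.
      apply: measurableT_comp => //; apply: measurable_fun_pair => //.
      exact: measurableT_comp.
    exact: measurableT_comp.
  have h20 p : 0 <= (EFin \o h2) p by rewrite lee_fin mulr_ge0.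
  pose H2 q := \int[mu2]_x' (h2 (x', q))%:E.
  have mH2 : measurable_fun setT H2.
    exact: (measurable_fun_fubini_tonelli_G (m1 := mu2) (EFin \o h2)).
  have H20 p : 0 <= H2 p by apply: integral_ge0 => y _; exact: h20.
  have -> : \int[nu \x nu]_p (t2 p)%:E = \int[nu]_p H2 p.
    rewrite fubini_tonelli2//; apply: eq_integral => -[y y'] _.
    rewrite /fubini_G/= fub2//=; last first.
      apply/measurable_EFinP; apply: (measurable_fun_pair1 (f := t2)).
      exact/measurable_EFinP.
    apply: eq_integral => x' _; rewrite /t2/= /tensor_kernel/=.
    under eq_integral do rewrite -mulrA EFinM.
    rewrite ge0_integralZr//; first by rewrite k12 mul1e.
    + by apply/measurable_EFinP; exact: measurable_fun_pair1.
    + by move=> z _; rewrite lee_fin.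
    + by rewrite lee_fin mulr_ge0.
  rewrite fub1//; rewrite le_eqVlt; apply/orP; left; apply/eqP.
  apply: eq_integral => y _; rewrite /oscillation fubini_tonelli2//.
    exact: (measurable_oscillation mk2 (sect1 y)).
  by move=> p; rewrite lee_fin mulr_ge0.
Qed.

Lemma le_oscillation_tensor k1 k2 (f : T1 * T2 -> R) :
  doubly_stochastic mu1 k1 -> doubly_stochastic mu2 k2 ->
  measurable_fun setT f ->
  oscillation (mu1 \x mu2) (tensor_kernel k1 k2) f <=
  \int[mu2]_x' oscillation mu1 k1 (fun x => f (x, x')) +
  \int[mu1]_y oscillation mu2 k2 (fun x' => f (y, x')).
Proof.
apply: le_oscillation_tensor_abstract.
- by move=> g mg g0; exact: fubini_tonelli1.
- by move=> g mg g0; exact: fubini_tonelli2.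
Qed.

Lemma measurable_oscillation_section1 (k1 : T1 * T1 -> R) (f : T1 * T2 -> R) :
  measurable_fun setT k1 -> (forall p, 0 <= k1 p)%R -> measurable_fun setT f ->
  measurable_fun setT (fun x' => oscillation mu1 k1 (fun x => f (x, x'))).
Proof.
move=> mk k0 mf.
pose h (p : (T1 * T2) * T1) : R := (k1 (p.1.1, p.2) * `|f p.1 - f (p.2, p.1.2)|)%R.
have mh : measurable_fun setT (EFin \o h).
  apply/measurable_EFinP/measurable_funM.
    by apply: measurableT_comp => //; apply: measurable_fun_pair => //;
      apply: measurableT_comp.
  apply: measurableT_comp => //; apply: measurable_funB; first exact: measurableT_comp.
  apply: measurableT_comp => //; apply: measurable_fun_pair => //.
  exact: measurableT_comp.
have h0 p : 0 <= (EFin \o h) p by rewrite lee_fin mulr_ge0.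
pose H p := \int[mu1]_y (h (p, y))%:E.
have mH : measurable_fun setT H.
  exact: (measurable_fun_fubini_tonelli_F (m2 := mu1) (EFin \o h)).
have H0 p : 0 <= H p by apply: integral_ge0 => y _; exact: h0.
rewrite (_ : (fun x' => _) = (fun x' => \int[mu1]_x H (x, x'))).
  exact: (measurable_fun_fubini_tonelli_G (m1 := mu1) H).
apply/funext => x'; rewrite /oscillation fubini_tonelli1//.
  exact: (measurable_oscillation mk (measurable_fun_pair1 x' mf)).
by move=> p; rewrite lee_fin mulr_ge0.
Qed.

Lemma measurable_oscillation_section2 (k2 : T2 * T2 -> R) (f : T1 * T2 -> R) :
  measurable_fun setT k2 -> (forall p, 0 <= k2 p)%R -> measurable_fun setT f ->
  measurable_fun setT (fun y => oscillation mu2 k2 (fun x' => f (y, x'))).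
Proof.
move=> mk k0 mf.
pose h (p : T2 * (T1 * T2)) : R := (k2 (p.1, p.2.2) * `|f (p.2.1, p.1) - f p.2|)%R.
have mh : measurable_fun setT (EFin \o h).
  apply/measurable_EFinP/measurable_funM.
    by apply: measurableT_comp => //; apply: measurable_fun_pair => //;
      apply: measurableT_comp.
  apply: measurableT_comp => //; apply: measurable_funB; last exact: measurableT_comp.
  apply: measurableT_comp => //; apply: measurable_fun_pair => //.
  exact: measurableT_comp.
have h0 p : 0 <= (EFin \o h) p by rewrite lee_fin mulr_ge0.
pose H q := \int[mu2]_x' (h (x', q))%:E.
have mH : measurable_fun setT H.
  exact: (measurable_fun_fubini_tonelli_G (m1 := mu2) (EFin \o h)).
have H0 p : 0 <= H p by apply: integral_ge0 => y _; exact: h0.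
rewrite (_ : (fun y => _) = (fun y => \int[mu2]_y' H (y, y'))).
  exact: (measurable_fun_fubini_tonelli_F (m2 := mu2) H).
apply/funext => y; rewrite /oscillation fubini_tonelli2//.
  exact: (measurable_oscillation mk (measurable_fun_pair2 y mf)).
by move=> p; rewrite lee_fin mulr_ge0.
Qed.

(** By Fubini almost every slice of [f] is integrable, so its oscillation tends to 0. Twice the L^1
    norm of the slice dominates, and dominated convergence handles each of the two terms of
    [le_oscillation_tensor]. *)
Lemma approximate_identity_tensor k1 k2 :
  approximate_identity mu1 k1 -> approximate_identity mu2 k2 ->
  approximate_identity (mu1 \x mu2) (fun n => tensor_kernel (k1 n) (k2 n)).
Proof.
move=> [ds1 ai1] [ds2 ai2]; split=> [n|f intf]; first exact: doubly_stochastic_tensor.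
have mf : measurable_fun setT f by move/integrableP: intf => [/measurable_EFinP].
have sect2 (x' : T2) : measurable_fun setT (fun x => f (x, x')).
  exact: measurable_fun_pair1.
have sect1 (y : T1) : measurable_fun setT (fun x' => f (y, x')).
  exact: measurable_fun_pair2.
have mk1 n : measurable_fun setT (k1 n) by case: (ds1 n).
have mk2 n : measurable_fun setT (k2 n) by case: (ds2 n).
have k10 n p : (0 <= k1 n p)%R by case: (ds1 n).
have k20 n p : (0 <= k2 n p)%R by case: (ds2 n).
have mnf : measurable_fun setT (EFin \o (fun p => `|f p|%R)).
  by apply/measurable_EFinP/measurableT_comp.
have nf0 p : 0 <= `|f p|%:E by rewrite lee_fin.
have c1 : \int[mu2]_x' oscillation mu1 (k1 n) (fun x => f (x, x')) @[n --> \oo] --> 0.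
  have := @dominated_convergence _ T2 R mu2 setT measurableT
    (fun n x' => oscillation mu1 (k1 n) (fun x => f (x, x'))) (cst 0)
    (fun x' => 2%:E * \int[mu1]_x `|f (x, x')|%:E).
  case.
  - by move=> n; exact: measurable_oscillation_section1.
  - exact: measurable_cst.
  - have := ae_integrable2 intf; apply: filterS => x' ix' _; exact: ai1.
  - apply: integrableZl => //; apply/integrableP; split.
      exact: (measurable_fun_fubini_tonelli_G (EFin \o (fun p => `|f p|%R))).
    under eq_integral do rewrite gee0_abs ?integral_ge0//.
    by move: intf => /integrableP[_]; rewrite fubini_tonelli2//.
  - apply: aeW => x' n _; rewrite gee0_abs ?oscillation_ge0//.
    exact: le_oscillation_norm.
  move=> _ _; rewrite integral_cst// mul0e; exact.
have c2 : \int[mu1]_y oscillation mu2 (k2 n) (fun x' => f (y, x')) @[n --> \oo] --> 0.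
  have := @dominated_convergence _ T1 R mu1 setT measurableT
    (fun n y => oscillation mu2 (k2 n) (fun x' => f (y, x'))) (cst 0)
    (fun y => 2%:E * \int[mu2]_x' `|f (y, x')|%:E).
  case.
  - by move=> n; exact: measurable_oscillation_section2.
  - exact: measurable_cst.
  - have := ae_integrable1 intf; apply: filterS => x' ix' _; exact: ai2.
  - apply: integrableZl => //; apply/integrableP; split.
      exact: (measurable_fun_fubini_tonelli_F (EFin \o (fun p => `|f p|%R))).
    under eq_integral do rewrite gee0_abs ?integral_ge0//.
    by move: intf => /integrableP[_]; rewrite fubini_tonelli1//.
  - apply: aeW => x' n _; rewrite gee0_abs ?oscillation_ge0//.
    exact: le_oscillation_norm.
  move=> _ _; rewrite integral_cst// mul0e; exact.
apply: (@squeeze_cvge _ _ _ _ (cst 0) _ (fun n =>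
  \int[mu2]_x' oscillation mu1 (k1 n) (fun x => f (x, x')) +
  \int[mu1]_y oscillation mu2 (k2 n) (fun x' => f (y, x')))).
- apply: nearW => n; rewrite oscillation_ge0/=.
    exact: le_oscillation_tensor.
  by move=> p; rewrite mulr_ge0.
- exact: cvg_cst.
- by rewrite -[X in _ --> X](adde0 0); apply: cvgeD.
Qed.

End oscillation_product.

(** * The cosine kernels on the circle and on the cube *)

Section periodic_shift.
Context {R : realType}.
Notation leb := (@lebesgue_measure R).
Local Open Scope ereal_scope.

Lemma measurable_shift (c : R) :
  measurable_fun setT ((fun x => x + c)%R : measurableTypeR R -> measurableTypeR R).
Proof. exact: measurable_funD. Qed.

(** The image of Lebesgue measure under a translation gives every half-open interval its length,
    which characterises Lebesgue measure. *)
Lemma ge0_integral_lebesgue_shift (c : R) (f : R -> \bar R) :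
  measurable_fun setT f -> (forall x, 0 <= f x) ->
  \int[leb]_x f (x + c)%R = \int[leb]_x f x.
Proof.
move=> mf f0.
pose phi : measurableTypeR R -> measurableTypeR R := (fun x => x + c)%R.
have mphi : measurable_fun setT phi by exact: measurable_shift.
pose phim : {mfun measurableTypeR R >-> measurableTypeR R} :=
  HB.pack phi (isMeasurableFun.Build _ _ _ _ phi mphi).
transitivity (\int[pushforward leb phim]_x f x).
  by rewrite ge0_integral_pushforward.
apply: eq_measure_integral => A mA _; apply/esym.
apply: (@lebesgue_measure_unique _ (pushforward leb phim)) => // X [[a b] /= _ <-].
rewrite /pushforward/= (_ : phi @^-1` _ = `](a - c)%R, (b - c)%R]%classic); last first.
  by apply/seteqP; split=> x /=; rewrite /phi !in_itv/= lerBrDr ltrBlDr.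
rewrite !lebesgue_measure_itv/= !lte_fin ltrD2r.
by case: ifPn => // _; rewrite -!EFinD; congr _%:E; ring.
Qed.

Lemma ge0_integral_itv_shift (a b c : R) x y (f : R -> \bar R) :
  measurable_fun setT f -> (forall x, 0 <= f x) ->
  \int[leb]_(t in [set` Interval (BSide x a) (BSide y b)]) f (t + c)%R =
  \int[leb]_(t in [set` Interval (BSide x (a + c)%R) (BSide y (b + c)%R)]) f t.
Proof.
move=> mf f0; rewrite [LHS]integral_mkcond [RHS]integral_mkcond.
rewrite -[RHS](@ge0_integral_lebesgue_shift c); last 2 first.
- by apply/(measurable_restrictT _ _).1 => //; exact: measurable_funTS.
- by move=> t; rewrite patchE; case: ifPn.
apply: eq_integral => t _; rewrite !patchE.
rewrite !mem_setE /= !in_itv/= /Order.lteif.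
by case: x; case: y; rewrite ?lerD2r ?ltrD2r.
Qed.

Lemma periodic_int (f : R -> \bar R) : (forall x, f (x + 1)%R = f x) ->
  forall (m : int) x, f (x + m%:~R)%R = f x.
Proof.
move=> f1; have fn (n : nat) x : f (x + n%:R)%R = f x.
  elim: n x => [|n ih] x; first by rewrite addr0.
  by rewrite -natr1 addrA f1 ih.
case=> n x; first exact: fn.
by rewrite NegzE intrN -[in RHS](subrK n.+1%:R x) fn.
Qed.

Lemma ge0_integral_periodic_shift (c : R) (f : R -> \bar R) :
  measurable_fun setT f -> (forall x, 0 <= f x) ->
  (forall x, f (x + 1)%R = f x) ->
  \int[leb]_(x in `[0%R, 1%R]) f (x + c)%R = \int[leb]_(x in `[0%R, 1%R]) f x.
Proof.
move=> mf f0 f1.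
wlog : c / (0 <= c < 1)%R.
  move=> h; rewrite -(h (c - (Num.floor c)%:~R)%R); last first.
    have := real_floor_itv (num_real c) => /andP[cl cu]; apply/andP; split.
      by rewrite subr_ge0.
    by rewrite ltrBlDr addrC -intrD1.
  by apply: eq_integral => x _; rewrite -[RHS](periodic_int f1 (Num.floor c)) -addrA subrK.
move=> /andP[c0 c1].
have mE D : measurable_fun D f by exact: measurable_funTS.
have sh : \int[leb]_(x in `[0%R, 1%R]) f (x + c)%R = \int[leb]_(x in `[c, (1 + c)%R]) f x.
  by rewrite ge0_integral_itv_shift// add0r.
rewrite {}sh -integral_itv_bndo_bndc// -[RHS]integral_itv_bndo_bndc//.
have cut (a b e : R) : (a <= b)%R -> (b <= e)%R ->
    \int[leb]_(x in `[a, e[) f x =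
    \int[leb]_(x in `[a, b[) f x + \int[leb]_(x in `[b, e[) f x.
  move=> ab be; rewrite (@itv_bndbnd_setU _ _ _ (BLeft b)) ?bnd_simp//.
  rewrite ge0_integral_setU//=.
    exact: mE.
  rewrite disj_set2E; apply/eqP; rewrite -subset0 => x [] /=; rewrite !in_itv/= => /andP[_ x1] /andP[x1' _].
  by move: (lt_le_trans x1 x1'); rewrite ltxx.
(* The window [[c, 1 + c[] is [[c, 1[] followed by [[1, 1 + c[]; periodicity moves the second piece
   back to [[0, c[]. *)
rewrite (cut c 1%R) ?lerDl//; last exact: ltW.
rewrite (cut 0%R c 1%R)//; last exact: ltW.
rewrite addeC; congr (_ + _).
rewrite -[X in `[X, _[](add0r 1%R) [X in `[_, X[]addrC -ge0_integral_itv_shift//.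
by apply: eq_integral => x _.
Qed.

End periodic_shift.

(** * Powers of the raised cosine as kernels on the circle *)

Section cosine_kernel.
Context {R : realType}.
Notation leb := (@lebesgue_measure R).
Notation U := (uniform_prob (@ltr01 R)).
Implicit Types (n : nat) (t x y : R).

(** Equal to [2^n cos(pi t)^(2n)], the unnormalised de la Vallee Poussin kernel: a nonnegative
    trigonometric polynomial of period 1 that concentrates at the integers. *)
Definition cos_bump n t : R := (1 + cos (pi *+ 2 * t)) ^+ n.

Definition cos_mass n : R := \int[U]_t cos_bump n t.

Definition cos_kernel n t : R := (cos_mass n)^-1 * cos_bump n t.

Lemma cos_nincr s t : 0 <= s -> s <= t -> t <= pi -> cos t <= cos s :> R.
Proof.
move=> s0 st tpi; have [->//|st'] := eqVneq s t.
by rewrite ltW// ltr_cos ?in_itv/= ?lt_neqAle ?st' ?st//; apply/andP; split; lra.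
Qed.

(** The hypotheses keep [t] at distance at least [e] from -1, 0 and 1, the peaks that differences of
    two points of [[0, 1]] can reach. For [|t| > 1/2] the cosine is unchanged by [|t| -> 1 - |t|],
    which brings the argument back to the half period where it decreases. *)
Lemma cos_far (e t : R) : 0 < e -> e <= 1 / 2 -> e <= `|t| -> `|t| <= 1 - e ->
  cos (pi *+ 2 * t) <= cos (pi *+ 2 * e).
Proof.
move=> e0 e12 et te; rewrite -[leLHS]cos_norm normrM (@ger0_norm _ (pi *+ 2)); last first.
  by rewrite mulrn_wge0// pi_ge0.
have p0 := @pi_gt0 R; have pE : pi *+ 2 = pi + pi :> R by [].
have [th|th] := leP `|t| (1 / 2).
  by apply: cos_nincr; rewrite pE; nra.
rewrite -[leLHS]cosN -[leLHS]cosD2pi pE.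
by apply: cos_nincr; nra.
Qed.

Lemma cos_bump_ge0 n t : 0 <= cos_bump n t.
Proof. by rewrite exprn_ge0// -lerBlDl sub0r cos_geN1. Qed.

Lemma cos_bumpN n t : cos_bump n (- t) = cos_bump n t.
Proof. by rewrite /cos_bump mulrN cosN. Qed.

Lemma cos_bumpD1 n t : cos_bump n (t + 1) = cos_bump n t.
Proof. by rewrite /cos_bump mulrDr mulr1 cosD2pi. Qed.

Lemma continuous_cos_bump n : continuous (cos_bump n).
Proof.
move=> t; apply: (@continuous_comp _ _ _ (fun t => 1 + cos (pi *+ 2 * t)) (fun z => z ^+ n)).
  apply: cvgD; first exact: cvg_cst.
  apply: (@continuous_comp _ _ _ (fun t => pi *+ 2 * t) cos).
    by apply: cvgM; [exact: cvg_cst|exact: cvg_id].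
  exact: continuous_cos.
exact: exprn_continuous.
Qed.

Lemma measurable_cos_bump n : measurable_fun setT (cos_bump n).
Proof. by apply: continuous_measurable_fun; exact: continuous_cos_bump. Qed.

Lemma measurable_EFin_cos_bump n : measurable_fun setT (EFin \o cos_bump n).
Proof. by apply/measurable_EFinP; exact: measurable_cos_bump. Qed.

Lemma cos_bump_le n t : cos_bump n t <= 2 ^+ n.
Proof.
rewrite lerXn2r ?nnegrE//.
by have := cos_le1 (pi *+ 2 * t); lra.
Qed.

Lemma integral_uniform01 (f : R -> \bar R) :
  measurable_fun setT f -> (forall x, 0 <= f x)%E ->
  (\int[U]_x f x = \int[leb]_(x in `[0%R, 1%R]) f x)%E.
Proof. by move=> mf f0; rewrite integral_uniform// subr0 invr1 mul1e. Qed.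

Lemma le_integral_uniform01 (f g : R -> \bar R) :
  measurable_fun setT f -> (forall x, 0 <= f x)%E ->
  measurable_fun setT g -> (forall x, 0 <= g x)%E ->
  (forall x, 0 <= x <= 1 -> (f x <= g x)%E) ->
  (\int[U]_x f x <= \int[U]_x g x)%E.
Proof.
move=> mf f0 mg g0 fg; rewrite !integral_uniform01//.
by apply: ge0_le_integral => //; apply: measurable_funTS.
Qed.

Lemma integrable_cos_bump n : U.-integrable setT (EFin \o cos_bump n).
Proof.
apply/integrableP; split; first exact: measurable_EFin_cos_bump.
apply: (@le_lt_trans _ _ (\int[U]_x (cst (2 ^+ n)%:E x))%E).
  apply: ge0_le_integral => //.
    by apply: measurableT_comp => //; exact: measurable_EFin_cos_bump.
  by move=> x _ /=; rewrite lee_fin ger0_norm ?cos_bump_ge0 ?cos_bump_le.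
rewrite integral_cst//; apply: lte_mul_pinfty => //.
by apply: (le_lt_trans (@probability_le1 _ _ _ U _ measurableT)); rewrite ltry.
Qed.

Lemma cos_massE n : ((cos_mass n)%:E = \int[U]_t (cos_bump n t)%:E)%E.
Proof.
rewrite /cos_mass /Rintegral fineK//; apply: integrable_fin_num => //.
exact: integrable_cos_bump.
Qed.

(** On [[0, a]] the bump is at least its value at [a]. This crude lower bound replaces the exact
    normalising constant: only exponential rates have to be compared. *)
Lemma cos_mass_ge n (a : R) : 0 < a -> a <= 1 / 2 ->
  a * (1 + cos (pi *+ 2 * a)) ^+ n <= cos_mass n.
Proof.
move=> a0 a1; rewrite -lee_fin cos_massE integral_uniform01; last 2 first.
- exact: measurable_EFin_cos_bump.
- by move=> x; rewrite lee_fin cos_bump_ge0.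
apply: (@le_trans _ _ (\int[leb]_(x in `[0%R, a]) ((1 + cos (pi *+ 2 * a)) ^+ n)%:E)%E).
  rewrite integral_cst//= lebesgue_measure_itv/= lte_fin a0 -EFinD subr0.
  by rewrite -EFinM mulrC.
apply: (@le_trans _ _ (\int[leb]_(x in `[0%R, a]) (cos_bump n x)%:E)%E).
  apply: ge0_le_integral => //.
  - by apply: measurable_funTS; exact: measurable_EFin_cos_bump.
  move=> x /=; rewrite in_itv/= => /andP[x0 xa]; rewrite lee_fin.
  have p0 := @pi_gt0 R; have pE : pi *+ 2 = pi + pi :> R by [].
  have ca := cos_geN1 (pi *+ 2 * a); have cx := cos_geN1 (pi *+ 2 * x).
  have xa' : cos (pi *+ 2 * a) <= cos (pi *+ 2 * x).
    by apply: cos_nincr; rewrite pE; nra.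
  by rewrite /cos_bump lerXn2r ?nnegrE//; lra.
apply: ge0_subset_integral => //.
- by apply: measurable_funTS; exact: measurable_EFin_cos_bump.
- by move=> x _; rewrite lee_fin cos_bump_ge0.
- by apply: subset_itvl; rewrite bnd_simp; lra.
Qed.

Lemma cos_mass_gt0 n : 0 < cos_mass n.
Proof.
(* At [a = 1/4] the cosine vanishes, so the lower bound is [1/4] for every [n]. *)
have := @cos_mass_ge n (1 / 4) _ _; rewrite (_ : pi *+ 2 * (1 / 4) = pi / 2); last first.
  by rewrite -mulr_natr; field.
rewrite cos_pihalf addr0 expr1n mulr1 => /(_ _ _)/lt_le_trans; apply; lra.
Qed.

Lemma cos_kernel_ge0 n t : 0 <= cos_kernel n t.
Proof. by rewrite mulr_ge0 ?cos_bump_ge0// invr_ge0 ltW// cos_mass_gt0. Qed.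

Lemma measurable_cos_kernel n : measurable_fun setT (cos_kernel n).
Proof. by apply: measurable_funM => //; exact: measurable_cos_bump. Qed.

Lemma integral_cos_kernel n x : (\int[U]_y (cos_kernel n (y - x))%:E = 1)%E.
Proof.
have mb z : measurable_fun setT (EFin \o (fun y => cos_bump n (y + z))).
  apply/measurable_EFinP; apply: (measurableT_comp (measurable_cos_bump n)).
  exact: measurable_funD.
under eq_integral do rewrite EFinM.
rewrite ge0_integralZl//=; last 3 first.
- exact: mb.
- by move=> y _; rewrite lee_fin cos_bump_ge0.
- by rewrite lee_fin invr_ge0 ltW// cos_mass_gt0.
rewrite integral_uniform01; last 2 first.
- exact: mb.
- by move=> y; rewrite lee_fin cos_bump_ge0.
rewrite (@ge0_integral_periodic_shift _ _ (EFin \o cos_bump n)); last 3 first.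
- exact: measurable_EFin_cos_bump.
- by move=> y; rewrite lee_fin cos_bump_ge0.
- by move=> y /=; rewrite cos_bumpD1.
rewrite -integral_uniform01; last 2 first.
- exact: measurable_EFin_cos_bump.
- by move=> y; rewrite lee_fin cos_bump_ge0.
rewrite /= -cos_massE -EFinM mulVf// gt_eqF// cos_mass_gt0//.
Qed.

Lemma cos_kernelN n t : cos_kernel n (- t) = cos_kernel n t.
Proof. by rewrite /cos_kernel cos_bumpN. Qed.

(** The bump is bounded by its value at [e] and the mass from below by [cos_mass_ge] at [e / 2],
    whose angle is [pi * e]. Since [cos (2 pi e) < cos (pi e)], the quotient is geometric with ratio
    below 1. *)
Lemma cos_kernel_far n (e t : R) : 0 < e -> e < 1 / 2 -> e <= `|t| -> `|t| <= 1 - e ->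
  cos_kernel n t <= (e / 2)^-1 * ((1 + cos (pi *+ 2 * e)) / (1 + cos (pi * e))) ^+ n.
Proof.
move=> e0 e12 et te; have p0 := @pi_gt0 R.
have c0 : 0 < 1 + cos (pi * e).
  have : 0 < cos (pi * e) by apply: cos_gt0_pihalf; apply/andP; split; nra.
  lra.
rewrite expr_div_n [X in _ * X]mulrC mulrA -invfM /cos_kernel /cos_bump.
have cf : cos (pi *+ 2 * t) <= cos (pi *+ 2 * e) by rewrite cos_far// ltW.
have ct := cos_geN1 (pi *+ 2 * t).
apply: ler_pM; first by rewrite invr_ge0 ltW// cos_mass_gt0.
- by rewrite exprn_ge0//; lra.
- rewrite lef_pV2 ?posrE ?cos_mass_gt0//; last by rewrite mulr_gt0 ?exprn_gt0//; lra.
  have := @cos_mass_ge n (e / 2); rewrite (_ : pi *+ 2 * (e / 2) = pi * e); last first.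
    by rewrite -mulr_natr; field.
  by apply; lra.
- by rewrite lerXn2r ?nnegrE//; lra.
Qed.

Lemma cvg_cos_kernel_far (e : R) : 0 < e -> e < 1 / 2 ->
  (e / 2)^-1 * ((1 + cos (pi *+ 2 * e)) / (1 + cos (pi * e))) ^+ n @[n --> \oo] --> (0 : R).
Proof.
move=> e0 e12; have p0 := @pi_gt0 R.
have c0 : 0 < 1 + cos (pi * e).
  have : 0 < cos (pi * e) by apply: cos_gt0_pihalf; apply/andP; split; nra.
  lra.
rewrite -[X in _ --> X](mulr0 (e / 2)^-1); apply: cvgM; first exact: cvg_cst.
apply: cvg_expr; rewrite ger0_norm; last first.
  by rewrite divr_ge0 ?(ltW c0)// -lerBlDl sub0r cos_geN1.
rewrite ltr_pdivrMr// mul1r ltrD2l mulr2n.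
by rewrite ltr_cos ?in_itv/=; first [nra | apply/andP; split; nra].
Qed.

Definition cos_kernel2 n (p : R * R) : R := cos_kernel n (p.1 - p.2).

Lemma doubly_stochastic_cos n : doubly_stochastic U (cos_kernel2 n).
Proof.
split.
- apply: (measurableT_comp (measurable_cos_kernel n)).
  by apply: measurable_funB; [exact: measurable_fst|exact: measurable_snd].
- by move=> p; exact: cos_kernel_ge0.
- move=> x; rewrite -(integral_cos_kernel n x); apply: eq_integral => y _.
  by rewrite /cos_kernel2 -cos_kernelN opprB.
- by move=> y; exact: integral_cos_kernel.
Qed.

End cosine_kernel.

(** * Convergence of the cosine kernels in L^1 of the circle *)

Section cosine_approximate_identity.
Context {R : realType}.
Notation leb := (@lebesgue_measure R).
Notation U := (uniform_prob (@ltr01 R)).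
Local Open Scope ereal_scope.

Lemma cvge_lt (u : nat -> \bar R) (l e : \bar R) : l < e -> u @ \oo --> l ->
  \forall n \near \oo, u n < e.
Proof.
by move=> le ul; apply: (ul [set y | y < e]); exact: open_ereal_lt'.
Qed.

(** Near [x] continuity makes the difference small, and elsewhere the kernel is uniformly small. The
    point [x] is interior because [g] is not periodic: at an endpoint the kernel would also compare
    [g] near 0 with [g] near 1. *)
Lemma cvg_oscillation_cos_pt (g : R -> R) (M x : R) : continuous g ->
  (forall y : R, 0 <= y <= 1 -> `|g y| <= M)%R -> (0 < x < 1)%R ->
  \int[U]_y (cos_kernel2 n (x, y) * `|g x - g y|)%:E @[n --> \oo] --> 0.
Proof.
move=> cg gM /andP[x0 x1].
have mg : measurable_fun setT g by exact: continuous_measurable_fun.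
have M0 : (0 <= M)%R by apply: le_trans (gM 0%R _); rewrite ?lexx ?ler01.
have mk n : measurable_fun setT (fun y => cos_kernel2 n (x, y)).
  by apply: measurable_fun_pair2; case: (@doubly_stochastic_cos R n).
suff h (e : R) : (0 < e)%R -> \forall n \near \oo,
    \int[U]_y (cos_kernel2 n (x, y) * `|g x - g y|)%:E <= e%:E.
  apply/fine_cvgP; split.
    have := h 1%R ltr01; apply: filterS => n hn.
    rewrite ge0_fin_numE; first exact: le_lt_trans hn (ltry _).
    by apply: integral_ge0 => y _; rewrite lee_fin mulr_ge0// cos_kernel_ge0.
  apply/cvgrPdist_le => e e0; have := h e e0; apply: filterS => n hn /=.
  have i0 : 0 <= \int[U]_y (cos_kernel2 n (x, y) * `|g x - g y|)%:E.
    by apply: integral_ge0 => y _; rewrite lee_fin mulr_ge0// cos_kernel_ge0.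
  rewrite sub0r normrN ger0_norm ?fine_ge0// -lee_fin fineK//.
  by rewrite ge0_fin_numE//; exact: le_lt_trans hn (ltry _).
move=> e0.
have /cvgrPdist_le/(_ (e / 2)%R) := cg x.
move=> /(_ ltac:(lra)) /nbhs_ballP[r /= r0 hr].
(* [r / 2] gives closeness of the values of [g], [1 / 4] keeps [a] below one half, and [x] and
   [1 - x] ensure [|x - y| <= 1 - a] for every [y] in [[0, 1]], away from the periodic copies of the
   peak. *)
pose a : R := (Num.min (Num.min (r / 2) (1 / 4)) (Num.min x (1 - x)))%R.
have a0 : (0 < a)%R by rewrite !lt_min; do !(apply/andP; split); lra.
have [ar a4 ax a1x] : [/\ a <= r / 2, a <= 1 / 4, a <= x & a <= 1 - x]%R.
  by split; rewrite !ge_min ?lexx ?orbT.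
have a12 : (a < 1 / 2)%R by lra.
(* The [+ 1] keeps the divisor positive when [M = 0]; the outcome used is [2 * M * s <= e / 2]. *)
have /cvgrPdist_le/(_ (e / 2 / (2 * M + 1))%R) := cvg_cos_kernel_far a0 a12.
have M1 : (0 < 2 * M + 1)%R by lra.
move=> /(_ ltac:(by rewrite !divr_gt0//)); apply: filterS => n.
set s := (_ * _ ^+ n)%R => hs.
have s0 : (0 <= s)%R.
  apply: mulr_ge0; first by rewrite invr_ge0; lra.
  apply/exprn_ge0/divr_ge0; first by have := cos_geN1 (pi *+ 2 * a)%R; lra.
  by have := cos_geN1 (pi * a)%R; lra.
have {}hs : (2 * M * s <= e / 2)%R.
  move: hs; rewrite sub0r normrN ger0_norm// ler_pdivlMr// => hs.
  by apply: le_trans hs; nra.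
have Ms0 : (0 <= 2 * M * s)%R by apply: mulr_ge0 => //; lra.
apply: (@le_trans _ _ (\int[U]_y ((e / 2) * cos_kernel2 n (x, y) + 2 * M * s)%:E)).
  apply: le_integral_uniform01.
  - apply/measurable_EFinP; apply: measurable_funM => //.
    by apply: measurableT_comp => //; exact: measurable_funB.
  - by move=> y; rewrite lee_fin mulr_ge0// cos_kernel_ge0.
  - by apply/measurable_EFinP; apply: measurable_funD => //; exact: measurable_funM.
  - move=> y; have k0 : (0 <= cos_kernel2 n (x, y))%R by exact: cos_kernel_ge0.
    rewrite lee_fin; nra.
  move=> y y01; rewrite lee_fin.
  have k0 : (0 <= cos_kernel2 n (x, y))%R by exact: cos_kernel_ge0.
  have [xy|xy] := ltP `|x - y|%R a.
    have gxy : (`|g x - g y| <= e / 2)%R.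
      by apply: hr; rewrite /ball/=; lra.
    by rewrite mulrC (le_trans (ler_wpM2r k0 gxy))// lerDl.
  have ks : (cos_kernel2 n (x, y) <= s)%R.
    apply: cos_kernel_far => //; move/andP: y01 => [y0 y1].
    by rewrite /= ler_norml; apply/andP; split; lra.
  have gxy : (`|g x - g y| <= 2 * M)%R.
    apply: (le_trans (ler_normB _ _)).
    have := gM x; have := gM y y01; rewrite (ltW x0) (ltW x1) => ? /(_ isT); lra.
  rewrite (le_trans (ler_pM _ _ ks gxy))// mulrC lerDr.
  by apply: mulr_ge0 => //; lra.
under eq_integral do rewrite EFinD EFinM.
rewrite ge0_integralD//=; last 2 first.
- move=> y _; have k0 : (0 <= cos_kernel2 n (x, y))%R by exact: cos_kernel_ge0.
  by rewrite -EFinM lee_fin mulr_ge0//; lra.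
- by apply: emeasurable_funM => //; apply/measurable_EFinP; exact: mk.
rewrite ge0_integralZl//=; last 3 first.
- by apply/measurable_EFinP; exact: mk.
- by move=> y _; rewrite lee_fin cos_kernel_ge0.
- by rewrite lee_fin; lra.
case: (@doubly_stochastic_cos R n) => _ _ -> _; rewrite mule1.
rewrite integral_cst//.
apply: (@le_trans _ _ ((e / 2)%:E + (e / 2)%:E)); last by rewrite -EFinD lee_fin; lra.
rewrite leeD2l//; apply: (@le_trans _ _ ((2 * M * s)%:E * 1)); last first.
  by rewrite mule1 lee_fin.
apply: lee_wpmul2l; first by rewrite lee_fin.
exact: (@probability_le1 _ _ _ U _ measurableT).
Qed.

Lemma cvg_oscillation_cos_continuous (g : R -> R) : continuous g ->
  oscillation U (@cos_kernel2 R n) g @[n --> \oo] --> 0.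
Proof.
move=> cg; have mg : measurable_fun setT g by exact: continuous_measurable_fun.
have [M gM] : exists M, (forall y : R, 0 <= y <= 1 -> `|g y| <= M)%R.
  have : compact (g @` `[0%R, 1%R]).
    apply: continuous_compact; last exact: segment_compact.
    exact: continuous_subspaceT.
  move/compact_bounded => -[M [_ hM]]; exists (M + 1)%R => y y01.
  by apply: (hM (M + 1)%R); [rewrite ltrDl | exists y].
have M0 : (0 <= M)%R by apply: le_trans (gM 0%R _); rewrite ?lexx ?ler01.
have mk n : measurable_fun setT (@cos_kernel2 R n) by case: (@doubly_stochastic_cos R n).
have k0 n p : (0 <= @cos_kernel2 R n p)%R by exact: cos_kernel_ge0.
pose F n x := \int[U]_y (cos_kernel2 n (x, y) * `|g x - g y|)%:E.
have mF n : measurable_fun setT (F n).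
  apply: (measurable_fun_fubini_tonelli_F (m2 := U)
    (fun p : R * R => (cos_kernel2 n p * `|g p.1 - g p.2|)%:E)).
    exact: measurable_oscillation.
  by move=> p; rewrite lee_fin mulr_ge0.
have F0 n x : 0 <= F n x by apply: integral_ge0 => y _; rewrite lee_fin mulr_ge0.
(* The endpoints, where pointwise convergence can fail, are a null set. *)
have oE n : oscillation U (@cos_kernel2 R n) g = \int[leb]_(x in `]0%R, 1%R[) F n x.
  rewrite /oscillation fubini_tonelli1//; last 2 first.
  - exact: (measurable_oscillation (mk n) mg).
  - by move=> p; rewrite lee_fin mulr_ge0.
  transitivity (\int[leb]_(x in `[0%R, 1%R]) F n x).
    exact: (integral_uniform01 (mF n) (F0 n)).
  rewrite -integral_itv_bndo_bndc; last exact: measurable_funTS.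
  by rewrite -integral_itv_obnd_cbnd//; exact: measurable_funTS.
rewrite (_ : (fun n => _) = (fun n => \int[leb]_(x in `]0%R, 1%R[) F n x)); last exact/funext.
have := @dominated_convergence _ _ R leb `]0%R, 1%R[%classic (measurable_itv _)
  F (cst 0) (cst (2 * M)%:E).
case.
- by move=> n; apply: measurable_funTS; exact: mF.
- exact: measurable_cst.
- by apply: aeW => x; rewrite /= in_itv/= => x01; exact: (cvg_oscillation_cos_pt cg gM).
- apply/integrableP; split; first exact: measurable_cst.
  rewrite integral_cst//= lebesgue_measure_itv/= lte_fin ltr01 -EFinD -EFinM.
  exact: ltry.
- apply: aeW => x n; rewrite /= in_itv/= => /andP[x0 x1]; rewrite gee0_abs//.
  apply: (@le_trans _ _ (\int[U]_y ((2 * M)%:E * (cos_kernel2 n (x, y))%:E))).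
    apply: le_integral_uniform01.
    + apply/measurable_EFinP; apply: measurable_funM; first exact: (measurable_fun_pair2 _ (mk n)).
      by apply: measurableT_comp => //; exact: measurable_funB.
    + by move=> y; rewrite lee_fin mulr_ge0.
    + apply: emeasurable_funM => //; apply/measurable_EFinP; exact: (measurable_fun_pair2 _ (mk n)).
    + by move=> y; rewrite -EFinM lee_fin; apply: mulr_ge0 => //; lra.
    move=> y y01; rewrite -EFinM lee_fin mulrC ler_wpM2r//.
    apply: (le_trans (ler_normB _ _)).
    have := gM x; have := gM y y01; rewrite (ltW x0) (ltW x1) => ? /(_ isT); lra.
  rewrite ge0_integralZl//=; last 3 first.
  + by apply/measurable_EFinP; exact: (measurable_fun_pair2 _ (mk n)).
  + by move=> y _; rewrite lee_fin.
  + by rewrite lee_fin mulr_ge0.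
  by case: (@doubly_stochastic_cos R n) => _ _ -> _; rewrite mule1.
by move=> _ _; rewrite integral_cst// mul0e; exact.
Qed.

(** Continuous functions are dense in L^1, and an L^1 error of [e / 4] costs at most [e / 2] in
    oscillation, whatever the kernel. *)
Lemma approximate_identity_cos : approximate_identity U (@cos_kernel2 R).
Proof.
split=> [n|f intf]; first exact: doubly_stochastic_cos.
have mf : measurable_fun setT f by move/integrableP: intf => [/measurable_EFinP].
have k0 n p : (0 <= @cos_kernel2 R n p)%R by exact: cos_kernel_ge0.
have mfE : measurable_fun setT (fun x => `|(EFin \o f) x|).
  by apply: measurableT_comp => //; exact/measurable_EFinP.
have intf' : leb.-integrable `[0%R, 1%R] (EFin \o f).
  apply/integrableP; split; first by apply: measurable_funTS; exact/measurable_EFinP.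
  by rewrite -integral_uniform01//; move/integrableP: intf => [].
have [|g_ [cg _ gf]] := @approximation_continuous_integrable R `[0%R, 1%R]%classic f (measurable_itv _) _ intf'.
  have : leb `[0%R, 1%R]%classic < +oo by rewrite lebesgue_measure_itv/= lte_fin ltr01 -EFinD ltry.
  exact.
suff h (e : R) : (0 < e)%R -> \forall n \near \oo, oscillation U (@cos_kernel2 R n) f <= e%:E.
  apply/fine_cvgP; split.
    have := h 1%R ltr01; apply: filterS => n hn.
    by rewrite ge0_fin_numE ?oscillation_ge0//; exact: le_lt_trans hn (ltry _).
  apply/cvgrPdist_le => e e0; have := h e e0; apply: filterS => n hn /=.
  rewrite sub0r normrN ger0_norm ?fine_ge0 ?oscillation_ge0// -lee_fin fineK//.
  by rewrite ge0_fin_numE ?oscillation_ge0//; exact: le_lt_trans hn (ltry _).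
move=> e0.
have [m hm] : exists m, \int[leb]_(z in `[0%R, 1%R]) `|(f z - g_ m z)%:E| <= (e / 4)%:E.
  have e4 : 0 < (e / 4)%:E by rewrite lte_fin; lra.
  have [N _ hN] := (cvge_lt e4 gf : \forall n \near \oo, _).
  by exists N; rewrite ltW//; apply: hN => /=.
have e2 : 0 < (e / 2)%:E by rewrite lte_fin; lra.
have := cvge_lt e2 (cvg_oscillation_cos_continuous (cg m)).
apply: filterS => n hn.
have mg : measurable_fun setT (g_ m) by exact: continuous_measurable_fun.
apply: (le_trans (le_oscillationD (doubly_stochastic_cos n) mf mg)).
apply: (@le_trans _ _ ((e / 2)%:E + 2%:E * (e / 4)%:E)); last first.
  by rewrite -EFinM -EFinD lee_fin; lra.
apply: leeD; first exact: ltW.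
have mfg := measurable_funB mf mg.
apply: (le_trans (le_oscillation_norm (doubly_stochastic_cos n) mfg)).
apply: lee_wpmul2l; first by rewrite lee_fin.
rewrite integral_uniform01//.
by apply/measurable_EFinP/measurableT_comp.
Qed.

End cosine_approximate_identity.

(** * Product kernels on the cube *)

Section cube_kernel.
Context {R : realType}.
Local Open Scope ereal_scope.

Definition cube_kernel (d n : nat) (p : d.-tuple R * d.-tuple R) : R :=
  (\prod_(i < d) cos_kernel n (tnth p.1 i - tnth p.2 i))%R.

Lemma cube_kernel_ge0 d n (p : d.-tuple R * d.-tuple R) : (0 <= cube_kernel n p)%R.
Proof. by apply: prodr_ge0 => i _; exact: cos_kernel_ge0. Qed.

Lemma measurable_cube_kernel d n : measurable_fun setT (@cube_kernel d n).
Proof.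
apply: measurable_prod => i _.
apply: (measurableT_comp (@measurable_cos_kernel R n)); apply: measurable_funB.
- by apply: (measurableT_comp (measurable_tnth i)); exact: measurable_fst.
- by apply: (measurableT_comp (measurable_tnth i)); exact: measurable_snd.
Qed.

Lemma cube_kernel_cons d n (p q : R * d.-tuple R) :
  cube_kernel n (tuple_cons p, tuple_cons q) =
  tensor_kernel (@cos_kernel2 R n) (@cube_kernel d n) (p, q).
Proof.
rewrite /cube_kernel big_ord_recl /= /tensor_kernel/= /cos_kernel2 /= !tnth0.
by congr (_ * _)%R; apply: eq_bigr => i _; rewrite !tnthS.
Qed.

(** Induction follows the construction of [cube]: tensor with the circle kernel, then transport
    along [tuple_cons]. In dimension 0 the kernel is an empty product and a single point has no
    oscillation. *)
Lemma approximate_identity_cube d : approximate_identity (cube R d) (@cube_kernel d).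
Proof.
elim: d => [|d ih].
  split=> [n|f _].
    split.
    - exact: measurable_cube_kernel.
    - exact: cube_kernel_ge0.
    - move=> x; rewrite /= integral_dirac//=; last first.
        by apply/measurable_EFinP; exact: (measurable_fun_pair2 _ (@measurable_cube_kernel 0 n)).
      by rewrite diracE in_setT mul1e /cube_kernel big_ord0.
    - move=> x; rewrite /= integral_dirac//=; last first.
        by apply/measurable_EFinP; exact: (measurable_fun_pair1 _ (@measurable_cube_kernel 0 n)).
      by rewrite diracE in_setT mul1e /cube_kernel big_ord0.
  rewrite (_ : (fun n => _) = cst 0); first exact: cvg_cst.
  apply/funext => n; apply: integral0_eq => -[x y] _ /=.
  by rewrite (tuple0 x) (tuple0 y) subrr normr0 mulr0.
have ai := approximate_identity_tensor (@approximate_identity_cos R) ih.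
have consE (x : d.+1.-tuple R) : x = tuple_cons (thead x, [tuple of behead x]).
  by rewrite [LHS]tuple_eta.
apply: approximate_identity_distribution.
- by move=> n; exact: measurable_cube_kernel.
- by move=> n; exact: cube_kernel_ge0.
- move=> n x; rewrite ge0_integral_distribution/=; last 2 first.
  + by apply/measurable_EFinP; exact: (measurable_fun_pair2 _ (@measurable_cube_kernel d.+1 n)).
  + by move=> y; rewrite lee_fin cube_kernel_ge0.
  rewrite (consE x); under eq_integral do rewrite /= cube_kernel_cons.
  by case: ai => /(_ n) [_ _ h _] _; exact: h.
- move=> n x; rewrite ge0_integral_distribution/=; last 2 first.
  + by apply/measurable_EFinP; exact: (measurable_fun_pair1 _ (@measurable_cube_kernel d.+1 n)).
  + by move=> y; rewrite lee_fin cube_kernel_ge0.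
  rewrite (consE x); under eq_integral do rewrite /= cube_kernel_cons.
  by case: ai => /(_ n) [_ _ _ h] _; exact: h.
- move: ai; congr (approximate_identity _ _).
  by apply/funext => n; apply/funext => -[p q] /=; rewrite cube_kernel_cons.
Qed.

End cube_kernel.

(** * Calculus on the torus *)

(* A named version of ['D_v f], whose head symbol [rewrite] can find. *)
Definition ddir {R : realType} {d : nat} (v : 'rV[R]_d) (f : 'rV[R]_d -> R) :
  'rV[R]_d -> R := 'D_v f.

Section torus_calculus.
Context {R : realType} {d : nat}.
Variable A : 'M[R]_d.
Local Notation V := 'rV[R]_d.
Implicit Types (f g : V -> R) (u v x : V).

Definition lattice_coord x (i : 'I_d) : R := (x *m invmx A) 0 i.

Lemma derive_comp1 (g : R -> R) f x v (dg : R) : differentiable f x ->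
  is_derive (f x) 1 g dg ->
  differentiable (g \o f) x /\ ddir v (g \o f) x = dg * ddir v f x.
Proof.
move=> df [gd gE].
have dgf : differentiable g (f x) by apply/derivable1_diffP.
have dgof : differentiable (g \o f) x by exact: differentiable_comp.
split=> //; rewrite /ddir !deriveE// diff_comp//= -gE deriveE//.
by rewrite -[in LHS](mulr1 ('d f x v)) -[_ * 1]/(_ *: (1 : R)) linearZ/= mulrC.
Qed.

(** A class on which integration by parts holds and which is stable under the inverse and the square
    root of functions bounded below by a positive constant; such functions need not be trigonometric
    polynomials. *)
Record C1_periodic f : Prop := C1Periodic {
  C1_per : Defs.periodic A f ;
  C1_diff : forall x, differentiable f x ;
  C1_cont : forall v, continuous (ddir v f) }.

Lemma C1_continuous f : C1_periodic f -> continuous f.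
Proof. by move=> cf x; apply: differentiable_continuous; exact: (C1_diff cf). Qed.

Lemma periodic_derive f v : Defs.periodic A f -> Defs.periodic A (ddir v f).
Proof.
move=> pf i x; rewrite /ddir /derive pf; set F := (fun h => _); set G := (fun h => _).
rewrite (_ : F = G)//; apply/funext => h; rewrite /F /G /=.
by rewrite addrA pf.
Qed.

Lemma deriveD_fun f g v : (forall x, differentiable f x) ->
  (forall x, differentiable g x) -> ddir v (f \+ g) = ddir v f \+ ddir v g.
Proof.
by move=> df dg; apply/funext => x; rewrite /ddir deriveD//; exact: diff_derivable.
Qed.

Lemma deriveM_fun f g v : (forall x, differentiable f x) ->
  (forall x, differentiable g x) -> ddir v (f \* g) = (ddir v f \* g) \+ (f \* ddir v g).
Proof.
move=> df dg; apply/funext => x.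
rewrite /ddir (_ : (f \* g) = f * g)// deriveM; try exact: diff_derivable.
by rewrite /= /GRing.scale/= addrC [g x * _]mulrC.
Qed.

Lemma C1_periodic_cst (c : R) : C1_periodic (cst c).
Proof.
split=> [i x //|x|v]; first exact: differentiable_cst.
rewrite (_ : ddir v (cst c) = cst 0); first exact: cst_continuous.
by apply/funext => x; rewrite /ddir derive_cst.
Qed.

Lemma C1_periodicD f g : C1_periodic f -> C1_periodic g -> C1_periodic (f \+ g).
Proof.
move=> [pf df cf] [pg dg cg]; split=> [i x|x|v].
- by rewrite /= pf pg.
- exact: differentiableD.
- by rewrite deriveD_fun// => x; exact: (continuousD (cf v x) (cg v x)).
Qed.

Lemma C1_periodicM f g : C1_periodic f -> C1_periodic g -> C1_periodic (f \* g).
Proof.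
move=> Cf Cg; have [pf df cf] := Cf; have [pg dg cg] := Cg; split=> [i x|x|v].
- by rewrite /= pf pg.
- exact: differentiableM.
- rewrite deriveM_fun// => x.
  exact: (continuousD (continuousM (cf v x) (C1_continuous Cg (x := x)))
    (continuousM (C1_continuous Cf (x := x)) (cg v x))).
Qed.

(** The outer function is constrained only at values taken by [f], so that the inverse and the root
    are allowed when [f] stays away from 0. *)
Lemma C1_periodic_comp (g dg : R -> R) f : C1_periodic f ->
  (forall x, is_derive (f x) 1 g (dg (f x))) ->
  (forall x, {for f x, continuous dg}) ->
  C1_periodic (g \o f) /\ forall v, ddir v (g \o f) = (fun x => dg (f x) * ddir v f x).
Proof.
move=> Cf hg cg; have [pf df cf] := Cf.
have dE v : ddir v (g \o f) = (fun x => dg (f x) * ddir v f x).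
  by apply/funext => x; have [] := derive_comp1 v (df x) (hg x).
split=> //; split=> [i x|x|v].
- by rewrite /= pf.
- by have [] := derive_comp1 0 (df x) (hg x).
- rewrite dE => x; apply: (continuousM _ (cf v x)).
  by apply: continuous_comp; [exact: C1_continuous|exact: cg].
Qed.

Lemma derive_sum_dir (I : Type) (r : seq I) (a : I -> R) (w : I -> V) f x :
  differentiable f x ->
  ddir (\sum_(i <- r) a i *: w i) f x = \sum_(i <- r) a i * ddir (w i) f x.
Proof.
move=> df; rewrite /ddir deriveE// linear_sum/=; apply: eq_bigr => i _.
by rewrite linearZ/= deriveE.
Qed.

Lemma lattice_coordD x y i : lattice_coord (x + y) i = lattice_coord x i + lattice_coord y i.
Proof. by rewrite /lattice_coord mulmxDl mxE. Qed.

Lemma lattice_coordN x i : lattice_coord (- x) i = - lattice_coord x i.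
Proof. by rewrite /lattice_coord mulNmx mxE. Qed.

Lemma differentiable_lattice_coord i x :
  differentiable (fun x => lattice_coord x i) x /\
  forall v, ddir v (fun x => lattice_coord x i) x = lattice_coord v i.
Proof.
have lin : linear (fun x => lattice_coord x i : R).
  by move=> a u v; rewrite /lattice_coord mulmxDl -scalemxAl !mxE.
pose L : {linear V -> R} := HB.pack (fun x => lattice_coord x i : R)
  (GRing.isLinear.Build _ _ _ _ (fun x => lattice_coord x i : R) lin).
have cL : continuous L.
  move=> y; apply: differentiable_continuous.
  rewrite (_ : (L : V -> R) = \sum_(k < d) (fun x : V => x 0 k * invmx A k i)).
    apply: differentiable_sum => k.
    apply: differentiableM; last exact: differentiable_cst.
    exact: differentiable_coord.
  by apply/funext => z; rewrite fct_sumE /= /lattice_coord mxE.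
have dL : differentiable L x by exact: linear_differentiable.
by split=> // v; rewrite /ddir deriveE// (@diff_lin _ _ _ L).
Qed.

End torus_calculus.

(** * Trigonometric polynomials in the lattice coordinates *)

Section trigonometric_polynomials.
Context {R : realType} {d : nat}.
Variable A : 'M[R]_d.
Hypothesis hA : A \in unitmx.
Local Notation V := 'rV[R]_d.
Implicit Types (f g : V -> R) (u v x : V).

Definition lattice_angle x (i : 'I_d) : R := pi *+ 2 * lattice_coord A x i.

(** The algebra generated by the cosines and sines of the lattice angles, given by its generation
    rather than by Fourier coefficients, so that closure properties and identities are structural
    inductions. *)
Inductive trig_poly : (V -> R) -> Prop :=
| trig_cst c : trig_poly (cst c)
| trig_cos i : trig_poly (fun x => cos (lattice_angle x i))
| trig_sin i : trig_poly (fun x => sin (lattice_angle x i))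
| trig_add f g : trig_poly f -> trig_poly g -> trig_poly (f \+ g)
| trig_mul f g : trig_poly f -> trig_poly g -> trig_poly (f \* g).

Lemma lattice_angleD x y i : lattice_angle (x + y) i = lattice_angle x i + lattice_angle y i.
Proof. by rewrite /lattice_angle lattice_coordD mulrDr. Qed.

Lemma lattice_angleN x i : lattice_angle (- x) i = - lattice_angle x i.
Proof. by rewrite /lattice_angle lattice_coordN mulrN. Qed.

Lemma lattice_coord_row i j : lattice_coord A (row i A) j = (i == j)%:R.
Proof. by rewrite /lattice_coord -row_mul mulmxV// !mxE. Qed.

Lemma lattice_angle_row x i j : lattice_angle (x + row i A) j =
  lattice_angle x j + (if i == j then pi *+ 2 else 0).
Proof.
rewrite lattice_angleD; congr (_ + _); rewrite /lattice_angle lattice_coord_row.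
by case: eqP; rewrite ?mulr1 ?mulr0.
Qed.

Lemma derive_lattice_angle x i :
  differentiable (fun x => lattice_angle x i) x /\
  forall v, ddir v (fun x => lattice_angle x i) x = lattice_angle v i.
Proof.
have [dl lE] := differentiable_lattice_coord A i x.
have -> : (fun x => lattice_angle x i) = (pi *+ 2) *: (fun x => lattice_coord A x i : R).
  by apply/funext => z.
split=> [|v]; first exact: differentiableZ.
by rewrite /ddir deriveZ ?[derive _ _ _]lE//; exact: diff_derivable.
Qed.

Lemma derive_trig_cos v i : ddir v (fun x => cos (lattice_angle x i)) =
  cst (- lattice_angle v i) \* (fun x => sin (lattice_angle x i)).
Proof.
apply/funext => x; have [da aE] := derive_lattice_angle x i.
have [_ ->] := derive_comp1 v da (is_derive_cos (lattice_angle x i)).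
by rewrite aE /= mulrC mulrN mulNr.
Qed.

Lemma derive_trig_sin v i : ddir v (fun x => sin (lattice_angle x i)) =
  cst (lattice_angle v i) \* (fun x => cos (lattice_angle x i)).
Proof.
apply/funext => x; have [da aE] := derive_lattice_angle x i.
have [_ ->] := derive_comp1 v da (is_derive_sin (lattice_angle x i)).
by rewrite aE /= mulrC.
Qed.

Lemma differentiable_trig_cos i x : differentiable (fun x => cos (lattice_angle x i)) x.
Proof.
have [da aE] := derive_lattice_angle x i.
by have [] := derive_comp1 0 da (is_derive_cos (lattice_angle x i)).
Qed.

Lemma differentiable_trig_sin i x : differentiable (fun x => sin (lattice_angle x i)) x.
Proof.
have [da aE] := derive_lattice_angle x i.
by have [] := derive_comp1 0 da (is_derive_sin (lattice_angle x i)).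
Qed.

Lemma continuous_cstM (c : R) f : continuous f -> continuous (cst c \* f).
Proof. by move=> cf x; exact: (continuousM (@cst_continuous _ _ c x) (cf x)). Qed.

Lemma trig_C1 f : trig_poly f -> C1_periodic A f.
Proof.
elim=> [c|i|i|g h _ Cg _ Ch|g h _ Cg _ Ch].
- exact: C1_periodic_cst.
- split=> [j x|x|v]; first by rewrite lattice_angle_row; case: eqP; rewrite ?addr0 ?cosD2pi.
    exact: differentiable_trig_cos.
  rewrite derive_trig_cos; apply: continuous_cstM => x.
  by apply: differentiable_continuous; exact: differentiable_trig_sin.
- split=> [j x|x|v]; first by rewrite lattice_angle_row; case: eqP; rewrite ?addr0 ?sinD2pi.
    exact: differentiable_trig_sin.
  rewrite derive_trig_sin; apply: continuous_cstM => x.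
  by apply: differentiable_continuous; exact: differentiable_trig_cos.
- exact: C1_periodicD.
- exact: C1_periodicM.
Qed.

Lemma trig_differentiable f : trig_poly f -> forall x, differentiable f x.
Proof. by move=> /trig_C1[]. Qed.

Lemma trig_derive f v : trig_poly f -> trig_poly (ddir v f).
Proof.
elim=> [c|i|i|g h tg Dg th Dh|g h tg Dg th Dh].
- rewrite (_ : ddir v (cst c) = cst 0); first exact: trig_cst.
  by apply/funext => x; rewrite /ddir derive_cst.
- by rewrite derive_trig_cos; apply: trig_mul; [exact: trig_cst|exact: trig_sin].
- by rewrite derive_trig_sin; apply: trig_mul; [exact: trig_cst|exact: trig_cos].
- by rewrite deriveD_fun; [exact: trig_add|exact: trig_differentiable..].
- rewrite deriveM_fun; [|exact: trig_differentiable..].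
  by apply: trig_add; exact: trig_mul.
Qed.

Lemma derive_cst_fun (c : R) v : ddir v (cst c : V -> R) = cst 0.
Proof. by apply/funext => x; rewrite /ddir derive_cst. Qed.

Lemma derive_cstM_fun (c : R) f v : (forall x, differentiable f x) ->
  ddir v (cst c \* f) = cst c \* ddir v f.
Proof.
move=> df; rewrite (deriveM_fun v (fun x => differentiable_cst c x) df).
by apply/funext => x /=; rewrite derive_cst_fun mul0r add0r.
Qed.

(** On a generator both sides are the same multiple of that generator, and the Leibniz rule carries
    the symmetry through sums and products. *)
Lemma trig_deriveC f u v : trig_poly f -> ddir u (ddir v f) = ddir v (ddir u f).
Proof.
elim=> [c|i|i|g h tg Dg th Dh|g h tg Dg th Dh].
- have h w z : ddir w (ddir z (cst c : V -> R)) = cst 0.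
    by rewrite (derive_cst_fun c z); exact: derive_cst_fun.
  by rewrite (h u v) (h v u).
- have ds := differentiable_trig_sin i.
  rewrite (derive_trig_cos u i) (derive_trig_cos v i).
  rewrite (derive_cstM_fun _ u ds) (derive_cstM_fun _ v ds).
  rewrite (derive_trig_sin u i) (derive_trig_sin v i).
  by apply/funext => x /=; ring.
- have ds := differentiable_trig_cos i.
  rewrite (derive_trig_sin u i) (derive_trig_sin v i).
  rewrite (derive_cstM_fun _ u ds) (derive_cstM_fun _ v ds).
  rewrite (derive_trig_cos u i) (derive_trig_cos v i).
  by apply/funext => x /=; ring.
- have dg := trig_differentiable tg; have dh := trig_differentiable th.
  have dDg w := trig_differentiable (trig_derive w tg).
  have dDh w := trig_differentiable (trig_derive w th).
  rewrite (deriveD_fun u dg dh) (deriveD_fun v dg dh).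
  by rewrite (deriveD_fun u (dDg v) (dDh v)) (deriveD_fun v (dDg u) (dDh u)) Dg Dh.
- have dg := trig_differentiable tg; have dh := trig_differentiable th.
  have tDg w := trig_derive w tg; have tDh w := trig_derive w th.
  have dDg w := trig_differentiable (tDg w).
  have dDh w := trig_differentiable (tDh w).
  have dM1 w := trig_differentiable (trig_mul (tDg w) th).
  have dM2 w := trig_differentiable (trig_mul tg (tDh w)).
  rewrite (deriveM_fun u dg dh) (deriveM_fun v dg dh).
  rewrite (deriveD_fun u (dM1 v) (dM2 v)) (deriveD_fun v (dM1 u) (dM2 u)).
  rewrite (deriveM_fun u (dDg v) dh) (deriveM_fun v (dDg u) dh).
  rewrite (deriveM_fun u dg (dDh v)) (deriveM_fun v dg (dDh u)) Dg Dh.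
  by apply/funext => x /=; rewrite addrACA.
Qed.

Lemma trig_partial f s : trig_poly f -> trig_poly (partial s f).
Proof. by move=> tf; elim: s => // i s ih; exact: trig_derive. Qed.

Lemma trig_smooth f : trig_poly f -> smooth f.
Proof. by move=> tf s; apply: trig_differentiable; exact: trig_partial. Qed.

Lemma trig_sum (I : Type) (r : seq I) (F : I -> V -> R) :
  (forall i, trig_poly (F i)) -> trig_poly (fun x => \sum_(i <- r) F i x).
Proof.
move=> tF; elim: r => [|i r ih].
  by rewrite (_ : (fun x => _) = cst 0); [exact: trig_cst|apply/funext => x; rewrite big_nil].
rewrite (_ : (fun x => _) = F i \+ (fun x => \sum_(i <- r) F i x)).
  exact: trig_add.
by apply/funext => x; rewrite big_cons.
Qed.

(** A sum is indexed by the disjoint union of the two index types, a product by their Cartesian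
    product. The translates of [f] thus span a space of finite dimension, which is what turns a
    convolution with [f] into a finite sum. *)
Lemma trig_separation f : trig_poly f ->
  exists (I : finType) (a b : I -> V -> R),
    [/\ forall k, trig_poly (a k), forall k, trig_poly (b k) &
        forall x w, f (x - w) = \sum_k a k x * b k w].
Proof.
elim=> [c|i|i|g h _ [I [a [b [ta tb gE]]]] _ [J [a' [b' [ta' tb' hE]]]]
             |g h _ [I [a [b [ta tb gE]]]] _ [J [a' [b' [ta' tb' hE]]]]].
- exists unit, (fun=> cst c), (fun=> cst 1); split=> [_|_|x w]; try exact: trig_cst.
  by rewrite (big_pred1 tt) ?mulr1// => -[].
- exists bool, (fun e x => if e then cos (lattice_angle x i) else sin (lattice_angle x i)),
    (fun e x => if e then cos (lattice_angle x i) else sin (lattice_angle x i)).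
  split=> [[]|[]|x w]; try exact: trig_cos; try exact: trig_sin.
  by rewrite lattice_angleD lattice_angleN cosB big_bool.
- exists bool, (fun e x => if e then sin (lattice_angle x i) else - cos (lattice_angle x i)),
    (fun e x => if e then cos (lattice_angle x i) else sin (lattice_angle x i)).
  split=> [[]|[]|x w]; try exact: trig_cos; try exact: trig_sin.
    rewrite (_ : (fun x => _) = cst (-1) \* (fun x => cos (lattice_angle x i))).
      by apply: trig_mul; [exact: trig_cst|exact: trig_cos].
    by apply/funext => x; rewrite /= mulN1r.
  by rewrite lattice_angleD lattice_angleN sinB big_bool mulNr.
- exists (I + J)%type, (fun k => match k with inl i => a i | inr j => a' j end),
    (fun k => match k with inl i => b i | inr j => b' j end).
  by split=> [[]|[]|x w] //; rewrite /= gE hE big_sumType.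
- exists (I * J)%type, (fun k => a k.1 \* a' k.2), (fun k => b k.1 \* b' k.2).
  split=> [k|k|x w]; try exact: trig_mul.
  rewrite /= gE hE mulr_suml -(pair_bigA _ (fun i j => a i x * a' j x * (b i w * b' j w))) /=.
  apply: eq_bigr => i _; rewrite mulr_sumr; apply: eq_bigr => j _.
  by rewrite mulrACA.
Qed.

End trigonometric_polynomials.

(** * Integration over the torus *)

Section measurability_on_tuples.
Context {R : realType} {d : nat}.
Local Notation V := 'rV[R]_d.

Definition row_of_tuple (y : d.-tuple R) : V := \row_i tnth y i.

Let grid (n : nat) (k : d.-tuple int) : V := \row_i ((tnth k i)%:~R / n.+1%:R).

Let cell (n : nat) (y : d.-tuple R) : d.-tuple int :=
  [tuple Num.floor (tnth y i * n.+1%:R) | i < d].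

Let measurable_cell n k : measurable [set y | cell n y = k].
Proof.
rewrite (_ : [set y | _] = \bigcap_(i in [set: 'I_d])
    [set y | Num.floor (tnth y i * n.+1%:R) = tnth k i]).
  apply: fin_bigcap_measurable => // i _.
  rewrite (_ : [set y | _] = (fun y => tnth y i) @^-1`
    `[((tnth k i)%:~R / n.+1%:R : R), ((tnth k i + 1)%:~R / n.+1%:R)[%classic).
    rewrite -[X in measurable X]setTI; apply: measurable_tnth => //.
  apply/seteqP; split=> y /=; rewrite in_itv/= ler_pdivrMr// ltr_pdivlMr//.
    by move=> <-; apply: real_floor_itv; rewrite num_real.
  by move/floor_def.
apply/seteqP; split=> y /=.
  by move=> <- i _ /=; rewrite tnth_mktuple.
by move=> h; apply: eq_from_tnth => i; rewrite tnth_mktuple; exact: h.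
Qed.

(** Measurability on tuples is known through coordinates, continuity through the norm on row
    vectors. The link is [g] sampled at the corner of the grid cell of side [1 / (n + 1)] containing
    the point: it takes countably many values on measurable cells and converges pointwise to [g]. *)
Lemma measurable_continuous_row (g : V -> R) : continuous g ->
  measurable_fun setT (g \o row_of_tuple).
Proof.
move=> cg.
apply: (@measurable_fun_cvg _ _ _ _ (fun n y => g (grid n (cell n y)))).
- move=> n _ Y mY; rewrite setTI.
  rewrite (_ : _ @^-1` _ = \bigcup_k [set y | Y (g (grid n k)) /\ cell n y = k]).
    apply: countable_bigcupT_measurable => [|k]; first exact: countableP.
    have [Yk|nYk] := pselect (Y (g (grid n k))).
      rewrite (_ : [set y | _] = [set y | cell n y = k]); first exact: measurable_cell.
      by apply/seteqP; split=> y //= [].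
    rewrite (_ : [set y | _] = set0); first exact: measurable0.
    by apply/seteqP; split=> y //= [].
  apply/seteqP; split=> y /=; first by move=> Yy; exists (cell n y).
  by move=> [k _ [Yk ->]].
- move=> y _; apply/cvgrPdist_le => e e0.
  have /cvgrPdist_le/(_ _ e0)/nbhs_ballP[r /= r0 hr] := cg (row_of_tuple y).
  have : \forall n \near \oo, n.+1%:R^-1 < r.
    have /cvgrPdist_lt/(_ _ r0) := @cvg_harmonic R.
    by apply: filterS => n; rewrite sub0r normrN ger0_norm ?invr_ge0.
  apply: filterS => n nr; apply: hr; split=> // i j; rewrite /ball/= !mxE !tnth_mktuple.
  have := real_floor_itv (num_real (tnth y j * n.+1%:R)) => /andP[fl fu].
  have n0 : 0 < n.+1%:R :> R by [].
  rewrite ger0_norm; last by rewrite subr_ge0 ler_pdivrMr.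
  apply: le_lt_trans nr; rewrite lerBlDl -[X in _ <= _ + X]mul1r -mulrDl ler_pdivlMr//.
  by rewrite -intrD1 ltW.
Qed.

End measurability_on_tuples.

(** * Continuous periodic functions *)

Section torus_functions.
Context {R : realType} {d : nat}.
Variable A : 'M[R]_d.
Hypothesis hA : A \in unitmx.
Local Notation V := 'rV[R]_d.
Implicit Types (f g : V -> R).

Lemma continuous_mulmxr : continuous (fun x : V => x *m A).
Proof.
move=> x U /nbhs_ballP[e /= e0 hU].
have : \forall z \near x, forall j : 'I_d, ball ((x *m A) 0 j) e ((z *m A) 0 j).
  apply: (@filter_forall _ _ _ (nbhs x) (nbhs_filter x)) => j.
  have cj : {for x, continuous (fun z : V => (z *m A) 0 j : R)}.
    apply: differentiable_continuous.
    rewrite (_ : (fun z : V => _) = \sum_(k < d) (fun z : V => z 0 k * A k j)).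
      apply: differentiable_sum => k.
      by apply: differentiableM; [exact: differentiable_coord|exact: differentiable_cst].
    by apply/funext => z; rewrite fct_sumE mxE.
  by move/cvg_ballP : cj => /(_ _ e0).
apply: (@filterS _ (nbhs x) (nbhs_filter x)) => z hz.
by apply: hU; split=> // i j; rewrite !ord1.
Qed.

Lemma measurable_continuous_torus f : continuous f ->
  measurable_fun setT (f \o torus_pt A).
Proof.
move=> cf; rewrite (_ : f \o _ = (f \o (fun x : V => x *m A)) \o row_of_tuple)//.
apply: measurable_continuous_row => x.
by apply: continuous_comp; [exact: continuous_mulmxr|exact: cf].
Qed.

(** The periods of [f] form an additive group, and it contains the rows of [A]. *)
Lemma periodic_lattice f : Defs.periodic A f ->
  forall (k : 'I_d -> int) x, f (x + (\row_i (k i)%:~R) *m A) = f x.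
Proof.
move=> pf; pose P v := forall x, f (x + v) = f x.
have P0 : P 0 by move=> x; rewrite addr0.
have PD u v : P u -> P v -> P (u + v) by move=> hu hv x; rewrite addrA hv hu.
have PN u : P u -> P (- u) by move=> hu x; rewrite -[in RHS](subrK u x) hu.
have PZ (m : int) u : P u -> P (m%:~R *: u).
  move=> Pu; have Pn (n : nat) : P (n%:R *: u).
    by elim: n => [|n ih]; rewrite ?scale0r// -natr1 scalerDl scale1r; exact: PD.
  case: m => n; first exact: Pn.
  by rewrite NegzE intrN scaleNr; apply: PN; exact: Pn.
move=> k; change (P ((\row_i (k i)%:~R) *m A)); rewrite mulmx_sum_row.
apply: (big_ind P) => // i _; rewrite mxE; apply: PZ => x; exact: pf.
Qed.

(** Subtracting the integer parts of the lattice coordinates moves any point into the image of the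
    unit cube, which is compact. *)
Lemma continuous_periodic_bounded f : continuous f -> Defs.periodic A f ->
  exists2 M, 0 < M & forall x, `|f x| <= M.
Proof.
move=> cf pf; pose g := f \o (fun x : V => x *m A).
have cg : continuous g.
  by move=> x; apply: continuous_comp; [exact: continuous_mulmxr|exact: cf].
have cK : compact [set v : V | forall i, `[(0 : R), 1]%classic (v ord0 i)].
  by apply: (rV_compact (A := fun _ => `[(0 : R), 1]%classic)) => i; exact: segment_compact.
have /compact_bounded[M [_ hM]] : compact (g @` [set v : V | forall i, `[(0 : R), 1]%classic (v ord0 i)]).
  by apply: continuous_compact => //; exact: continuous_subspaceT.
exists (`|M| + 1) => [|x]; first by rewrite ltr_wpDl.
pose y := x *m invmx A.
pose k i : int := - Num.floor (y 0 i).
rewrite -(periodic_lattice pf k x).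
have -> : x + (\row_i (k i)%:~R) *m A = (y + \row_i (k i)%:~R) *m A.
  by rewrite mulmxDl /y -mulmxA mulVmx// mulmx1.
apply: (hM (`|M| + 1)); first by rewrite ltr_pwDr// ler_norm.
exists (y + \row_i (k i)%:~R) => // i; rewrite /= in_itv/= [(y + _) _ _]mxE [(\row__ _) _ _]mxE /k intrN.
have := real_floor_itv (num_real (y 0 i)); rewrite intrD1.
by rewrite [ord0]ord1 => /andP[? ?]; apply/andP; split; lra.
Qed.

End torus_functions.

(** * Integrals of partial derivatives over the cube *)

Section cube_integral_derivative.
Context {R : realType}.
Notation leb := (@lebesgue_measure R).
Notation U := (uniform_prob (@ltr01 R)).
Local Open Scope ereal_scope.

Definition upd {d : nat} (y : d.-tuple R) (j : 'I_d) (t : R) : d.-tuple R :=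
  [tuple (if i == j then t else tnth y i) | i < d].

Lemma upd_cons0 d (t s : R) (y : d.-tuple R) :
  upd (tuple_cons (t, y)) ord0 s = tuple_cons (s, y).
Proof.
apply: eq_from_tnth => i; rewrite tnth_mktuple.
by case: (unliftP ord0 i) => [k ->|->]; rewrite /= ?tnthS ?tnth0.
Qed.

Lemma upd_consS d (t s : R) (y : d.-tuple R) j :
  upd (tuple_cons (t, y)) (lift ord0 j) s = tuple_cons (t, upd y j s).
Proof.
apply: eq_from_tnth => i; rewrite tnth_mktuple.
case: (unliftP ord0 i) => [k ->|->]; last by rewrite /= !tnth0.
by rewrite !tnthS tnth_mktuple (inj_eq lift_inj).
Qed.

Lemma integral_uniform01_real (f : R -> R) : measurable_fun setT f ->
  \int[U]_x (f x)%:E = \int[leb]_(x in `[0%R, 1%R]) (f x)%:E.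
Proof.
move=> mf; have mEf : measurable_fun setT (EFin \o f) by exact/measurable_EFinP.
rewrite integralE [RHS]integralE; congr (_ - _).
- by apply: integral_uniform01 => //; exact: measurable_funepos.
- by apply: integral_uniform01 => //; exact: measurable_funeneg.
Qed.

Lemma bounded_integrable (d : measure_display) (T : measurableType d)
    (mu : probability T R) (f : T -> R) (M : R) :
  measurable_fun setT f -> (forall x, `|f x| <= M)%R ->
  mu.-integrable setT (EFin \o f).
Proof.
move=> mf fM; apply: measurable_bounded_integrable => //.
  by apply: (le_lt_trans (@probability_le1 _ _ _ mu _ measurableT)); rewrite ltry.
exists M; split; first exact: num_real.
by move=> x Mx y _ /=; rewrite (le_trans (fM y))// ltW.
Qed.

Lemma integral_uniform01_derive0 (F f : R -> R) :
  (forall t : R, is_derive t 1%R F (f t)) -> continuous f -> F 1%R = F 0%R ->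
  \int[U]_x (f x)%:E = 0.
Proof.
move=> dF cf F10; have dF' t : derivable F t 1%R by have [] := dF t.
have cF : continuous F.
  by move=> t; apply: differentiable_continuous; apply/derivable1_diffP.
rewrite integral_uniform01_real; last exact: continuous_measurable_fun.
rewrite (@continuous_FTC2 _ f F)//.
- by rewrite F10 subee.
- exact: continuous_subspaceT.
- split=> [t _ //||].
  + by apply: cvg_at_right_filter; exact: cF.
  + by apply: cvg_at_left_filter; exact: cF.
- by move=> t _; rewrite derive1E; have [_ ->] := dF t.
Qed.

(** If [j] is not the first coordinate, that coordinate is frozen and induction applies to the
    slice. Otherwise Fubini places the integral over the first coordinate innermost, where the
    fundamental theorem of calculus and the equal end values give 0. *)
Lemma cube_integral_derive0 d (j : 'I_d) (g h : d.-tuple R -> R) (M : R) :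
  measurable_fun setT h -> (forall y, `|h y| <= M)%R ->
  (forall y (t : R), is_derive t 1%R (fun s => g (upd y j s)) (h (upd y j t))) ->
  (forall y, continuous (fun t => h (upd y j t))) ->
  (forall y, g (upd y j 1%R) = g (upd y j 0%R)) ->
  \int[cube R d]_y (h y)%:E = 0.
Proof.
elim: d j g h => [[]//|d ih] j g h mh hM dg ch g10.
pose hc := h \o (@tuple_cons R d).
have mhc : measurable_fun setT hc.
  by apply: measurableT_comp => //; exact: measurable_tuple_cons.
have ihc : (U \x cube R d).-integrable setT (EFin \o hc).
  exact: (@bounded_integrable _ _ (U \x cube R d) hc M mhc (fun p => hM _)).
rewrite /= integral_distribution//; last exact/measurable_EFinP.
case: (unliftP ord0 j) dg ch g10 => [k ->|->] dg ch g10.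
- rewrite -(integral12_prod_meas1 ihc); apply: integral0_eq => t _.
  rewrite /fubini_F/=; apply: (ih k (fun y => g (tuple_cons (t, y)))).
  + exact: (measurable_fun_pair2 _ mhc).
  + by move=> y; exact: hM.
  + move=> y s; have := dg (tuple_cons (t, y)) s; rewrite upd_consS.
    by under eq_fun do rewrite upd_consS.
  + by move=> y; have := ch (tuple_cons (t, y)); under eq_fun do rewrite upd_consS.
  + by move=> y; have := g10 (tuple_cons (t, y)); rewrite !upd_consS.
- rewrite -(integral21_prod_meas1 ihc); apply: integral0_eq => y _.
  rewrite /fubini_G/=; apply: (integral_uniform01_derive0 (F := fun t => g (tuple_cons (t, y)))).
  + move=> s; have := dg (tuple_cons (0%R, y)) s; rewrite upd_cons0.
    by under eq_fun do rewrite upd_cons0.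
  + by have := ch (tuple_cons (0%R, y)); under eq_fun do rewrite upd_cons0.
  + by have := g10 (tuple_cons (0%R, y)); rewrite !upd_cons0.
Qed.

End cube_integral_derivative.

(** * Averages over the torus and integration by parts *)

Section torus_average.
Context {R : realType} {d : nat}.
Variable A : 'M[R]_d.
Hypothesis hA : A \in unitmx.
Local Notation V := 'rV[R]_d.
Local Notation mu := (cube R d).
Implicit Types (f g : V -> R) (v x : V).

Definition C0_periodic f : Prop := continuous f /\ Defs.periodic A f.

(** The average is taken for the probability [cube], which keeps the volume of the torus out of the
    estimates. *)
Definition avg f : R := \int[mu]_y f (torus_pt A y).

Lemma C0_periodic_bounded f : C0_periodic f -> exists2 M, 0 < M & forall x, `|f x| <= M.
Proof. by move=> [cf pf]; exact: (continuous_periodic_bounded hA). Qed.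

Lemma C0_periodic_measurable f : C0_periodic f -> measurable_fun setT (f \o torus_pt A).
Proof. by move=> [cf _]; exact: measurable_continuous_torus. Qed.

Lemma C0_periodic_integrable f : C0_periodic f ->
  mu.-integrable setT (EFin \o (f \o torus_pt A)).
Proof.
move=> Cf; have [M _ fM] := C0_periodic_bounded Cf.
exact: (@bounded_integrable _ _ _ mu _ M (C0_periodic_measurable Cf) (fun y => fM _)).
Qed.

Lemma C0_periodic_cst (c : R) : C0_periodic (cst c).
Proof. by split=> //; exact: cst_continuous. Qed.

Lemma C0_periodicD f g : C0_periodic f -> C0_periodic g -> C0_periodic (f \+ g).
Proof.
move=> [cf pf] [cg pg]; split=> [x|i x]; first exact: (continuousD (cf x) (cg x)).
by rewrite /= pf pg.
Qed.

Lemma C0_periodicM f g : C0_periodic f -> C0_periodic g -> C0_periodic (f \* g).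
Proof.
move=> [cf pf] [cg pg]; split=> [x|i x]; first exact: (continuousM (cf x) (cg x)).
by rewrite /= pf pg.
Qed.

Lemma C0_periodicZ (c : R) f : C0_periodic f -> C0_periodic (fun x => c * f x).
Proof. by move=> Cf; exact: (C0_periodicM (C0_periodic_cst c) Cf). Qed.

Lemma C0_periodicX f n : C0_periodic f -> C0_periodic (fun x => f x ^+ n).
Proof.
move=> Cf; elim: n => [|n ih]; first exact: (C0_periodic_cst 1).
rewrite (_ : (fun x => _) = f \* (fun x => f x ^+ n)); first exact: C0_periodicM.
by apply/funext => x; rewrite /= exprS.
Qed.

Lemma C0_periodic_sum (I : Type) (r : seq I) (F : I -> V -> R) :
  (forall i, C0_periodic (F i)) -> C0_periodic (fun x => \sum_(i <- r) F i x).
Proof.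
move=> CF; elim: r => [|i r ih].
  rewrite (_ : (fun x => _) = cst 0); first exact: C0_periodic_cst.
  by apply/funext => x; rewrite big_nil.
rewrite (_ : (fun x => _) = F i \+ (fun x => \sum_(i <- r) F i x)).
  exact: C0_periodicD.
by apply/funext => x; rewrite big_cons.
Qed.

Lemma avgD f g : C0_periodic f -> C0_periodic g -> avg (f \+ g) = avg f + avg g.
Proof. by move=> Cf Cg; rewrite /avg RintegralD//; exact: C0_periodic_integrable. Qed.

Lemma avgZ (c : R) f : C0_periodic f -> avg (fun x => c * f x) = c * avg f.
Proof. by move=> Cf; rewrite /avg RintegralZl//; exact: C0_periodic_integrable. Qed.

Lemma avg_sum (I : Type) (r : seq I) (F : I -> V -> R) :
  (forall i, C0_periodic (F i)) ->
  avg (fun x => \sum_(i <- r) F i x) = \sum_(i <- r) avg (F i).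
Proof.
move=> CF; elim: r => [|i r ih].
  rewrite big_nil /avg; under eq_Rintegral do rewrite big_nil.
  by rewrite /Rintegral integral0.
rewrite big_cons -ih -avgD//; last exact: C0_periodic_sum.
by congr avg; apply/funext => x; rewrite big_cons.
Qed.

Lemma le_avg f g : C0_periodic f -> C0_periodic g -> (forall x, f x <= g x) -> avg f <= avg g.
Proof.
move=> Cf Cg fg; rewrite /avg; apply: le_Rintegral => //;
  exact: C0_periodic_integrable.
Qed.

Lemma avgE f : C0_periodic f -> ((avg f)%:E = \int[mu]_y (f (torus_pt A y))%:E)%E.
Proof.
move=> Cf; rewrite /avg /Rintegral fineK//.
by apply: integrable_fin_num => //; exact: C0_periodic_integrable.
Qed.

Lemma C1_C0 f : C1_periodic A f -> C0_periodic f.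
Proof. by move=> Cf; split; [exact: (C1_continuous Cf)|exact: (C1_per Cf)]. Qed.

Lemma C1_C0_ddir f v : C1_periodic A f -> C0_periodic (ddir v f).
Proof.
by move=> Cf; split; [exact: (C1_cont Cf)|apply: periodic_derive; exact: (C1_per Cf)].
Qed.

Lemma torus_pt_upd (y : d.-tuple R) j s :
  torus_pt A (upd y j s) = (torus_pt A y - tnth y j *: row j A) + s *: row j A.
Proof.
rewrite -addrA -scaleNr -scalerDl /torus_pt rowE scalemxAl -mulmxDl; congr (_ *m _).
apply/rowP => i; rewrite !mxE tnth_mktuple eqxx andTb; case: eqP => [->|_].
  by rewrite mulr1; ring.
by rewrite mulr0 addr0.
Qed.

Lemma is_derive_line f (a v : V) (t : R) : (forall x, differentiable f x) ->
  is_derive t 1 (fun s => f (a + s *: v)) (ddir v f (a + t *: v)).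
Proof.
move=> df; have := @diff_derivable _ _ _ f (a + t *: v) v (df _).
rewrite /ddir => fd.
have E : (fun h : R => h^-1 *: (((fun s : R => f (a + s *: v)) \o shift t) (h *: 1) -
    f (a + t *: v))) =
  (fun h => h^-1 *: ((f \o shift (a + t *: v)) (h *: v) - f (a + t *: v))).
  apply/funext => h /=; rewrite -[h *: 1]/(h * 1) mulr1 scalerDl.
  by congr (_ *: (f _ - _)); rewrite addrCA.
by split; rewrite /derivable /derive E.
Qed.

(** Moving along row [j] changes only the [j]-th cube coordinate, and moving by the whole row is a
    period. *)
Lemma avg_ddir_row f j : C1_periodic A f -> avg (ddir (row j A) f) = 0.
Proof.
move=> Cf; have C0 := C1_C0_ddir (row j A) Cf.
have [M _ fM] := C0_periodic_bounded C0.
rewrite /avg /Rintegral; apply: (f_equal fine (y := 0%E)).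
apply: (@cube_integral_derive0 R d j (f \o torus_pt A) (ddir (row j A) f \o torus_pt A) M).
- exact: C0_periodic_measurable.
- by move=> y; exact: fM.
- move=> y t /=; rewrite torus_pt_upd; under eq_fun do rewrite torus_pt_upd.
  by apply: is_derive_line; exact: (C1_diff Cf).
- move=> y; under eq_fun do rewrite /= torus_pt_upd.
  move=> t; apply: continuous_comp; last exact: (C1_cont Cf).
  apply: cvgD; first exact: cvg_cst.
  by apply: cvgZr_tmp; exact: cvg_id.
- by move=> y /=; rewrite !torus_pt_upd scale1r scale0r addr0 (C1_per Cf).
Qed.

(** As [A] is invertible its rows form a basis, so [v] is a combination of the directions already
    treated. This is how derivatives along the standard axes, which need not be lattice directions,
    are reached. *)
Lemma avg_ddir f v : C1_periodic A f -> avg (ddir v f) = 0.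
Proof.
move=> Cf; have vE : v = \sum_j (v *m invmx A) 0 j *: row j A.
  by rewrite -mulmx_sum_row -mulmxA mulVmx// mulmx1.
have -> : ddir v f = (fun x => \sum_j (v *m invmx A) 0 j * ddir (row j A) f x).
  apply/funext => x; rewrite [in LHS]vE derive_sum_dir//; exact: (C1_diff Cf).
rewrite avg_sum => [|j]; last by apply: C0_periodicZ; exact: C1_C0_ddir.
by rewrite big1// => j _; rewrite avgZ ?avg_ddir_row ?mulr0//; exact: C1_C0_ddir.
Qed.

Lemma avg_by_parts f g v : C1_periodic A f -> C1_periodic A g ->
  avg (ddir v f \* g) = - avg (f \* ddir v g).
Proof.
move=> Cf Cg; apply/eqP; rewrite -addr_eq0 -avgD.
- by rewrite -deriveM_fun ?avg_ddir//; [exact: C1_periodicM|exact: (C1_diff Cf)|exact: (C1_diff Cg)].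
- by apply: C0_periodicM; [exact: C1_C0_ddir|exact: C1_C0].
- by apply: C0_periodicM; [exact: C1_C0|exact: C1_C0_ddir].
Qed.

Lemma smooth_C1 f : smooth f -> Defs.periodic A f -> C1_periodic A f.
Proof.
move=> sf pf; split=> // [x|v]; first exact: (sf [::]).
have -> : ddir v f = (fun x => \sum_i v 0 i * ddir (delta_mx 0 i) f x).
  apply/funext => x; rewrite [in LHS](row_sum_delta v) derive_sum_dir//.
  exact: (sf [::]).
have ci i : C0_periodic (ddir (delta_mx 0 i) f).
  split; last exact: periodic_derive.
  by move=> x; apply: differentiable_continuous; exact: (sf [:: i]).
by have [] := C0_periodic_sum (index_enum 'I_d) (fun i => C0_periodicZ (v 0 i) (ci i)).
Qed.

End torus_average.

(** * The inequality for trigonometric polynomials *)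

Section smooth_inequality.
Context {R : realType} {d : nat}.
Variable A : 'M[R]_d.
Hypothesis hA : A \in unitmx.
Local Notation V := 'rV[R]_d.
Implicit Types (f g : V -> R) (v x : V).

Lemma C1_periodic_inv f (e : R) : 0 < e -> (forall x, e <= f x) -> C1_periodic A f ->
  C1_periodic A (fun x => (f x)^-1) /\
  forall v, ddir v (fun x => (f x)^-1) = (fun x => - (f x) ^- 2 * ddir v f x).
Proof.
move=> e0 ef Cf; have f0 x : f x != 0 by rewrite gt_eqF// (lt_le_trans e0).
apply: (@C1_periodic_comp _ _ _ (fun t => t^-1) (fun t => - t ^- 2)) => // x.
- split; first by apply: derivableV; [exact: f0|exact: derivable_id].
  by rewrite deriveV// ?derive_id ?scaler1//; exact: f0.
- apply: continuousN; apply: continuousV; first by rewrite expf_neq0.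
  exact: exprn_continuous.
Qed.

Lemma C1_periodic_sqrt f (e : R) : 0 < e -> (forall x, e <= f x) -> C1_periodic A f ->
  C1_periodic A (fun x => Num.sqrt (f x)) /\
  forall v, ddir v (fun x => Num.sqrt (f x)) =
    (fun x => (2 * Num.sqrt (f x))^-1 * ddir v f x).
Proof.
move=> e0 ef Cf; have f0 x : 0 < f x by rewrite (lt_le_trans e0).
apply: (@C1_periodic_comp _ _ _ Num.sqrt (fun t => (2 * Num.sqrt t)^-1)) => // x.
- exact: is_derive1_sqrt.
- apply: continuousV; first by rewrite mulf_neq0// gt_eqF// sqrtr_gt0.
  apply: continuousM; first exact: cst_continuous.
  exact: sqrt_continuous.
Qed.

Definition grad_sqr f x : R := \sum_i (ddir (delta_mx 0 i) f x) ^+ 2.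
Definition laplacian f x : R := \sum_i ddir (delta_mx 0 i) (ddir (delta_mx 0 i) f) x.
Local Notation D i := (ddir (delta_mx 0 i)).

Lemma trig_C0 f : trig_poly A f -> C0_periodic A f.
Proof. by move=> tf; apply: C1_C0; exact: trig_C1. Qed.

(** One integration by parts on each side turns [D i (D j f) * D i (D j f)] and
    [D j (D j f) * D i (D i f)] into [D j f] times a third derivative, and these third derivatives
    agree by symmetry. *)
Lemma avg_hessian f : trig_poly A f ->
  avg A (fun x => \sum_i \sum_j (D i (D j f) x) ^+ 2) =
  avg A (fun x => (laplacian f x) ^+ 2).
Proof.
move=> tf; have tD i := trig_derive hA (delta_mx 0 i) tf.
have tDD i j := trig_derive hA (delta_mx 0 i) (tD j).
have C0D i j := trig_C0 (tDD i j).
transitivity (\sum_i \sum_j avg A (D i (D j f) \* D i (D j f))).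
  rewrite (avg_sum hA); last first.
    move=> i; apply: C0_periodic_sum => j; exact: C0_periodicX.
  apply: eq_bigr => i _; rewrite (avg_sum hA); last by move=> j; exact: C0_periodicX.
  by apply: eq_bigr => j _; congr avg; apply/funext => x; rewrite expr2.
transitivity (\sum_i \sum_j avg A (D j (D j f) \* D i (D i f))).
  apply: eq_bigr => i _; apply: eq_bigr => j _.
  have comm : D i (D i (D j f)) = D j (D i (D i f)).
    rewrite (trig_deriveC hA (delta_mx 0 i) (delta_mx 0 j) tf).
    exact: (trig_deriveC hA (delta_mx 0 i) (delta_mx 0 j) (tD i)).
  have := avg_by_parts hA (delta_mx 0 i) (trig_C1 hA (tD j)) (trig_C1 hA (tDD i j)).
  have := avg_by_parts hA (delta_mx 0 j) (trig_C1 hA (tD j)) (trig_C1 hA (tDD i i)).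
  move=> e1 e2; apply: (etrans e2); apply: (etrans _ (esym e1)).
  exact: (f_equal (fun h => - avg A (D j f \* h)) comm).
apply/esym; rewrite (_ : (fun x => _) = (fun x => \sum_i \sum_j (D j (D j f) x * D i (D i f) x))).
  rewrite (avg_sum hA); last first.
    by move=> i; apply: C0_periodic_sum => j; apply: C0_periodicM.
  apply: eq_bigr => i _; apply: (avg_sum hA) => j; exact: C0_periodicM.
apply/funext => x; rewrite expr2 /laplacian mulr_sumr; apply: eq_bigr => i _.
by rewrite mulr_suml.
Qed.

(** Here [w], [P], [D2], [p], [h] stand for [1/f], [|grad f|^2], the Laplacian, the gradient and the
    Hessian. The squares of [P w - 3 D2] and of [w p_i p_j - 3 h_ij] give the shares
    [1/6 + 1/3 = 1/2] of [(P w)^2]. The weight 3 is optimal: after absorption it recovers what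
    Cauchy-Schwarz gives, namely that the L^2 norm of [P w] is at most three times that of the
    Laplacian. *)
Lemma fisher_pointwise (w D2 P : R) (p : 'I_d -> R) (h : 'I_d -> 'I_d -> R) :
  P = \sum_i p i ^+ 2 ->
  w * P * D2 + 2 * w * (\sum_i \sum_j p j * h i j * p i) <=
  2^-1 * (P * w) ^+ 2 + 3 / 2 * D2 ^+ 2 + 3 * \sum_i \sum_j (h i j) ^+ 2.
Proof.
move=> PE.
have e1 : w * P * D2 <= 6^-1 * (P * w) ^+ 2 + 3 / 2 * D2 ^+ 2.
  have := sqr_ge0 (P * w - 3 * D2); lra.
have e2 : 2 * w * (\sum_i \sum_j p j * h i j * p i) <=
    3^-1 * (P * w) ^+ 2 + 3 * \sum_i \sum_j (h i j) ^+ 2.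
  (* [P^2] is the sum of all [p_i^2 p_j^2], so that it can be compared with the Hessian entry by
     entry. *)
  have -> : (P * w) ^+ 2 = \sum_i \sum_j (w * p i * p j) ^+ 2.
    rewrite exprMn [P ^+ 2]expr2 {1}PE mulr_suml mulr_suml; apply: eq_bigr => i _.
    by rewrite PE mulr_sumr mulr_suml; apply: eq_bigr => j _; ring.
  rewrite !mulr_sumr -big_split/=; apply: ler_sum => i _.
  rewrite !mulr_sumr -big_split/=; apply: ler_sum => j _.
  have := sqr_ge0 (w * p i * p j - 3 * h i j); lra.
by move: e1 e2; lra.
Qed.

Lemma smooth_fisher f (e : R) : 0 < e -> (forall x, e <= f x) -> trig_poly A f ->
  avg A (fun x => (grad_sqr f x / f x) ^+ 2) <= 9 * avg A (fun x => (laplacian f x) ^+ 2).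
Proof.
move=> e0 ef tf; have tD i := trig_derive hA (delta_mx 0 i) tf.
have tDD i j := trig_derive hA (delta_mx 0 i) (tD j).
have C0DD i j := trig_C0 (tDD i j).
have [Cw wE] := C1_periodic_inv e0 ef (trig_C1 hA tf).
pose w x := (f x)^-1.
have tP : trig_poly A (grad_sqr f).
  rewrite /grad_sqr; apply: trig_sum => i.
  rewrite (_ : (fun x => _) = D i f \* D i f); first exact: trig_mul.
  by apply/funext => x; rewrite /= expr2.
have DP i : D i (grad_sqr f) = (fun x => \sum_j 2 * (D j f x * D i (D j f) x)).
  have CE j : forall x, differentiable (D j f) x by exact: (trig_differentiable hA (tD j)).
  apply/funext => x; rewrite /ddir.
  have -> : grad_sqr f = \sum_j (D j f * D j f).
    by apply/funext => z; rewrite fct_sumE /grad_sqr; apply: eq_bigr => j _; rewrite expr2.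
  rewrite derive_sum; last by move=> j; apply: derivableM; exact: diff_derivable.
  apply: eq_bigr => j _; rewrite deriveM; try exact: diff_derivable.
  transitivity (D j f x * D i (D j f) x + D j f x * D i (D j f) x); first by [].
  by rewrite mulr_natl mulr2n.
pose X i := (grad_sqr f \* D i f) \* w.
have CX i : C1_periodic A (X i).
  by apply: C1_periodicM => //; apply: trig_C1 => //; exact: trig_mul.
have XE i : D i (X i) = (fun x =>
    2 * w x * (\sum_j D j f x * D i (D j f) x * D i f x) +
    w x * grad_sqr f x * D i (D i f) x - grad_sqr f x * w x ^+ 2 * D i f x ^+ 2).
  rewrite /X (deriveM_fun _ (trig_differentiable hA (trig_mul tP (tD i))) (C1_diff Cw)).
  rewrite (deriveM_fun _ (trig_differentiable hA tP) (trig_differentiable hA (tD i))).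
  rewrite DP wE; apply/funext => x /=; rewrite -exprVn -/(w x) -mulr_sumr -mulr_suml.
  by move: (\sum_j _) (w x) (grad_sqr f x) (D i f x) (D i (D i f) x) => *; ring.
have CE : C0_periodic A (fun x => (grad_sqr f x * w x) ^+ 2).
  by apply: C0_periodicX; apply: C0_periodicM; [exact: trig_C0|exact: C1_C0].
have C0L : C0_periodic A (fun x => laplacian f x ^+ 2).
  by apply: C0_periodicX; apply: C0_periodic_sum.
have C0H : C0_periodic A (fun x => \sum_i \sum_j (D i (D j f) x) ^+ 2).
  by apply: C0_periodic_sum => i; apply: C0_periodic_sum => j; exact: C0_periodicX.
have C0X i : C0_periodic A (D i (X i)) by exact: C1_C0_ddir.
have div0 : avg A (fun x => \sum_i D i (X i) x) = 0.
  by rewrite (avg_sum hA)// big1// => i _; exact: avg_ddir.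
have divE x : \sum_i D i (X i) x = 2 * w x * (\sum_i \sum_j D j f x * D i (D j f) x * D i f x) +
    w x * grad_sqr f x * laplacian f x - (grad_sqr f x * w x) ^+ 2.
  under eq_bigr do rewrite XE.
  rewrite sumrB big_split /= -!mulr_sumr -/(laplacian f x) -/(grad_sqr f x).
  by congr (_ - _); ring.
have C1E := C0_periodicZ 2^-1 CE; have C1L := C0_periodicZ (3 / 2) C0L.
have C1H := C0_periodicZ 3 C0H; have CLH := C0_periodicD C1L C1H.
have CR := C0_periodicD C1E CLH.
have Cdiv := C0_periodic_sum (index_enum 'I_d) C0X.
(* Pointwise, adding the divergence cancels [(P w)^2] and leaves the left side of
   [fisher_pointwise]; on average the divergence contributes nothing. Half of the average of
   [(P w)^2] is then absorbed, and [3/2 + 3] doubles to 9. *)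
have le := le_avg hA (C0_periodicD CE Cdiv) CR.
rewrite (avgD hA CE Cdiv) div0 addr0 (avgD hA C1E CLH) (avgD hA C1L C1H) in le.
rewrite (avgZ hA _ CE) (avgZ hA _ C0L) (avgZ hA _ C0H) (avg_hessian tf) in le.
suff : avg A (fun x => (grad_sqr f x * w x) ^+ 2) <=
    2^-1 * avg A (fun x => (grad_sqr f x * w x) ^+ 2) +
    (3 / 2 * avg A (fun x => laplacian f x ^+ 2) + 3 * avg A (fun x => laplacian f x ^+ 2)).
  rewrite /w; lra.
apply: le => x; rewrite /= divE.
have := fisher_pointwise (w x) (laplacian f x) (fun i j => D i (D j f) x)
  (erefl (grad_sqr f x)); lra.
Qed.

End smooth_inequality.

(** * Mollification *)

Section mollification.
Context {R : realType} {d : nat}.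
Variable A : 'M[R]_d.
Hypothesis hA : A \in unitmx.
Local Notation V := 'rV[R]_d.
Local Notation mu := (cube R d).
Implicit Types (f g k : V -> R) (v x w : V).

Definition torus_integrable f : Prop := mu.-integrable setT (EFin \o (f \o torus_pt A)).

Lemma torus_integrable_measurable f : torus_integrable f ->
  measurable_fun setT (f \o torus_pt A).
Proof. by move=> /integrableP[/measurable_EFinP]. Qed.

Lemma torus_integrableM f g : torus_integrable f -> C0_periodic A g ->
  torus_integrable (f \* g).
Proof.
move=> hf Cg; have [M M0 gM] := C0_periodic_bounded hA Cg.
have mf := torus_integrable_measurable hf; have mg := C0_periodic_measurable Cg.
apply: (@le_integrable _ _ _ mu setT measurableT _
  (fun y => (M%:E * (EFin \o (f \o torus_pt A)) y)%E)).
- by apply/measurable_EFinP; exact: measurable_funM.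
- move=> y _ /=; rewrite lee_fin !normrM mulrC ler_wpM2r//.
  by rewrite (gtr0_norm M0).
- exact: integrableZl.
Qed.

Definition moll k f x : R := \int[mu]_z (f (torus_pt A z) * k (x - torus_pt A z)).

Lemma trig_lin (I : finType) (c : I -> R) (a : I -> V -> R) :
  (forall i, trig_poly A (a i)) -> trig_poly A (fun x => \sum_i c i * a i x).
Proof.
move=> ta; apply: trig_sum => i.
rewrite (_ : (fun x => _) = cst (c i) \* a i)//.
by apply: trig_mul => //; exact: trig_cst.
Qed.

Lemma ddir_lin (I : finType) (c : I -> R) (a : I -> V -> R) v :
  (forall i, trig_poly A (a i)) ->
  ddir v (fun x => \sum_i c i * a i x) = (fun x => \sum_i c i * ddir v (a i) x).
Proof.
move=> ta.
suff h (r : seq I) : ddir v (fun x => \sum_(i <- r) c i * a i x) =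
    (fun x => \sum_(i <- r) c i * ddir v (a i) x) by exact: h.
have tc i : trig_poly A (cst (c i) \* a i).
  by apply: trig_mul => //; exact: trig_cst.
elim: r => [|i r ih].
  rewrite (_ : (fun x => \sum_(i <- [::]) c i * a i x) = cst 0); last first.
    by apply/funext => x; rewrite big_nil.
  by rewrite derive_cst_fun; apply/funext => x; rewrite big_nil.
rewrite (_ : (fun x => \sum_(j <- i :: r) c j * a j x) =
    (cst (c i) \* a i) \+ (fun x => \sum_(j <- r) c j * a j x)); last first.
  by apply/funext => x; rewrite big_cons.
have tr : trig_poly A (fun x => \sum_(j <- r) c j * a j x) by exact: trig_sum tc.
rewrite (deriveD_fun v (trig_differentiable hA (tc i)) (trig_differentiable hA tr)).
rewrite (derive_cstM_fun _ v (trig_differentiable hA (ta i))) ih.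
by apply/funext => x; rewrite big_cons.
Qed.

Lemma ddir_shift k v w : ddir v (fun x => k (x - w)) = (fun x => ddir v k (x - w)).
Proof.
apply/funext => x; rewrite /ddir /derive.
set F := (fun h => _); set G := (fun h => _).
by rewrite (_ : F = G)//; apply/funext => h; rewrite /F /G /= addrA.
Qed.

Lemma ddir_reflect k v x : (forall z, differentiable k z) ->
  ddir v (fun w => k (x - w)) = (fun w => - ddir v k (x - w)).
Proof.
move=> dk; apply/funext => w; transitivity (ddir (- v) k (x - w)).
  rewrite /ddir /derive; set F := (fun h => _); set G := (fun h => _).
  rewrite (_ : F = G)//; apply/funext => h; rewrite /F /G /=.
  by rewrite opprD scalerN addrCA.
by rewrite /ddir !deriveE// linearN.
Qed.

Section separated.
Variables (k : V -> R) (I : finType) (a b : I -> V -> R).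
Hypothesis ta : forall i, trig_poly A (a i).
Hypothesis tb : forall i, trig_poly A (b i).
Hypothesis kE : forall x w, k (x - w) = \sum_i a i x * b i w.

Lemma integral_separated f (c : I -> R) : torus_integrable f ->
  \int[mu]_z (f (torus_pt A z) * \sum_i c i * b i (torus_pt A z)) =
  \sum_i (\int[mu]_z (f (torus_pt A z) * b i (torus_pt A z))) * c i.
Proof.
move=> hf.
have ib i : torus_integrable (f \* b i) by apply: torus_integrableM => //; exact: trig_C0.
have iZ i : mu.-integrable setT (EFin \o (fun z => c i * (f (torus_pt A z) * b i (torus_pt A z)))).
  exact: (@integrableZl _ _ _ mu setT measurableT (c i) _ (ib i)).
suff h (r : seq I) :
    mu.-integrable setT (EFin \o (fun z => f (torus_pt A z) * \sum_(i <- r) c i * b i (torus_pt A z))) /\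
    \int[mu]_z (f (torus_pt A z) * \sum_(i <- r) c i * b i (torus_pt A z)) =
    \sum_(i <- r) (\int[mu]_z (f (torus_pt A z) * b i (torus_pt A z))) * c i.
  by have [_] := h (index_enum I).
elim: r => [|i r [ih1 ih2]].
  split.
    rewrite (_ : _ \o _ = cst 0%E); first exact: integrable0.
    by apply/funext => z; rewrite /= big_nil mulr0.
  under eq_Rintegral do rewrite big_nil mulr0.
  by rewrite big_nil /Rintegral integral0.
have E : (fun z => f (torus_pt A z) * \sum_(j <- i :: r) c j * b j (torus_pt A z)) =
  (fun z => c i * (f (torus_pt A z) * b i (torus_pt A z)) +
    f (torus_pt A z) * \sum_(j <- r) c j * b j (torus_pt A z)).
  by apply/funext => z; rewrite big_cons mulrDr mulrCA.
rewrite E; split.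
  exact: (integrableD measurableT (iZ i) ih1).
rewrite RintegralD// ih2 big_cons; congr (_ + _).
by rewrite RintegralZl 1?mulrC//; exact: ib.
Qed.

Lemma moll_separated f : torus_integrable f -> moll k f =
  (fun x => \sum_i (\int[mu]_z (f (torus_pt A z) * b i (torus_pt A z))) * a i x).
Proof.
move=> hf; apply/funext => x; rewrite /moll; under eq_Rintegral do rewrite kE.
exact: (integral_separated (fun i => a i x)).
Qed.

Lemma moll_ddir_separated f v : torus_integrable f -> moll (ddir v k) f =
  (fun x => \sum_i (\int[mu]_z (f (torus_pt A z) * b i (torus_pt A z))) * ddir v (a i) x).
Proof.
move=> hf; apply/funext => x; rewrite /moll.
have DkE w : ddir v k (x - w) = \sum_i ddir v (a i) x * b i w.
  have -> : ddir v k (x - w) = ddir v (fun z => k (z - w)) x by rewrite ddir_shift.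
  have -> : (fun z => k (z - w)) = (fun z => \sum_i b i w * a i z).
    by apply/funext => z; rewrite kE; apply: eq_bigr => i _; rewrite mulrC.
  by rewrite ddir_lin//; apply: eq_bigr => i _; rewrite mulrC.
under eq_Rintegral do rewrite DkE.
exact: (integral_separated (fun i => ddir v (a i) x)).
Qed.

End separated.

Lemma moll_trig k f : trig_poly A k -> torus_integrable f -> trig_poly A (moll k f).
Proof.
move=> tk hf; have [I [a [b [ta tb kE]]]] := trig_separation tk.
by rewrite (moll_separated tb kE hf); exact: trig_lin.
Qed.

(** After separation only the finitely many factors [a i] depend on [x]; the integrals are constant
    coefficients. *)
Lemma ddir_moll k f v : trig_poly A k -> torus_integrable f ->
  ddir v (moll k f) = moll (ddir v k) f.
Proof.
move=> tk hf; have [I [a [b [ta tb kE]]]] := trig_separation tk.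
rewrite (moll_separated tb kE hf) (moll_ddir_separated ta tb kE v hf).
exact: ddir_lin.
Qed.

Lemma partial_moll k f s : trig_poly A k -> torus_integrable f ->
  partial s (moll k f) = moll (partial s k) f.
Proof.
move=> tk hf; elim: s => //= i s ih.
change (ddir (delta_mx 0 i) (partial s (moll k f)) =
  moll (ddir (delta_mx 0 i) (partial s k)) f).
by rewrite ih ddir_moll//; exact: trig_partial.
Qed.

(** Each derivative of the reflected kernel yields a factor -1. The resulting sign is the one in the
    definition of a weak derivative, so the two cancel when this function is used as a test
    function. *)
Lemma partial_reflect k x s : trig_poly A k ->
  partial s (fun w => k (x - w)) = (fun w => (-1) ^+ size s * partial s k (x - w)).
Proof.
move=> tk; elim: s => [|i s ih] /=; first by apply/funext => w; rewrite mul1r.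
change (ddir (delta_mx 0 i) (partial s (fun w => k (x - w))) =
  (fun w => (-1) ^+ (size s).+1 * ddir (delta_mx 0 i) (partial s k) (x - w))).
have ts := trig_partial hA s tk; have dt := trig_differentiable hA ts.
have dr w : differentiable (fun w => partial s k (x - w)) w.
  by apply: (differentiable_comp (f := fun w => x - w)) => //; exact: differentiableB.
rewrite ih (_ : (fun w => _) = cst ((-1) ^+ size s) \* (fun w => partial s k (x - w)))//.
rewrite (derive_cstM_fun _ _ dr) ddir_reflect//.
by apply/funext => w /=; rewrite exprS mulrN mulN1r mulNr.
Qed.

Lemma trig_reflect k x : trig_poly A k -> trig_poly A (fun w => k (x - w)).
Proof.
move=> tk; have [I [a [b [ta tb kE]]]] := trig_separation tk.
rewrite (_ : (fun w => _) = (fun w => \sum_i a i x * b i w)); first exact: trig_lin.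
by apply/funext => w.
Qed.

Lemma det_gt0 : 0 < `|\det A|.
Proof. by rewrite normr_gt0 -unitfE -unitmxE. Qed.

Lemma Rintegral_torus_measure (F : d.-tuple R -> R) :
  mu.-integrable setT (EFin \o F) ->
  \int[torus_measure A]_y F y = `|\det A| * \int[mu]_y F y.
Proof.
move=> iF; have mF := measurable_int mu iF.
have [ip ineg] : ((\int[mu]_y (EFin \o F)^\+ y)%E \is a fin_num /\
    (\int[mu]_y (EFin \o F)^\- y)%E \is a fin_num).
  by split; apply: integrable_fin_num => //; [exact: integrable_funepos|exact: integrable_funeneg].
rewrite /Rintegral [in LHS]integralE [in RHS]integralE /torus_measure.
rewrite !ge0_integral_mscale//=; [|exact: measurable_funeneg|exact: measurable_funepos].
have ad : (\int[mu]_y (EFin \o F)^\+ y +? - \int[mu]_y (EFin \o F)^\- y)%E.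
  by rewrite fin_num_adde_defl// fin_numN.
by rewrite -(muleBr _ ad)// fineM// fin_numB ip ineg.
Qed.

End mollification.

(** * Weak derivatives under convolution *)

Section torus_Lp_facts.
Context {R : realType} {d : nat}.
Variable A : 'M[R]_d.
Hypothesis hA : A \in unitmx.
Local Notation V := 'rV[R]_d.
Local Notation mu := (cube R d).
Implicit Types (f g k : V -> R) (v x w : V).

Lemma ge0_integral_torus_measure (F : d.-tuple R -> \bar R) :
  measurable_fun setT F -> (forall y, 0 <= F y)%E ->
  (\int[torus_measure A]_y F y = `|\det A|%:E * \int[mu]_y F y)%E.
Proof. by move=> mF F0; rewrite /torus_measure ge0_integral_mscale. Qed.

Lemma integrable_torus_measure (F : d.-tuple R -> R) :
  (torus_measure A).-integrable setT (EFin \o F) <-> mu.-integrable setT (EFin \o F).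
Proof.
have d0 := det_gt0 hA.
split=> /integrableP[mF iF]; apply/integrableP; split=> //.
  move: iF; rewrite ge0_integral_torus_measure//; last exact: measurableT_comp.
  apply: contraTT; rewrite -!leNgt !leye_eq => /eqP ->.
  by rewrite gt0_muley// lte_fin.
rewrite ge0_integral_torus_measure//; last exact: measurableT_comp.
by apply: lte_mul_pinfty => //; rewrite lee_fin.
Qed.

Lemma torus_Lp1 f : torus_Lp A 1%:E f <-> Defs.periodic A f /\ torus_integrable A f.
Proof.
split=> -[pf hf]; split=> //.
  by apply/integrable_torus_measure; exact/Lfun1_integrable.
by apply/Lfun1_integrable; exact/integrable_torus_measure.
Qed.

Lemma torus_Lp2_sqr f : torus_Lp A 2%:E f ->
  mu.-integrable setT (EFin \o (fun y => f (torus_pt A y) ^+ 2)).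
Proof. by move=> [_ /Lfun2_integrable_sqr hf]; exact/integrable_torus_measure. Qed.

Lemma weak_partial_moll s f g k : weak_partial A s f g -> trig_poly A k ->
  partial s (moll A k f) = moll A k g.
Proof.
move=> [/torus_Lp1[pf hf] /torus_Lp1[pg hg] fg] tk.
rewrite (partial_moll hA s tk hf); apply/funext => x.
have tr := trig_reflect x tk; have tp := trig_partial hA s tr.
have := fg _ (trig_smooth hA tr) (C1_per (trig_C1 hA tr)).
rewrite (Rintegral_torus_measure A (torus_integrableM hA hf (trig_C0 hA tp))).
rewrite (Rintegral_torus_measure A (torus_integrableM hA hg (trig_C0 hA tr))).
(* Both sides carry the volume factor of [torus_measure], which is nonzero because [A] is
   invertible. *)
rewrite mulrCA => /(mulfI (lt0r_neq0 (det_gt0 hA))).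
under eq_Rintegral do rewrite (partial_reflect hA x s tk) /= mulrCA.
rewrite RintegralZl//; last first.
  exact: (torus_integrableM hA hf (trig_C0 hA (trig_reflect x (trig_partial hA s tk)))).
by move=> /(can_inj (signrMK _)).
Qed.

End torus_Lp_facts.

(** * Convolution with the cosine kernels: convergence and contraction *)

Section torus_bump_kernel.
Context {R : realType} {d : nat}.
Variable A : 'M[R]_d.
Hypothesis hA : A \in unitmx.
Local Notation V := 'rV[R]_d.
Local Notation mu := (cube R d).
Implicit Types (f g : V -> R) (v x w : V).

Definition torus_bump (n : nat) x : R := \prod_(i < d) cos_kernel n (lattice_coord A x i).

Lemma trig_prod (I : Type) (r : seq I) (F : I -> V -> R) :
  (forall i, trig_poly A (F i)) -> trig_poly A (fun x => \prod_(i <- r) F i x).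
Proof.
move=> tF; elim: r => [|i r ih].
  by rewrite (_ : (fun x => _) = cst 1); [exact: trig_cst|apply/funext => x; rewrite big_nil].
rewrite (_ : (fun x => _) = F i \* (fun x => \prod_(i <- r) F i x)).
  exact: trig_mul.
by apply/funext => x; rewrite big_cons.
Qed.

Lemma trig_bump n : trig_poly A (torus_bump n).
Proof.
apply: trig_prod => i; rewrite /cos_kernel.
(* The power is written as a product over [n] copies of [tt], which [trig_prod] covers. *)
rewrite (_ : (fun x => _) = cst (cos_mass n)^-1 \*
   (fun x => \prod_(j <- nseq n tt) (cst 1 \+ (fun x => cos (lattice_angle A x i))) x)).
  apply: trig_mul; first exact: trig_cst.
  by apply: trig_prod => _; apply: trig_add; [exact: trig_cst|exact: trig_cos].
by apply/funext => x /=; rewrite big_nseq iter_mulr_1.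
Qed.

Lemma lattice_coord_torus_pt (y : d.-tuple R) i : lattice_coord A (torus_pt A y) i = tnth y i.
Proof. by rewrite /lattice_coord /torus_pt -mulmxA mulmxV// mulmx1 mxE. Qed.

(** Lattice coordinates are linear and invert [torus_pt]. Hence convolution on the torus, read on
    the cube, is integration against [cube_kernel], to which the approximate identity applies. *)
Lemma bump_torus_pt n (y z : d.-tuple R) :
  torus_bump n (torus_pt A y - torus_pt A z) = cube_kernel n (y, z).
Proof.
apply: eq_bigr => i _.
by rewrite lattice_coordD lattice_coordN !lattice_coord_torus_pt.
Qed.

Lemma bump_ge0 n x : 0 <= torus_bump n x.
Proof. by apply: prodr_ge0 => i _; exact: cos_kernel_ge0. Qed.

Lemma moll_bump_ge0 n f x : {ae mu, forall y, 0 <= f (torus_pt A y)} ->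
  torus_integrable A f -> 0 <= moll A (torus_bump n) f x.
Proof.
move=> f0 hf; have mf := torus_integrable_measurable hf.
have mb : measurable_fun setT (fun z => torus_bump n (x - torus_pt A z)).
  exact: (C0_periodic_measurable (trig_C0 hA (trig_reflect x (trig_bump n)))).
rewrite /moll /Rintegral fine_ge0//.
have -> : (\int[mu]_z (f (torus_pt A z) * torus_bump n (x - torus_pt A z))%:E =
    \int[mu]_z (`|f (torus_pt A z)| * torus_bump n (x - torus_pt A z))%:E)%E.
  apply: ae_eq_integral => //.
  - by apply/measurable_EFinP; exact: measurable_funM.
  - by apply/measurable_EFinP; apply: measurable_funM => //; exact: measurableT_comp.
  - by apply: filterS f0 => z fz _ /=; rewrite ger0_norm.
by apply: integral_ge0 => z _; rewrite lee_fin mulr_ge0// bump_ge0.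
Qed.

Lemma integrable_bump n f (y : d.-tuple R) : torus_integrable A f ->
  mu.-integrable setT (EFin \o (fun z => f (torus_pt A z) * cube_kernel n (y, z))).
Proof.
move=> hf; have := torus_integrableM hA hf (trig_C0 hA (trig_reflect (torus_pt A y) (trig_bump n))).
apply: eq_integrable => // z _ /=; congr EFin; congr (_ * _).
by rewrite bump_torus_pt.
Qed.

Lemma moll_bumpE n f (y : d.-tuple R) :
  moll A (torus_bump n) f (torus_pt A y) = \int[mu]_z (f (torus_pt A z) * cube_kernel n (y, z)).
Proof. by apply: eq_Rintegral => z _; rewrite bump_torus_pt. Qed.

Lemma torus_integrable_cst (c : R) : torus_integrable A (cst c).
Proof. exact: (C0_periodic_integrable hA (C0_periodic_cst A c)). Qed.

Lemma ds_cube n : doubly_stochastic mu (@cube_kernel R d n).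
Proof. by have [+ _] := @approximate_identity_cube R d. Qed.

Lemma Rintegral_cube_kernel n (y : d.-tuple R) : \int[mu]_z cube_kernel n (y, z) = 1.
Proof. by rewrite /Rintegral; case: (ds_cube n) => _ _ -> _. Qed.

Lemma integrable_cube_kernel n (y : d.-tuple R) :
  mu.-integrable setT (EFin \o (fun z => cube_kernel n (y, z))).
Proof.
have := integrable_bump n y (torus_integrable_cst 1).
by apply: eq_integrable => // z _ /=; rewrite mul1r.
Qed.

Lemma measurable_moll n f : torus_integrable A f ->
  measurable_fun setT (moll A (torus_bump n) f \o torus_pt A).
Proof.
by move=> hf; exact: (C0_periodic_measurable (trig_C0 hA (moll_trig hA (trig_bump n) hf))).
Qed.

(** As the kernel has total mass 1 in [z], the difference is the average of [f(z) - f(y)]; the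
    absolute value then moves under the integral. *)
Lemma integral_moll_dist n f : torus_integrable A f ->
  (\int[mu]_y `|moll A (torus_bump n) f (torus_pt A y) - f (torus_pt A y)|%:E <=
   oscillation mu (@cube_kernel R d n) (f \o torus_pt A))%E.
Proof.
move=> hf; have mf := torus_integrable_measurable hf.
have [mk k0 _ _] := ds_cube n.
have mo := measurable_oscillation mk mf.
rewrite /oscillation fubini_tonelli1//; last by move=> p; rewrite lee_fin mulr_ge0.
apply: ge0_le_integral => //.
- apply/measurable_EFinP; apply: measurableT_comp => //.
  by apply: measurable_funB => //; exact: measurable_moll.
- by apply: measurable_fun_fubini_tonelli_F => // p; rewrite lee_fin mulr_ge0.
move=> y _; rewrite /fubini_F/=.
have ic := integrableZl measurableT (f (torus_pt A y)) (integrable_cube_kernel n y).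
have iF := integrable_bump n y hf.
have -> : moll A (torus_bump n) f (torus_pt A y) - f (torus_pt A y) =
    \int[mu]_z (f (torus_pt A z) * cube_kernel n (y, z) -
                f (torus_pt A y) * cube_kernel n (y, z)).
  rewrite RintegralB// moll_bumpE; congr (_ - _).
  by rewrite RintegralZl ?Rintegral_cube_kernel ?mulr1//; exact: integrable_cube_kernel.
have iB := integrableB measurableT iF ic.
apply: (@le_trans _ _ (\int[mu]_z `|f (torus_pt A z) * cube_kernel n (y, z) -
                f (torus_pt A y) * cube_kernel n (y, z)|%:E)%E).
  rewrite EFin_normr_Rintegral//.
  exact: (@le_abse_integral _ _ _ mu setT _ measurableT (measurable_int mu iB)).
rewrite le_eqVlt; apply/orP; left; apply/eqP; apply: eq_integral => z _.
by rewrite -mulrBl normrM mulrC (ger0_norm (k0 _)) distrC.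
Qed.

Lemma cvg_moll f : torus_integrable A f ->
  (\int[mu]_y `|moll A (torus_bump n) f (torus_pt A y) - f (torus_pt A y)|%:E @[n --> \oo] --> 0)%E.
Proof.
move=> hf; have [_ /(_ _ hf) ai] := @approximate_identity_cube R d.
apply: (@squeeze_cvge _ _ _ _ (cst 0%E) _ (fun n =>
  oscillation mu (@cube_kernel R d n) (f \o torus_pt A))) => //; last exact: cvg_cst.
apply: nearW => n; apply/andP; split; last exact: integral_moll_dist.
by apply: integral_ge0 => y _; rewrite lee_fin.
Qed.

(** Jensen's inequality in variance form: with [m] the mollified value, the weighted integral of
    [(f - m)^2] is nonnegative, so [m^2] is at most the weighted integral of [f^2]. The other
    marginal of the kernel then removes the weight. *)
Lemma integral_moll_sqr n f : torus_integrable A f ->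
  (\int[mu]_y (moll A (torus_bump n) f (torus_pt A y) ^+ 2)%:E <=
   \int[mu]_y (f (torus_pt A y) ^+ 2)%:E)%E.
Proof.
move=> hf; have mf := torus_integrable_measurable hf.
have [mk k0 _ _] := ds_cube n.
have mf2 : measurable_fun setT (EFin \o (fun y => f (torus_pt A y) ^+ 2)).
  by apply/measurable_EFinP; exact: (measurable_funX 2 mf).
(* An infinite right side leaves nothing to prove; otherwise [f^2] is integrable, as the real-valued
   variance computation requires. *)
have [foo|] := eqVneq (\int[mu]_y (f (torus_pt A y) ^+ 2)%:E)%E +oo%E.
  by rewrite foo leey.
rewrite -ltey => foo.
have if2 : torus_integrable A (fun x => f x ^+ 2).
  apply/integrableP; split=> //; rewrite (le_lt_trans _ foo)// le_eqVlt.
  apply/orP; left; apply/eqP; apply: eq_integral => y _ /=.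
  by rewrite ger0_norm// sqr_ge0.
rewrite -(stochastic_integral2 (ds_cube n) mf2); last by move=> y; rewrite lee_fin sqr_ge0.
have mK : measurable_fun setT (fun p : d.-tuple R * d.-tuple R =>
    ((cube_kernel n p)%:E * (EFin \o (fun y => f (torus_pt A y) ^+ 2)%R) p.2)%E).
  by apply: emeasurable_funM; [exact/measurable_EFinP|exact: measurableT_comp].
have K0 p : (0 <= (cube_kernel n p)%:E * (EFin \o (fun y => f (torus_pt A y) ^+ 2)%R) p.2)%E.
  by rewrite -EFinM lee_fin mulr_ge0// sqr_ge0.
rewrite (fubini_tonelli1 _ mK K0).
apply: ge0_le_integral => //.
- by move=> y _; rewrite lee_fin sqr_ge0.
- by apply/measurable_EFinP; exact: (measurable_funX 2 (measurable_moll n hf)).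
- exact: measurable_fun_fubini_tonelli_F.
move=> y _; rewrite /fubini_F/=.
have i2 := integrable_bump n y if2; have i1 := integrable_bump n y hf.
have ik := integrable_cube_kernel n y.
pose m := moll A (torus_bump n) f (torus_pt A y).
have mE : m = \int[mu]_z (f (torus_pt A z) * cube_kernel n (y, z)) by exact: moll_bumpE.
have i1m := integrableZl measurableT (2 * m) i1.
have ikm := integrableZl measurableT (m ^+ 2) ik.
have var : 0 <= \int[mu]_z ((f (torus_pt A z) ^+ 2 * cube_kernel n (y, z) -
    2 * m * (f (torus_pt A z) * cube_kernel n (y, z))) + m ^+ 2 * cube_kernel n (y, z)).
  apply: Rintegral_ge0 => z _.
  have := mulr_ge0 (sqr_ge0 (f (torus_pt A z) - m)) (k0 (y, z)); lra.
have : m ^+ 2 <= \int[mu]_z (f (torus_pt A z) ^+ 2 * cube_kernel n (y, z)).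
  move: var; rewrite RintegralD//; last exact: (integrableB measurableT i2 i1m).
  rewrite RintegralB// !RintegralZl// -mE Rintegral_cube_kernel; lra.
rewrite -lee_fin => /le_trans; apply; rewrite /Rintegral fineK; last exact: integrable_fin_num.
rewrite le_eqVlt; apply/orP; left; apply/eqP; apply: eq_integral => z _.
by rewrite -EFinM mulrC.
Qed.

End torus_bump_kernel.

(** * Passage to the limit *)

Section limits_of_integrals.
Context {d : measure_display} {T : measurableType d} {R : realType}.
Variable mu : probability T R.
Local Open Scope ereal_scope.

(** Choosing the [n]-th integral at most [2^-(n+1)] makes the series of functions integrable, hence
    finite almost everywhere, so its terms tend to 0. [phi] is not claimed to be increasing, which
    is why convergence of the integrals along it is part of the conclusion. *)
Lemma ae_subsequence (h : nat -> T -> R) :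
  (forall n, measurable_fun setT (h n)) -> (forall n y, 0 <= h n y)%R ->
  \int[mu]_y (h n y)%:E @[n --> \oo] --> 0 ->
  exists phi : nat -> nat,
    \int[mu]_y (h (phi n) y)%:E @[n --> \oo] --> 0 /\
    {ae mu, forall y, h (phi n) y @[n --> \oo] --> 0%R}.
Proof.
move=> mh h0 ih.
have ph (n : nat) : {m | \int[mu]_y (h m y)%:E <= (1 / (2 ^ (n + 1))%:R)%:E}.
  apply: cid; have e0 : 0 < (1 / (2 ^ (n + 1))%:R)%:E :> \bar R.
    by rewrite lte_fin divr_gt0// ltr0n expn_gt0.
  have [N _ hN] := cvge_lt e0 ih.
  by exists N; rewrite ltW//; apply: hN => /=.
pose phi n := sval (ph n).
have phiP n : \int[mu]_y (h (phi n) y)%:E <= (1 / (2 ^ (n + 1))%:R)%:E by exact: (svalP (ph n)).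
have I0 n : 0 <= \int[mu]_y (h (phi n) y)%:E by apply: integral_ge0 => y _; rewrite lee_fin.
have S1 : \sum_(n <oo) \int[mu]_y (h (phi n) y)%:E <= 1.
  have := @cvg_geometric_eseries_half R 1 0; rewrite expr0 divr1 => /cvg_lim <-//.
  by apply: lee_nneseries => // n _; exact: phiP.
(* The [n]-th term is at most the tail of the series from [n] on. *)
have tail0 (u : nat -> \bar R) : (forall n, 0 <= u n) -> \sum_(n <oo) u n < +oo ->
    u n @[n --> \oo] --> 0.
  move=> u0 su; have tl := nneseries_tail_cvg su (fun k _ => u0 k).
  apply: (@squeeze_cvge _ _ _ _ (cst 0) _ (fun N => \sum_(N <= k <oo) u k)) => //; last exact: cvg_cst.
  apply: nearW => n; rewrite u0 /=.
  rewrite (@nneseries_split _ _ n 1) //= addn1 big_nat1 leeDl//.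
  exact: nneseries_ge0.
exists phi; split; first by apply: tail0 => //; rewrite (le_lt_trans S1)// ltry.
have mS : measurable_fun setT (fun y => \sum_(n <oo) (h (phi n) y)%:E).
  by apply: ge0_emeasurable_sum => // n *; [rewrite lee_fin|exact/measurable_EFinP].
have iS : mu.-integrable setT (fun y => \sum_(n <oo) (h (phi n) y)%:E).
  apply/integrableP; split => //.
  have S0 y : 0 <= \sum_(n <oo) (h (phi n) y)%:E.
    by apply: nneseries_ge0 => n _ _; rewrite lee_fin.
  under eq_integral do rewrite gee0_abs//.
  rewrite integral_nneseries//; first by rewrite (le_lt_trans S1)// ltry.
  - by move=> n; exact/measurable_EFinP.
  - by move=> n y _; rewrite lee_fin.
have := integrable_ae measurableT iS; apply: filterS => y /(_ I) Sy.
have : (h (phi n) y)%:E @[n --> \oo] --> 0.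
  apply: tail0; first by move=> n; rewrite lee_fin.
  by move: Sy; rewrite fin_numElt => /andP[].
by move/fine_cvg.
Qed.

Lemma fatou_ae (f : nat -> T -> R) (g : T -> R) (C : \bar R) :
  (forall n, measurable_fun setT (f n)) -> measurable_fun setT g ->
  (forall n y, 0 <= f n y)%R -> (forall y, 0 <= g y)%R ->
  {ae mu, forall y, f n y @[n --> \oo] --> g y} ->
  (forall n, \int[mu]_y (f n y)%:E <= C) ->
  \int[mu]_y (g y)%:E <= C.
Proof.
move=> mf mg f0 g0 fg fC.
have mEf n : measurable_fun setT (EFin \o f n) by exact/measurable_EFinP.
have -> : \int[mu]_y (g y)%:E = \int[mu]_y limn_einf (fun n => (f n y)%:E).
  apply: ae_eq_integral => //; first exact/measurable_EFinP.
    rewrite /limn_einf; apply: measurableT_comp => //.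
    apply: measurable_fun_limn_esup => n; apply: measurableT_comp => //; exact: mEf.
  apply: filterS fg => y fgy _; apply/esym.
  have fgE : (f n y)%:E @[n --> \oo] --> (g y)%:E.
    by apply: cvg_EFin => //; exact: nearW.
  by have [-> _] := cvg_limn_einf_sup fgE.
apply: (le_trans (fatou _ _ _ _)) => //.
  by move=> n y _; rewrite lee_fin.
rewrite limn_einf_lim.
apply: lime_le; first exact: is_cvg_einfs.
by apply: nearW => n; apply: le_trans (fC n); apply: ereal_inf_lbound; exists n => /=.
Qed.

Lemma cvg_RintegralM (f : nat -> T -> R) (g phi : T -> R) (M : R) :
  (forall n, mu.-integrable setT (EFin \o f n)) -> mu.-integrable setT (EFin \o g) ->
  measurable_fun setT phi -> (forall y, `|phi y| <= M)%R ->
  \int[mu]_y `|f n y - g y|%:E @[n --> \oo] --> 0 ->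
  (\int[mu]_y (f n y * phi y))%R @[n --> \oo] --> (\int[mu]_y (g y * phi y))%R.
Proof.
move=> intf intg mphi phiM fg.
have M0 : (0 <= M)%R by apply: le_trans (phiM point).
have bphi : [bounded phi y | y in [set: T]].
  exists M; split; first exact: num_real.
  by move=> x Mx y _ /=; rewrite (le_trans (phiM y))// ltW.
have ip (h : T -> R) : mu.-integrable setT (EFin \o h) ->
    mu.-integrable setT (EFin \o (fun y => h y * phi y)%R).
  by move=> ih; exact: (integrableMl measurableT ih mphi bphi).
have mB n : measurable_fun setT (EFin \o (fun y => `|f n y - g y|%R)).
  apply/measurable_EFinP; apply: measurableT_comp => //.
  by apply: measurable_funB; apply/measurable_EFinP;
    [exact: (measurable_int mu (intf n))|exact: (measurable_int mu intg)].
have intB n : mu.-integrable setT (EFin \o (fun y => f n y - g y)%R).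
  exact: (integrableB measurableT (intf n) intg).
have fin n : \int[mu]_y `|f n y - g y|%:E \is a fin_num.
  by apply: integrable_fin_num => //; exact: (integrable_abse (intB n)).
apply/cvgrPdist_le => e e0.
(* [M + 1] instead of [M], since [M] may be 0. *)
have e1 : 0 < (e / (M + 1))%:E by rewrite lte_fin divr_gt0// ltr_wpDl.
have := cvge_lt e1 fg; apply: filterS => n hn.
rewrite distrC -RintegralB//; [|exact: (ip _ (intf n))|exact: (ip _ intg)].
rewrite -lee_fin EFin_normr_Rintegral//; last first.
  exact: (integrableB measurableT (ip _ (intf n)) (ip _ intg)).
apply: (le_trans (le_abse_integral _ _ _)) => //.
  exact: (measurable_int mu (integrableB measurableT (ip _ (intf n)) (ip _ intg))).
apply: (@le_trans _ _ (\int[mu]_y (M%:E * `|f n y - g y|%:E))).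
  apply: ge0_le_integral => //.
  - apply: measurableT_comp => //.
    exact: (measurable_int mu (integrableB measurableT (ip _ (intf n)) (ip _ intg))).
  - by apply: emeasurable_funM => //; exact: mB.
  - move=> y _ /=; rewrite -EFinM lee_fin -mulrBl normrM mulrC ler_wpM2r//.
rewrite ge0_integralZl//; last exact: mB.
apply: (@le_trans _ _ (M%:E * (e / (M + 1))%:E)).
  by apply: lee_wpmul2l; rewrite ?lee_fin// ltW.
rewrite -EFinM lee_fin mulrCA -{2}(mulr1 e) ler_wpM2l ?(ltW e0)//.
by rewrite ler_pdivrMr ?mul1r; lra.
Qed.

Lemma dominated_cvg_real (f : nat -> T -> R) (g D : T -> R) :
  (forall n, measurable_fun setT (f n)) -> measurable_fun setT g ->
  {ae mu, forall y, f n y @[n --> \oo] --> g y} ->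
  mu.-integrable setT (EFin \o D) ->
  {ae mu, forall y n, (`|f n y| <= D y)%R} ->
  \int[mu]_y `|f n y - g y|%:E @[n --> \oo] --> 0.
Proof.
move=> mf mg fg iD fD.
have [|||||_ + _] := @dominated_convergence _ T R mu setT measurableT
    (fun n => EFin \o f n) (EFin \o g) (EFin \o D) => //.
- by move=> n; exact/measurable_EFinP.
- exact/measurable_EFinP.
- by apply: filterS fg => y fgy _; apply: cvg_EFin => //; exact: nearW.
- by apply: filterS fD => y fDy n _ /=; rewrite lee_fin.
Qed.

End limits_of_integrals.

Section real_limits.
Context {R : realType}.

(** The inverse is discontinuous at 0, where its value is 0 by convention. The continuous functions
    [x / (x^2 + 1/(n+1))] converge to it everywhere, including that point. *)
Lemma measurable_invr : measurable_fun setT (fun x : R => x^-1).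
Proof.
apply: (measurable_fun_cvg (h := fun (n : nat) (x : R) => x / (x ^+ 2 + n.+1%:R^-1) : R)).
  move=> n; apply: continuous_measurable_fun => x; apply: cvgM; first exact: cvg_id.
  apply: cvgV; first by rewrite gt_eqF// ltr_wpDl ?sqr_ge0// invr_gt0.
  by apply: cvgD; [exact: exprn_continuous|exact: cvg_cst].
move=> x _; have [->|x0] := eqVneq x 0.
  by rewrite invr0; under eq_cvg do rewrite mul0r; exact: cvg_cst.
rewrite (_ : x^-1 = x / (x ^+ 2 + 0)); last by rewrite addr0 expr2 invfM mulrA divff// mul1r.
apply: cvgM; first exact: cvg_cst.
apply: cvgV; first by rewrite addr0 expf_neq0.
by apply: cvgD; [exact: cvg_cst|exact: cvg_harmonic].
Qed.

Lemma cvg_sumr (I : finType) (f : I -> nat -> R) (l : I -> R) :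
  (forall i, f i n @[n --> \oo] --> l i) ->
  \sum_i f i n @[n --> \oo] --> \sum_i l i.
Proof.
move=> fl; suff h (r : seq I) : \sum_(i <- r) f i n @[n --> \oo] --> \sum_(i <- r) l i by exact: h.
elim: r => [|i r ih].
  by rewrite big_nil; under eq_cvg do rewrite big_nil; exact: cvg_cst.
by rewrite big_cons; under eq_cvg do rewrite big_cons; exact: cvgD.
Qed.

Lemma cvg_sqr (u : nat -> R) (l : R) : u n @[n --> \oo] --> l ->
  u n ^+ 2 @[n --> \oo] --> l ^+ 2.
Proof. by move=> ul; exact: (cvgM ul ul). Qed.

End real_limits.

(** * The L^2 bound on |grad theta|^2 / theta *)

Section fisher_limit.
Context {R : realType} {d : nat}.
Variable A : 'M[R]_d.
Hypothesis hA : A \in unitmx.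
Local Notation V := 'rV[R]_d.
Local Notation mu := (cube R d).
Local Notation pt := (torus_pt A).
Local Notation mollb n := (moll A (torus_bump A n)).

(** The sum of the L^1 errors over the finite index set is a single sequence tending to 0, and it
    dominates each error; a subsequence good for the sum is good for all members. *)
Lemma moll_subsequence (I : finType) (w : I -> V -> R) :
  (forall i, torus_integrable A (w i)) ->
  exists phi : nat -> nat,
    (forall i, (\int[mu]_y `|mollb (phi n) (w i) (pt y) - w i (pt y)|%:E @[n --> \oo] --> 0)%E) /\
    {ae mu, forall y i, mollb (phi n) (w i) (pt y) @[n --> \oo] --> w i (pt y)}.
Proof.
move=> iw.
have mm n i : measurable_fun setT (fun y => `|mollb n (w i) (pt y) - w i (pt y)|).
  apply: measurableT_comp => //; apply: measurable_funB; first exact: measurable_moll.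
  exact: torus_integrable_measurable.
pose h n y := \sum_i `|mollb n (w i) (pt y) - w i (pt y)|.
have mh n : measurable_fun setT (h n) by apply: measurable_sum => i; exact: mm.
have h0 n y : 0 <= h n y by apply: sumr_ge0.
have hi n y i : `|mollb n (w i) (pt y) - w i (pt y)| <= h n y.
  by rewrite /h (bigD1 i)//= lerDl sumr_ge0.
have ih : (\int[mu]_y (h n y)%:E @[n --> \oo] --> 0)%E.
  rewrite (_ : (fun n => _) =
     (fun n => \sum_i \int[mu]_y `|mollb n (w i) (pt y) - w i (pt y)|%:E)%E); last first.
    apply/funext => n; under eq_integral do rewrite /h -sumEFin.
    rewrite ge0_integral_sum//; first by move=> i; apply/measurable_EFinP; exact: mm.
  have z : (\sum_(i : I) 0 = 0 :> \bar R)%E by rewrite big1.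
  rewrite -[X in _ --> X]z.
  apply: cvg_nnesum => i _; last exact: cvg_moll.
  by apply: nearW => n; apply: integral_ge0 => y _; rewrite lee_fin.
have [phi [c1 c2]] := ae_subsequence mh h0 ih.
exists phi; split=> [i|].
  apply: (@squeeze_cvge _ _ _ _ (cst 0%E) _ (fun n => (\int[mu]_y (h (phi n) y)%:E)%E)) => //;
    last exact: cvg_cst.
  apply: nearW => n; apply/andP; split; first by apply: integral_ge0 => y _; rewrite lee_fin.
  apply: ge0_le_integral => //.
  - by apply/measurable_EFinP; exact: mm.
  - by apply/measurable_EFinP; exact: mh.
  - by move=> y _; rewrite lee_fin; exact: hi.
apply: filterS c2 => y hy i.
apply/cvgrPdist_le => e e0; move/cvgrPdist_le: hy => /(_ _ e0).
apply: filterS => n; rewrite sub0r normrN ger0_norm// => hn.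
by rewrite distrC (le_trans (hi _ _ _)).
Qed.

Variables (th : V -> R) (v : 'I_d -> V -> R).
Hypothesis th0 : forall x, 0 <= th x.
Hypothesis thpos : {ae mu, forall y, 0 < th (pt y)}.
Hypothesis wv : forall i, weak_partial A [:: i] th (v i).
Hypothesis ith : torus_integrable A th.

Let iv i : torus_integrable A (v i).
Proof. by have [_ /(torus_Lp1 hA)[]] := wv i. Qed.

Let mv i : measurable_fun setT (fun y => v i (pt y)).
Proof. exact: torus_integrable_measurable. Qed.

Let mth : measurable_fun setT (fun y => th (pt y)).
Proof. exact: torus_integrable_measurable. Qed.

(** The density [|grad theta|^2 / theta] of the Fisher information, with 0 where [theta] vanishes.
    It is its square that has to be integrated. *)
Definition fisher (y : d.-tuple R) : R := (\sum_i v i (pt y) ^+ 2) / th (pt y).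

Lemma moll_ge0 n x : 0 <= mollb n th x.
Proof. by apply: moll_bump_ge0 => //; apply: aeW => y; exact: th0. Qed.

Lemma trig_moll n : trig_poly A (mollb n th).
Proof. by apply: moll_trig => //; exact: trig_bump. Qed.

Lemma ddir_cstD (c : R) n u : ddir u (cst c \+ mollb n th) = ddir u (mollb n th).
Proof.
have dm := trig_differentiable hA (trig_moll n).
rewrite (deriveD_fun u (fun x => differentiable_cst c x) dm).
by apply/funext => x /=; rewrite derive_cst_fun add0r.
Qed.

Lemma ddir_moll_th n i : ddir (delta_mx 0 i) (mollb n th) = mollb n (v i).
Proof. exact: (weak_partial_moll hA (wv i) (trig_bump A n)). Qed.

Lemma moll_sum n (H : 'I_d -> V -> R) x : (forall i, torus_integrable A (H i)) ->
  mollb n (fun x => \sum_i H i x) x = \sum_i mollb n (H i) x.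
Proof.
move=> iH; have tr := trig_C0 hA (trig_reflect x (trig_bump A n)).
have iM i := torus_integrableM hA (iH i) tr.
suff h (r : seq 'I_d) : mu.-integrable setT
      (EFin \o (fun z => (\sum_(i <- r) H i (pt z)) * torus_bump A n (x - pt z))) /\
    \int[mu]_z ((\sum_(i <- r) H i (pt z)) * torus_bump A n (x - pt z)) =
    \sum_(i <- r) mollb n (H i) x by have [_] := h (index_enum 'I_d).
elim: r => [|i r [ih1 ih2]].
  split.
    rewrite (_ : _ \o _ = cst 0%E); first exact: integrable0.
    by apply/funext => z; rewrite /= big_nil mul0r.
  under eq_Rintegral do rewrite big_nil mul0r.
  by rewrite big_nil /Rintegral integral0.
have E : (fun z => (\sum_(j <- i :: r) H j (pt z)) * torus_bump A n (x - pt z)) =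
  (fun z => H i (pt z) * torus_bump A n (x - pt z) +
    (\sum_(j <- r) H j (pt z)) * torus_bump A n (x - pt z)).
  by apply/funext => z; rewrite big_cons mulrDl.
rewrite E; split; first exact: (integrableD measurableT (iM i) ih1).
by rewrite (RintegralD measurableT (iM i) ih1) ih2 big_cons.
Qed.

Lemma fisher_bound L : weak_laplacian A th L ->
  (\int[mu]_y (fisher y ^+ 2)%:E <= 9%:E * \int[mu]_y (L (pt y) ^+ 2)%:E)%E.
Proof.
move=> [H [wH LE]].
have iH i : torus_integrable A (H i) by have [_ /(torus_Lp1 hA)[]] := wH i.
have LE' : L = (fun x => \sum_i H i x) by exact/funext.
have iL : torus_integrable A L.
  rewrite /torus_integrable LE'.
  have := @integrable_sum _ _ _ mu setT measurableT _ (index_enum 'I_d) xpredT _ (fun i _ => iH i).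
  by apply: eq_integrable => // y _ /=; rewrite sumEFin.
have lapE n x : laplacian (mollb n th) x = mollb n L x.
  rewrite LE' moll_sum//; apply: eq_bigr => i _.
  have := weak_partial_moll hA (wH i) (trig_bump A n).
  by move=> /(congr1 (fun f => f x)).
(* The index [None] stands for [th] and [Some i] for its [i]-th derivative, so that one subsequence
   serves them all. *)
have [phi [_ ae_phi]] := @moll_subsequence (option 'I_d)
  (fun o => if o is Some i then v i else th) (fun o => match o with Some i => iv i | None => ith end).
(* The mollification is known to be nonnegative only; the constant supplies the positive lower bound
   that [smooth_fisher] asks for, and tends to 0. *)
pose u n : V -> R := cst n.+1%:R^-1 \+ mollb (phi n) th.
have ue n x : n.+1%:R^-1 <= u n x by rewrite /u /= lerDl moll_ge0.
have tu n : trig_poly A (u n) by apply: trig_add; [exact: trig_cst|exact: trig_moll].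
have ge n x : grad_sqr (u n) x = \sum_i mollb (phi n) (v i) x ^+ 2.
  by apply: eq_bigr => i _; rewrite /u ddir_cstD ddir_moll_th.
have lu n x : laplacian (u n) x = mollb (phi n) L x.
  by rewrite -lapE /laplacian /u; apply: eq_bigr => i _; rewrite ddir_cstD.
have n0 n : 0 < n.+1%:R^-1 :> R by rewrite invr_gt0.
have Cw n := (C1_periodic_inv (n0 n) (ue n) (trig_C1 hA (tu n))).1.
have Cg n : C0_periodic A (fun x => (grad_sqr (u n) x / u n x) ^+ 2).
  apply: C0_periodicX; apply: C0_periodicM; last exact: C1_C0.
  rewrite /grad_sqr; apply: C0_periodic_sum => i; apply: C0_periodicX.
  by apply: C1_C0_ddir; exact: trig_C1.
apply: (@fatou_ae _ _ _ mu (fun n y => (grad_sqr (u n) (pt y) / u n (pt y)) ^+ 2)).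
- by move=> n; exact: (C0_periodic_measurable (Cg n)).
- apply: (measurable_funX 2); apply: measurable_funM.
    by apply: measurable_sum => i; apply: (measurable_funX 2); exact: mv.
  by apply: (measurableT_comp measurable_invr); exact: mth.
- by move=> n y; exact: sqr_ge0.
- by move=> y; exact: sqr_ge0.
- apply: filterS2 ae_phi thpos => y hy ty.
  have c1 : grad_sqr (u n) (pt y) @[n --> \oo] --> \sum_i v i (pt y) ^+ 2.
    under eq_cvg do rewrite ge.
    by apply: cvg_sumr => i; apply: cvg_sqr; exact: (hy (Some i)).
  have c2 : u n (pt y) @[n --> \oo] --> th (pt y).
    by rewrite -[X in _ --> X]add0r; apply: cvgD; [exact: cvg_harmonic|exact: (hy None)].
  apply: cvg_sqr; apply: cvgM => //.
  by apply: cvgV => //; rewrite gt_eqF.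
- move=> n; rewrite -(avgE hA (Cg n)).
  have := smooth_fisher hA (n0 n) (ue n) (tu n); rewrite -lee_fin => /le_trans; apply.
  rewrite EFinM; apply: lee_wpmul2l; first by rewrite lee_fin.
  have CL : C0_periodic A (fun x => laplacian (u n) x ^+ 2).
    apply: C0_periodicX; rewrite (_ : laplacian _ = mollb (phi n) L); last exact/funext.
    by apply: trig_C0 => //; apply: moll_trig => //; exact: trig_bump.
  rewrite (avgE hA CL); under eq_integral do rewrite lu.
  exact: integral_moll_sqr.
Qed.

End fisher_limit.

Lemma measurable_sqrtr {R : realType} : measurable_fun setT (fun x : R => Num.sqrt x).
Proof. by apply: continuous_measurable_fun; exact: sqrt_continuous. Qed.

(** * The chain rule for sqrt (e + theta) *)

Section weak_gradient_sqrt.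
Context {R : realType} {d : nat}.
Variable A : 'M[R]_d.
Hypothesis hA : A \in unitmx.
Local Notation V := 'rV[R]_d.
Local Notation mu := (cube R d).
Local Notation pt := (torus_pt A).
Local Notation mollb n := (moll A (torus_bump A n)).
Variables (th : V -> R) (v : 'I_d -> V -> R).
Hypothesis th0 : forall x, 0 <= th x.
Hypothesis wv : forall i, weak_partial A [:: i] th (v i).
Hypothesis ith : torus_integrable A th.

Let iv i : torus_integrable A (v i).
Proof. by have [_ /(torus_Lp1 hA)[]] := wv i. Qed.

Let mv i : measurable_fun setT (fun y => v i (pt y)).
Proof. exact: torus_integrable_measurable. Qed.

Let mth : measurable_fun setT (fun y => th (pt y)).
Proof. exact: torus_integrable_measurable. Qed.

Lemma sqrt_dist (a b e : R) : 0 < e -> e <= a -> e <= b ->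
  `|Num.sqrt a - Num.sqrt b| <= (Num.sqrt e)^-1 * `|a - b|.
Proof.
move=> e0 ea eb; have se : 0 < Num.sqrt e by rewrite sqrtr_gt0.
rewrite mulrC ler_pdivlMr//.
have -> : a - b = (Num.sqrt a - Num.sqrt b) * (Num.sqrt a + Num.sqrt b).
  by rewrite -subr_sqr !sqr_sqrtr//; lra.
rewrite normrM ler_wpM2l// (le_trans _ (ler_norm _))//.
by rewrite (le_trans (ler_wsqrtr ea))// lerDl sqrtr_ge0.
Qed.

Lemma inv_sqrt_le (a e : R) : 0 < e -> e <= a ->
  0 <= (2 * Num.sqrt a)^-1 <= (Num.sqrt e)^-1.
Proof.
move=> e0 ea; have se : 0 < Num.sqrt e by rewrite sqrtr_gt0.
have sa : Num.sqrt e <= Num.sqrt a by exact: ler_wsqrtr.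
rewrite invr_ge0 mulr_ge0 ?sqrtr_ge0//= lef_pV2 ?posrE//; last first.
  by rewrite mulr_gt0// (lt_le_trans se).
by apply: (le_trans sa); lra.
Qed.

Lemma measurable_sqrt_shift (e : R) : measurable_fun setT (fun y => Num.sqrt (e + th (pt y))).
Proof.
apply: (measurableT_comp measurable_sqrtr); exact: measurable_funD.
Qed.

Lemma integrable_sqrt_shift (e : R) : 0 <= e ->
  mu.-integrable setT (EFin \o (fun y => Num.sqrt (e + th (pt y)))).
Proof.
move=> e0.
have iD : mu.-integrable setT (EFin \o (fun y => (1 + e) + th (pt y))).
  exact: (integrableD measurableT (torus_integrable_cst hA (1 + e)) ith).
apply: (le_integrable measurableT _ _ iD).
  by apply/measurable_EFinP; exact: measurable_sqrt_shift.
move=> y _ /=; rewrite lee_fin (ger0_norm (sqrtr_ge0 _)) (le_trans _ (ler_norm _))//.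
have t0 := th0 (pt y); have s0 := sqrtr_ge0 (e + th (pt y)).
have := sqr_sqrtr (addr_ge0 e0 t0); move: (Num.sqrt _) s0 => s s0 sE; nra.
Qed.

Lemma measurable_grad_shift (e : R) i :
  measurable_fun setT (fun y => (2 * Num.sqrt (e + th (pt y)))^-1 * v i (pt y)).
Proof.
apply: measurable_funM => //; apply: (measurableT_comp measurable_invr).
by apply: measurable_funM => //; exact: measurable_sqrt_shift.
Qed.

Lemma integrable_grad_shift (e : R) i : 0 < e ->
  mu.-integrable setT (EFin \o (fun y => (2 * Num.sqrt (e + th (pt y)))^-1 * v i (pt y))).
Proof.
move=> e0; have iZ := integrableZl measurableT (Num.sqrt e)^-1 (iv i).
apply: (le_integrable measurableT _ _ iZ).
  by apply/measurable_EFinP; exact: measurable_grad_shift.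
move=> y _ /=; rewrite lee_fin !normrM ler_wpM2r//.
have ee : e <= e + th (pt y) by rewrite lerDl.
have /andP[p0 p1] := inv_sqrt_le e0 ee.
by rewrite ger0_norm// (le_trans p1)// ler_norm.
Qed.

(** The identity holds for the mollified functions by classical integration by parts. For fixed
    [e > 0] the root is Lipschitz and its derivative bounded on [[e, +oo[], so both sides
    converge. *)
Lemma weak_sqrt_shift (e : R) i (f : V -> R) : 0 < e -> C1_periodic A f ->
  \int[mu]_y (Num.sqrt (e + th (pt y)) * ddir (delta_mx 0 i) f (pt y)) =
  - \int[mu]_y ((2 * Num.sqrt (e + th (pt y)))^-1 * v i (pt y) * f (pt y)).
Proof.
move=> e0 Cf; have se : 0 < (Num.sqrt e)^-1 by rewrite invr_gt0 sqrtr_gt0.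
have [phi [cphi ae_phi]] := @moll_subsequence _ _ A hA (option 'I_d)
  (fun o => if o is Some i then v i else th) (fun o => match o with Some i => iv i | None => ith end).
pose u n : V -> R := cst e \+ mollb (phi n) th.
have m0 n x : 0 <= mollb n th x by exact: moll_ge0.
have ue n x : e <= u n x by rewrite /u /= lerDl.
have te y : e <= e + th (pt y) by rewrite lerDl.
have tu n : trig_poly A (u n) by apply: trig_add; [exact: trig_cst|exact: trig_moll].
have CE n := C1_periodic_sqrt e0 (ue n) (trig_C1 hA (tu n)).
have duE n : ddir (delta_mx 0 i) (u n) = mollb (phi n) (v i).
  by rewrite /u (ddir_cstD hA ith) (ddir_moll_th hA wv).
have C0D := C1_C0_ddir (delta_mx 0 i) Cf; have C0f := C1_C0 Cf.
have [M1 _ hM1] := C0_periodic_bounded hA C0D.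
have [M2 _ hM2] := C0_periodic_bounded hA C0f.
pose f2 n (x : V) := (2 * Num.sqrt (u n x))^-1 * mollb (phi n) (v i) x.
have f2E n : ddir (delta_mx 0 i) (fun x => Num.sqrt (u n x)) = f2 n.
  by have [_ ->] := CE n; rewrite duE.
have C0f2 n : C0_periodic A (f2 n).
  by rewrite -f2E; apply: C1_C0_ddir; exact: (CE n).1.
have parts n : \int[mu]_y (Num.sqrt (u n (pt y)) * ddir (delta_mx 0 i) f (pt y)) =
    - \int[mu]_y (f2 n (pt y) * f (pt y)).
  have := avg_by_parts hA (delta_mx 0 i) (CE n).1 Cf.
  by rewrite f2E /avg /= => ->; rewrite opprK.
have mm n j : measurable_fun setT (fun y => mollb n (v j) (pt y)).
  exact: (measurable_moll hA n (iv j)).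
have mmt n : measurable_fun setT (fun y => mollb n th (pt y)).
  exact: (measurable_moll hA n ith).
have mu_ n : measurable_fun setT (fun y => (2 * Num.sqrt (u n (pt y)))^-1).
  apply: (measurableT_comp measurable_invr); apply: measurable_funM => //.
  exact: (C0_periodic_measurable (C1_C0 (CE n).1)).
have mdist n : measurable_fun setT (fun y => `|mollb (phi n) th (pt y) - th (pt y)|).
  by apply: measurableT_comp => //; exact: measurable_funB.
have mdisv n : measurable_fun setT (fun y => `|mollb (phi n) (v i) (pt y) - v i (pt y)|).
  by apply: measurableT_comp => //; exact: measurable_funB.
have scale0 (w : nat -> d.-tuple R -> R) : (forall n, measurable_fun setT (w n)) ->
    (forall n y, 0 <= w n y) -> (\int[mu]_y (w n y)%:E @[n --> \oo] --> 0)%E ->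
    (\int[mu]_y ((Num.sqrt e)^-1%:E * (w n y)%:E) @[n --> \oo] --> 0)%E.
  move=> mw w0 cw; rewrite (_ : (fun n => _) =
      (fun n => (Num.sqrt e)^-1%:E * \int[mu]_y (w n y)%:E)%E).
    by rewrite -[X in _ --> X](mule0 (Num.sqrt e)^-1%:E); apply: cvgeZl.
  apply/funext => n.
  have mE : measurable_fun setT (EFin \o w n) by exact/measurable_EFinP.
  by rewrite (ge0_integralZl mu measurableT mE)// => *; rewrite lee_fin.
have L1 : \int[mu]_y (Num.sqrt (u n (pt y)) * ddir (delta_mx 0 i) f (pt y)) @[n --> \oo] -->
    \int[mu]_y (Num.sqrt (e + th (pt y)) * ddir (delta_mx 0 i) f (pt y)).
  apply: (@cvg_RintegralM _ _ _ mu (fun n y => Num.sqrt (u n (pt y))) _ _ M1).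
  - by move=> n; exact: (C0_periodic_integrable hA (C1_C0 (CE n).1)).
  - by apply: integrable_sqrt_shift; exact: ltW.
  - exact: C0_periodic_measurable.
  - by move=> y; exact: hM1.
  apply: (@squeeze_cvge _ _ _ _ (cst 0%E) _ (fun n => (\int[mu]_y
    ((Num.sqrt e)^-1%:E * `|mollb (phi n) th (pt y) - th (pt y)|%:E))%E)).
  - apply: nearW => n; apply/andP; split; first by apply: integral_ge0 => y _; rewrite lee_fin.
    apply: ge0_le_integral => //.
    + apply/measurable_EFinP; apply: measurableT_comp => //; apply: measurable_funB.
        exact: (C0_periodic_measurable (C1_C0 (CE n).1)).
      exact: measurable_sqrt_shift.
    + by apply: emeasurable_funM => //; exact/measurable_EFinP.
    + move=> y _; rewrite -EFinM lee_fin (le_trans (sqrt_dist e0 (ue n _) (te y)))//.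
      by rewrite /u /= opprD addrACA subrr add0r.
  - exact: cvg_cst.
  - by apply: scale0 => //; exact: (cphi None).
have L2 : \int[mu]_y (f2 n (pt y) * f (pt y)) @[n --> \oo] -->
    \int[mu]_y ((2 * Num.sqrt (e + th (pt y)))^-1 * v i (pt y) * f (pt y)).
  pose g2 y := (2 * Num.sqrt (e + th (pt y)))^-1 * v i (pt y).
  (* The intermediate function has the mollified root but the true derivative. From [f2] to [h] the
     error is at most [1 / sqrt e] times the L^1 error of the mollified derivative; from [h] to [g2]
     dominated convergence applies. *)
  pose h n y := (2 * Num.sqrt (u n (pt y)))^-1 * v i (pt y).
  have mh n : measurable_fun setT (h n) by exact: measurable_funM.
  have mg2 : measurable_fun setT g2 by exact: measurable_grad_shift.
  have hg : (\int[mu]_y `|h n y - g2 y|%:E @[n --> \oo] --> 0)%E.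
    apply: (@dominated_cvg_real _ _ _ mu h g2 (fun y => (Num.sqrt e)^-1 * `|v i (pt y)|)) => //.
    - apply: filterS ae_phi => y hy; apply: cvgM; last exact: cvg_cst.
      apply: cvgV; first by rewrite mulf_neq0// gt_eqF// sqrtr_gt0 (lt_le_trans e0).
      apply: cvgM; first exact: cvg_cst.
      apply: (@cvg_comp _ _ _ (fun n => u n (pt y)) Num.sqrt); last exact: sqrt_continuous.
      by apply: cvgD; [exact: cvg_cst|exact: (hy None)].
    - have := integrableZl measurableT (Num.sqrt e)^-1 (integrable_abse (iv i)).
      by apply: eq_integrable.
    - apply: aeW => y n; rewrite /h normrM ler_wpM2r//.
      by have /andP[p0 p1] := inv_sqrt_le e0 (ue n (pt y)); rewrite ger0_norm.
  apply: (@cvg_RintegralM _ _ _ mu (fun n y => f2 n (pt y)) g2 _ M2).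
  - by move=> n; exact: (C0_periodic_integrable hA (C0f2 n)).
  - exact: integrable_grad_shift.
  - exact: C0_periodic_measurable.
  - by move=> y; exact: hM2.
  apply: (@squeeze_cvge _ _ _ _ (cst 0%E) _ (fun n => (\int[mu]_y
    ((Num.sqrt e)^-1%:E * `|mollb (phi n) (v i) (pt y) - v i (pt y)|%:E) +
    \int[mu]_y `|h n y - g2 y|%:E)%E)).
  - apply: nearW => n; apply/andP; split; first by apply: integral_ge0 => y _; rewrite lee_fin.
    have mhg : measurable_fun setT (EFin \o (fun y => `|h n y - g2 y|)).
      by apply/measurable_EFinP; apply: measurableT_comp => //; exact: measurable_funB.
    have mev : measurable_fun setT (fun y =>
        ((Num.sqrt e)^-1%:E * `|mollb (phi n) (v i) (pt y) - v i (pt y)|%:E)%E).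
      by apply: emeasurable_funM => //; exact/measurable_EFinP.
    rewrite -ge0_integralD//.
    apply: ge0_le_integral => //.
    + apply/measurable_EFinP; apply: measurableT_comp => //; apply: measurable_funB => //.
      exact: (C0_periodic_measurable (C0f2 n)).
    + exact: emeasurable_funD.
    + move=> y _; rewrite -EFinM -EFinD lee_fin.
      have -> : f2 n (pt y) - g2 y = (2 * Num.sqrt (u n (pt y)))^-1 *
         (mollb (phi n) (v i) (pt y) - v i (pt y)) + (h n y - g2 y).
        by rewrite /f2 /h; ring.
      rewrite (le_trans (ler_normD _ _))// lerD2r normrM ler_wpM2r//.
      by have /andP[p0 p1] := inv_sqrt_le e0 (ue n (pt y)); rewrite ger0_norm.
  - exact: cvg_cst.
  - rewrite -[X in _ --> X](adde0 0%E); apply: cvgeD => //.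
    by apply: scale0 => //; exact: (cphi (Some i)).
have := cvg_unique _ L1; apply => //.
rewrite (_ : (fun n => _) = (fun n => - \int[mu]_y (f2 n (pt y) * f (pt y)))); last exact/funext.
exact: cvgN.
Qed.

End weak_gradient_sqrt.

Lemma sqrt_le_affine {R : rcfType} (a t : R) : 0 <= a -> a <= 1 -> 0 <= t ->
  Num.sqrt (a + t) <= 2 + t.
Proof.
move=> a0 a1 t0; have := sqr_sqrtr (addr_ge0 a0 t0).
move: (Num.sqrt _) => s sE; have := sqr_ge0 (s - 1); nra.
Qed.

(** * The weak gradient of the square root *)

Section weak_gradient_sqrt_limit.
Context {R : realType} {d : nat}.
Variable A : 'M[R]_d.
Hypothesis hA : A \in unitmx.
Local Notation V := 'rV[R]_d.
Local Notation mu := (cube R d).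
Local Notation pt := (torus_pt A).
Variables (th : V -> R) (v : 'I_d -> V -> R).
Hypothesis th0 : forall x, 0 <= th x.
Hypothesis thpos : {ae mu, forall y, 0 < th (pt y)}.
Hypothesis wv : forall i, weak_partial A [:: i] th (v i).
Hypothesis ith : torus_integrable A th.
Hypothesis fin_fisher : (\int[mu]_y (fisher A th v y ^+ 2)%:E < +oo)%E.

Let iv i : torus_integrable A (v i).
Proof. by have [_ /(torus_Lp1 hA)[]] := wv i. Qed.

Let mv i : measurable_fun setT (fun y => v i (pt y)).
Proof. exact: torus_integrable_measurable. Qed.

Let mth : measurable_fun setT (fun y => th (pt y)).
Proof. exact: torus_integrable_measurable. Qed.

Definition grad_sqrt (i : 'I_d) (x : V) : R := (2 * Num.sqrt (th x))^-1 * v i x.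

Lemma grad_sqrt_sqr y : \sum_i grad_sqrt i (pt y) ^+ 2 = 4^-1 * fisher A th v y.
Proof.
rewrite /fisher mulrCA -invfM mulr_suml; apply: eq_bigr => i _.
rewrite /grad_sqrt exprMn exprVn exprMn sqr_sqrtr// mulrC; congr (_ / (_ * _)).
by rewrite expr2 -natrM.
Qed.

Lemma measurable_grad_sqrt i : measurable_fun setT (fun y => grad_sqrt i (pt y)).
Proof.
apply: measurable_funM => //; apply: (measurableT_comp measurable_invr).
by apply: measurable_funM => //; exact: (measurableT_comp measurable_sqrtr).
Qed.

Lemma measurable_fisher : measurable_fun setT (fisher A th v).
Proof.
apply: measurable_funM; last exact: (measurableT_comp measurable_invr).
by apply: measurable_sum => i; exact: (measurable_funX 2 (mv i)).
Qed.

(** Here [fin_fisher] enters: the square of the component is at most a quarter of [fisher], whose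
    square is integrable, and constants are integrable for a probability. *)
Lemma integrable_grad_sqrt i : torus_integrable A (grad_sqrt i).
Proof.
have iF : mu.-integrable setT (EFin \o (fun y => fisher A th v y ^+ 2)).
  apply/integrableP; split.
    by apply/measurable_EFinP; exact: (measurable_funX 2 measurable_fisher).
  rewrite (le_lt_trans _ fin_fisher)// le_eqVlt; apply/orP; left; apply/eqP.
  by apply: eq_integral => y _ /=; rewrite ger0_norm// sqr_ge0.
have iD := integrableD measurableT (torus_integrable_cst hA 2) iF.
apply: (le_integrable measurableT _ _ iD).
  by apply/measurable_EFinP; exact: measurable_grad_sqrt.
move=> y _ /=; rewrite lee_fin (le_trans _ (ler_norm _))//.
have gi : grad_sqrt i (pt y) ^+ 2 <= 4^-1 * fisher A th v y.
  rewrite -grad_sqrt_sqr (bigD1 i)//= lerDl; apply: sumr_ge0 => j _; exact: sqr_ge0.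
change (`|grad_sqrt i (pt y)| <= 2 + fisher A th v y ^+ 2).
move: (grad_sqrt i (pt y)) (fisher A th v y) gi => g F gF.
(* The three squares give [|g| <= g^2 + 1/4] and [F <= F^2 + 1/4]; with [g^2 <= F / 4] the bound
   [2 + F^2] holds with room to spare. *)
have := sqr_ge0 (g + 2^-1); have := sqr_ge0 (g - 2^-1); have := sqr_ge0 (F - 2^-1).
by rewrite ler_norml => *; apply/andP; split; lra.
Qed.

(** Let [e = 1/(n+1)] tend to 0 in [weak_sqrt_shift]. The roots are dominated by [2 + theta]. The
    gradients are dominated by the limit itself, because adding [e] increases the denominator; this
    comparison and the pointwise limit use positivity almost everywhere. *)
Lemma weak_sqrt i (f : V -> R) : C1_periodic A f ->
  \int[mu]_y (Num.sqrt (th (pt y)) * ddir (delta_mx 0 i) f (pt y)) =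
  - \int[mu]_y (grad_sqrt i (pt y) * f (pt y)).
Proof.
move=> Cf; have n0 n : 0 < n.+1%:R^-1 :> R by rewrite invr_gt0.
have n1 n : n.+1%:R^-1 <= 1 :> R by rewrite invf_le1// ler1n.
have C0D := C1_C0_ddir (delta_mx 0 i) Cf; have C0f := C1_C0 Cf.
have [M1 _ hM1] := C0_periodic_bounded hA C0D.
have [M2 _ hM2] := C0_periodic_bounded hA C0f.
have csqrt y : Num.sqrt (n.+1%:R^-1 + th (pt y)) @[n --> \oo] --> Num.sqrt (th (pt y)).
  have c : n.+1%:R^-1 + th (pt y) @[n --> \oo] --> th (pt y).
    by rewrite -[X in _ --> X]add0r; apply: cvgD; [exact: cvg_harmonic|exact: cvg_cst].
  apply: (@cvg_comp _ _ _ (fun n => n.+1%:R^-1 + th (pt y)) Num.sqrt); first exact: c.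
  exact: sqrt_continuous.
have msq : measurable_fun setT (fun y => Num.sqrt (th (pt y))).
  exact: (measurableT_comp measurable_sqrtr mth).
have isq : mu.-integrable setT (EFin \o (fun y => Num.sqrt (th (pt y)))).
  have := integrable_sqrt_shift hA th0 ith (lexx 0).
  by apply: eq_integrable => // y _ /=; rewrite add0r.
have L1 : \int[mu]_y (Num.sqrt (n.+1%:R^-1 + th (pt y)) * ddir (delta_mx 0 i) f (pt y))
    @[n --> \oo] --> \int[mu]_y (Num.sqrt (th (pt y)) * ddir (delta_mx 0 i) f (pt y)).
  apply: (@cvg_RintegralM _ _ _ mu (fun n y => Num.sqrt (n.+1%:R^-1 + th (pt y))) _ _ M1) => //.
  - by move=> n; apply: (integrable_sqrt_shift hA th0 ith); exact: ltW.
  - exact: C0_periodic_measurable.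
  apply: (@dominated_cvg_real _ _ _ mu _ _ (fun y => 2 + th (pt y))) => //.
  - by move=> n; exact: (measurable_sqrt_shift ith).
  - exact: aeW.
  - exact: (integrableD measurableT (torus_integrable_cst hA 2) ith).
  - apply: aeW => y n; rewrite (ger0_norm (sqrtr_ge0 _)).
    by apply: sqrt_le_affine => //; exact: ltW.
have L2 : \int[mu]_y ((2 * Num.sqrt (n.+1%:R^-1 + th (pt y)))^-1 * v i (pt y) * f (pt y))
    @[n --> \oo] --> \int[mu]_y (grad_sqrt i (pt y) * f (pt y)).
  apply: (@cvg_RintegralM _ _ _ mu (fun n y =>
    (2 * Num.sqrt (n.+1%:R^-1 + th (pt y)))^-1 * v i (pt y)) _ _ M2) => //.
  - by move=> n; exact: (integrable_grad_shift hA th0 wv ith i (n0 n)).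
  - exact: integrable_grad_sqrt.
  - exact: C0_periodic_measurable.
  apply: (@dominated_cvg_real _ _ _ mu _ _ (fun y => `|grad_sqrt i (pt y)|)) => //.
  - by move=> n; exact: (measurable_grad_shift hA wv ith).
  - exact: measurable_grad_sqrt.
  - apply: filterS thpos => y ty; apply: cvgM; last exact: cvg_cst.
    apply: cvgV; first by rewrite mulf_neq0// gt_eqF// sqrtr_gt0.
    by apply: cvgM; [exact: cvg_cst|exact: csqrt].
  - exact: (integrable_abse (integrable_grad_sqrt i)).
  - apply: filterS thpos => y ty n; rewrite /grad_sqrt !normrM ler_wpM2r//.
    have s0 : 0 < Num.sqrt (th (pt y)) by rewrite sqrtr_gt0.
    have ss : Num.sqrt (th (pt y)) <= Num.sqrt (n.+1%:R^-1 + th (pt y)).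
      by apply: ler_wsqrtr; rewrite lerDr ltW.
    rewrite !ger0_norm ?invr_ge0 ?mulr_ge0 ?sqrtr_ge0// lef_pV2 ?posrE ?mulr_gt0//.
      by rewrite ler_wpM2l.
    exact: lt_le_trans ss.
have := cvg_unique _ L1; apply => //.
rewrite (_ : (fun n => _) = (fun n => - \int[mu]_y
    ((2 * Num.sqrt (n.+1%:R^-1 + th (pt y)))^-1 * v i (pt y) * f (pt y)))).
  exact: cvgN.
by apply/funext => n; exact: (weak_sqrt_shift hA th0 wv ith).
Qed.

Lemma weak_partial_sqrt i :
  weak_partial A [:: i] (fun x => Num.sqrt (th x)) (grad_sqrt i).
Proof.
have [/(torus_Lp1 hA)[pth _] /(torus_Lp1 hA)[pv _] _] := wv i.
have isq : torus_integrable A (fun x => Num.sqrt (th x)).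
  have := integrable_sqrt_shift hA th0 ith (lexx 0).
  by apply: eq_integrable => // y _ /=; rewrite add0r.
have ig := integrable_grad_sqrt i.
split.
- by apply/(torus_Lp1 hA); split=> // j x; rewrite pth.
- by apply/(torus_Lp1 hA); split=> // j x; rewrite /grad_sqrt pth pv.
move=> f sf pf; have Cf := smooth_C1 sf pf.
have iD := torus_integrableM hA isq (C1_C0_ddir (delta_mx 0 i) Cf).
rewrite (Rintegral_torus_measure A iD).
rewrite (Rintegral_torus_measure A (torus_integrableM hA ig (C1_C0 Cf))).
by rewrite [X in _ * X](weak_sqrt i Cf) expr1 mulN1r mulrN.
Qed.

End weak_gradient_sqrt_limit.

(** * Weak derivatives and equality almost everywhere *)

Section almost_everywhere.
Context {R : realType} {d : nat}.
Variable A : 'M[R]_d.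
Hypothesis hA : A \in unitmx.
Local Notation V := 'rV[R]_d.
Local Notation mu := (cube R d).
Local Notation pt := (torus_pt A).
Implicit Types (f g : V -> R).

Lemma torus_integrable_ae f g : torus_integrable A f -> measurable_fun setT (g \o pt) ->
  {ae mu, forall y, g (pt y) = f (pt y)} -> torus_integrable A g.
Proof.
move=> hf mg gf; have mf := torus_integrable_measurable hf.
apply/integrableP; split; first exact/measurable_EFinP.
move/integrableP: hf => [_]; rewrite (_ : (\int[mu]_y `|(EFin \o (f \o pt)) y|)%E =
  (\int[mu]_y `|(EFin \o (g \o pt)) y|)%E)//.
apply: ae_eq_integral => //.
- by apply: measurableT_comp => //; exact/measurable_EFinP.
- by apply: measurableT_comp => //; exact/measurable_EFinP.
- by apply: filterS gf => y gfy _ /=; rewrite gfy.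
Qed.

(** Only integrals of [f] enter the definition, apart from periodicity, which is required at every
    point and is therefore a separate hypothesis on [g]. This permits passing from [theta] to its
    absolute value and back. *)
Lemma weak_partial_ae s f g h : weak_partial A s f h -> Defs.periodic A g ->
  measurable_fun setT (g \o pt) -> {ae mu, forall y, g (pt y) = f (pt y)} ->
  weak_partial A s g h.
Proof.
move=> [/(torus_Lp1 hA)[pf hf] hh fh] pg mg gf.
have hg := torus_integrable_ae hf mg gf.
split=> //; first exact/(torus_Lp1 hA).
move=> phi sphi pphi; rewrite -fh//.
have Cp : C0_periodic A (partial s phi).
  split; first by move=> x; apply: differentiable_continuous; exact: sphi.
  by elim: (s) => // i s' ih; exact: periodic_derive.
rewrite (Rintegral_torus_measure A (torus_integrableM hA hg Cp)).
rewrite (Rintegral_torus_measure A (torus_integrableM hA hf Cp)).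
congr (_ * fine _); apply: ae_eq_integral => //.
- exact: (measurable_int mu (torus_integrableM hA hg Cp)).
- exact: (measurable_int mu (torus_integrableM hA hf Cp)).
- by apply: filterS gf => y gfy _ /=; rewrite gfy.
Qed.

Lemma weak_partial_unique s f g1 g2 : weak_partial A s f g1 -> weak_partial A s f g2 ->
  {ae mu, forall y, g1 (pt y) = g2 (pt y)}.
Proof.
move=> w1 w2.
have i1 : torus_integrable A g1 by have [_ /(torus_Lp1 hA)[]] := w1.
have i2 : torus_integrable A g2 by have [_ /(torus_Lp1 hA)[]] := w2.
have m1 := torus_integrable_measurable i1; have m2 := torus_integrable_measurable i2.
have mE n : moll A (torus_bump A n) g1 = moll A (torus_bump A n) g2.
  rewrite -(weak_partial_moll hA w1 (trig_bump A n)).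
  exact: (weak_partial_moll hA w2 (trig_bump A n)).
have md (g : V -> R) n : torus_integrable A g ->
    measurable_fun setT (EFin \o (fun y => `|moll A (torus_bump A n) g (pt y) - g (pt y)|)).
  move=> ig; apply/measurable_EFinP; apply: measurableT_comp => //.
  by apply: measurable_funB; [exact: measurable_moll|exact: torus_integrable_measurable].
have m12 : measurable_fun setT (EFin \o (fun y => g1 (pt y) - g2 (pt y))).
  by apply/measurable_EFinP; exact: measurable_funB.
have z : (\int[mu]_y `|(g1 (pt y) - g2 (pt y))%:E| = 0)%E.
  apply/eqP; rewrite eq_le integral_ge0// andbT.
  have c : (\int[mu]_y `|moll A (torus_bump A n) g1 (pt y) - g1 (pt y)|%:E +
      \int[mu]_y `|moll A (torus_bump A n) g2 (pt y) - g2 (pt y)|%:E @[n --> \oo] --> 0)%E.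
    by rewrite -[X in _ --> X](adde0 0%E); apply: cvgeD => //; exact: cvg_moll.
  apply: (cvge_ge _ c); apply: nearW => n.
  rewrite -ge0_integralD//; [|exact: md..].
  apply: ge0_le_integral => //.
  - exact: measurableT_comp.
  - by apply: emeasurable_funD; exact: md.
  move=> y _ /=; rewrite lee_fin mE distrC.
  (* The common mollification is inserted, so that [|g1 - g2|] is bounded by the two mollification
     errors. *)
  have -> : g2 (pt y) - g1 (pt y) = (moll A (torus_bump A n) g2 (pt y) - g1 (pt y)) -
    (moll A (torus_bump A n) g2 (pt y) - g2 (pt y)) by ring.
  exact: ler_normB.
have := (ae_eq_integral_abs mu measurableT m12).1 z.
by apply: filterS => y /(_ I) /= [] /eqP; rewrite subr_eq0 => /eqP.
Qed.

Lemma ae_torus_measure (P : d.-tuple R -> Prop) :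
  {ae torus_measure A, forall y, P y} -> {ae mu, forall y, P y}.
Proof.
move=> [N [mN N0 sN]]; exists N; split=> //.
move: N0; rewrite /torus_measure /mscale/= => /eqP.
by rewrite mule_eq0 eqe gt_eqF ?(det_gt0 hA)//= => /eqP.
Qed.

End almost_everywhere.

Lemma euclidean_norm4 (R : realType) (d : nat) (u : 'rV[R]_d) :
  euclidean_norm u ^+ 4 = (\sum_i u 0 i ^+ 2) ^+ 2.
Proof.
by rewrite (exprM _ 2 2) sqr_sqrtr// sumr_ge0// => i _; exact: sqr_ge0.
Qed.

(** From [(a + b)^2 <= 2 (a^2 + b^2)], along the list. It puts the Laplacian of an H^2 function in
    L^2. *)
Lemma integrable_sqr_sum {R : realType} (d' : measure_display) (T : measurableType d')
    (mu : probability T R) (I : Type) (r : seq I) (F : I -> T -> R) :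
  (forall i, measurable_fun setT (F i)) ->
  (forall i, mu.-integrable setT (EFin \o (fun y => F i y ^+ 2))) ->
  mu.-integrable setT (EFin \o (fun y => (\sum_(i <- r) F i y) ^+ 2)).
Proof.
move=> mF iF; elim: r => [|i r ih].
  rewrite (_ : _ \o _ = cst 0%E); first exact: integrable0.
  by apply/funext => y; rewrite /= big_nil expr0n.
have i2 := integrableZl measurableT 2 (integrableD measurableT (iF i) ih).
apply: (le_integrable measurableT _ _ i2).
  apply/measurable_EFinP; apply: (measurable_funX 2).
  by apply: measurable_sum => j; exact: mF.
move=> y _ /=; rewrite lee_fin big_cons ger0_norm ?sqr_ge0// (le_trans _ (ler_norm _))//.
have := sqr_ge0 (F i y - \sum_(j <- r) F j y); lra.
Qed.

(** * The inequality for arbitrary weak gradients and Laplacians of an H^2 function *)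

Theorem proposition2p8 (R : realType) (d : nat) (hd : (1 <= d)%N)
    (A : 'M[R]_d) (hA : A \in unitmx) (theta : 'rV[R]_d -> R)
    (theta_H2 : sobolev_H A 2 theta)
    (theta_pos : {ae torus_measure A, forall y, 0 < theta (torus_pt A y)}) :
  (exists G, weak_gradient A (fun x => Num.sqrt (theta x)) G) /\
  (forall G L,
    weak_gradient A (fun x => Num.sqrt (theta x)) G ->
    weak_laplacian A theta L ->
    (\int[torus_measure A]_y (euclidean_norm (G (torus_pt A y)) ^+ 4)%:E
     <= (9 / 16)%:E *
        \int[torus_measure A]_y (L (torus_pt A y) ^+ 2)%:E)%E).
Proof.
have [_ hs] := theta_H2.
(* The empty list of derivatives yields periodicity and L^1 integrability of [theta] itself. *)
have [_ [_ [/(torus_Lp1 hA)[ptheta itheta] _ _]]] := hs [::] isT.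
have /choice[v wv0] : forall i, exists v, weak_partial A [:: i] theta v.
  by move=> i; have [v [_ ?]] := hs [:: i] isT; exists v.
have /choice[H wH0] : forall i, exists h,
    torus_Lp A 2%:E h /\ weak_partial A [:: i; i] theta h.
  by move=> i; have [h ?] := hs [:: i; i] isT; exists h.
have mtheta := torus_integrable_measurable itheta.
have pos := ae_torus_measure hA theta_pos.
(* [theta] may be nonpositive on a null set, where mollification needs a sign. *)
pose th x := `|theta x|.
have th0 x : 0 <= th x by exact: normr_ge0.
have pth : Defs.periodic A th by move=> i x; rewrite /th ptheta.
have mth : measurable_fun setT (th \o torus_pt A) by exact: measurableT_comp.
have thE : {ae cube R d, forall y, th (torus_pt A y) = theta (torus_pt A y)}.
  by apply: filterS pos => y ty; rewrite /th gtr0_norm.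
have thpos : {ae cube R d, forall y, 0 < th (torus_pt A y)}.
  by apply: filterS pos => y ty; rewrite /th gtr0_norm.
have ith := torus_integrable_ae itheta mth thE.
have toth s h : weak_partial A s theta h -> weak_partial A s th h.
  by move=> w; exact: (weak_partial_ae hA w pth mth thE).
have wv i := toth _ _ (wv0 i).
have lap L : weak_laplacian A theta L -> weak_laplacian A th L.
  by move=> [K [wK LE]]; exists K; split=> // i; exact: toth.
have bound L (wL : weak_laplacian A theta L) := fisher_bound hA th0 thpos wv ith (lap L wL).
(* The bound is applied to the Laplacian assembled from the L^2 derivatives [H i] given by H^2,
   before any given [L] is considered: its right side is finite, and this finiteness feeds the chain
   rule for the root. *)
have finF : (\int[cube R d]_y (fisher A th v y ^+ 2)%:E < +oo)%E.
  have wL : weak_laplacian A theta (fun x => \sum_i H i x).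
    by exists H; split=> // i; have [] := wH0 i.
  apply: (le_lt_trans (bound _ wL)); apply: lte_mul_pinfty => //.
  have iS := @integrable_sqr_sum _ _ _ (cube R d) _ (index_enum 'I_d)
    (fun i y => H i (torus_pt A y)).
  have /integrableP[_] := iS
    (* Measurability of [H i] is read off the L^1 membership contained in its [weak_partial]. *)
    (fun i => torus_integrable_measurable (((torus_Lp1 hA (H i)).1 (let: And3 _ h _ := (wH0 i).2 in h)).2))
    (fun i => torus_Lp2_sqr hA (wH0 i).1).
  apply: le_lt_trans; rewrite le_eqVlt; apply/orP; left; apply/eqP.
  by apply: eq_integral => y _ /=; rewrite ger0_norm// sqr_ge0.
have wg i := weak_partial_sqrt hA th0 thpos wv ith finF i.
(* Back from the absolute value to [theta]: the two square roots differ on a null set only. *)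
have wsqrt i : weak_partial A [:: i] (fun x => Num.sqrt (theta x)) (grad_sqrt th v i).
  apply: (weak_partial_ae hA (wg i)).
  - by move=> j x; rewrite ptheta.
  - exact: (measurableT_comp measurable_sqrtr mtheta).
  - by apply: filterS thE => y ->.
split.
  exists (fun x => \row_i grad_sqrt th v i x) => i.
  have -> : (fun x => (\row_j grad_sqrt th v j x) 0 i) = grad_sqrt th v i.
    by apply/funext => x; rewrite mxE.
  exact: wsqrt.
move=> G L wG wL.
have iG i : torus_integrable A (fun x => G x 0 i).
  by have [_ /(torus_Lp1 hA)[]] := wG i.
have mG : measurable_fun setT
    (fun y => (\sum_i G (torus_pt A y) 0 i ^+ 2) ^+ 2).
  apply: (measurable_funX 2); apply: measurable_sum => i.
  exact: (measurable_funX 2 (torus_integrable_measurable (iG i))).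
have mL : measurable_fun setT (fun y => L (torus_pt A y) ^+ 2).
  apply: (measurable_funX 2); have [K [wK LE]] := wL.
  rewrite (_ : (fun y => _) = (fun y => \sum_i K i (torus_pt A y))); last first.
    by apply/funext => y; rewrite LE.
  apply: measurable_sum => i; have [_ /(torus_Lp1 hA)[_ iK] _] := wK i.
  exact: torus_integrable_measurable.
under eq_integral do rewrite euclidean_norm4.
rewrite !(ge0_integral_torus_measure A); first last.
- by move=> y; rewrite lee_fin sqr_ge0.
- exact/measurable_EFinP.
- by move=> y; rewrite lee_fin sqr_ge0.
- exact/measurable_EFinP.
(* The volume of the torus multiplies both sides and is removed; what remains is an inequality on
   the unit cube. *)
rewrite [leRHS]muleCA; apply: lee_wpmul2l; first by rewrite lee_fin.
have aeG : {ae cube R d, forall y i, G (torus_pt A y) 0 i = grad_sqrt th v i (torus_pt A y)}.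
  apply: filter_forall => i; exact: (weak_partial_unique hA (wG i) (wsqrt i)).
have mF := measurable_fisher hA wv ith.
(* By uniqueness the given gradient has squared length [fisher / 4] almost everywhere, hence fourth
   power [fisher^2 / 16]. *)
have -> : (\int[cube R d]_y ((\sum_i G (torus_pt A y) 0 i ^+ 2) ^+ 2)%:E =
    16^-1%:E * \int[cube R d]_y (fisher A th v y ^+ 2)%:E)%E.
  rewrite -ge0_integralZl//; last first.
  - by move=> y _; rewrite lee_fin sqr_ge0.
  - by apply/measurable_EFinP; exact: (measurable_funX 2 mF).
  apply: ae_eq_integral => //.
  - exact/measurable_EFinP.
  - by apply: emeasurable_funM => //; apply/measurable_EFinP; exact: (measurable_funX 2 mF).
  - apply: filterS aeG => y Gy _; rewrite -EFinM; congr EFin.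
    under eq_bigr do rewrite Gy.
    rewrite (grad_sqrt_sqr A v th0) exprMn; congr (_ * _).
    by rewrite exprVn; congr (_^-1); rewrite expr2 -natrM.
apply: (le_trans (lee_wpmul2l _ (bound L wL))); first by rewrite lee_fin.
by rewrite muleA -EFinM mulrC.
Qed.
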